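(* Let $\alpha'\in\mathbb{R}\setminus\{0\}$ and $b\in\mathbb{R}$. For $c>0$ consider the $SU(2)^2$-invariant local singular solution of the IIB system on the conifold with parameters $(\alpha',b)$ and squashing parameter $c$ described in the context. (i) If $c>1$, the solution is forward complete and asymptotically conical, i.e. at infinity it approaches $(\omega_{\mathrm C},\Omega_{\mathrm C},e^{\phi_\infty})$ for some $\phi_\infty\in\mathbb{R}$. (ii) For $c>1$, the asymptotic value $\phi_\infty$ of the dilaton is increasing in $c$. (iii) The solution corresponding to $c=1$ is the CV--MN solution on the resolved conifold, which for $\alpha'>0$ is $$u_\ast=\tfrac92\alpha's+b+\tfrac32\alpha',\qquad e^{2\phi_\ast}=\tfrac1{\sqrt3}\,\tfrac92\alpha'\,e^{-3s}\sqrt{\tfrac92\alpha's+b+\tfrac34\alpha'} .$$ (iv) If $0<c<1$, the solution is forward incomplete.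
   Context: IIB system. An $SU(3)$-structure on a 6-manifold is a pair $(\omega,\Omega)$ of a real non-degenerate 2-form and a locally decomposable complex 3-form with $\omega\wedge\Omega=0$, $2\omega^3=3\,\mathrm{Re}\,\Omega\wedge\mathrm{Im}\,\Omega$, such that $g=\omega(\cdot,J\cdot)$ is positive definite, where $J$ is the almost complex structure for which a complex 1-form $\alpha$ is of type $(1,0)$ iff $\alpha\wedge\Omega=0$. For a $k$-form $\beta$ set $J\beta=(-1)^k\beta(J\cdot,\dots,J\cdot)$, and $d^c\omega=J\,d\omega$. A triple $(\omega,\Omega,\phi)$ solves the IIB system if $d(e^{-2\phi}\Omega)=0$, $d(e^{-2\phi}\omega^2)=0$, $dd^c\omega=0$. The function $\phi$ is called the dilaton. Homogeneous forms. Let $\eta_1,\eta_2,\eta_3$ and $\eta_1',\eta_2',\eta_3'$ be bases of left-invariant 1-forms on the two factors of $SU(2)^2$ with $d\eta_i=2\eta_j\wedge\eta_k$, $d\eta_i'=2\eta_j'\wedge\eta_k'$ for $(ijk)$ cyclic permutations of $(123)$, and $\Sigma=SU(2)^2/\triangle U(1)$, with $U(1)\subset SU(2)$ generated by the vector field dual to the first basis element. The following descend to invariant forms on $\Sigma$: $\eta^{se}=\frac23(\eta_1-\eta_1')$, $\omega_1^{se}=\frac23(\eta_2\wedge\eta_3-\eta_2'\wedge\eta_3')$, $\omega_0^{se}=\frac23(\eta_2\wedge\eta_3+\eta_2'\wedge\eta_3')$, $\omega_2^{se}=-\frac23(\eta_2\wedge\eta_2'+\eta_3\wedge\eta_3')$,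 $\omega_3^{se}=\frac23(\eta_2\wedge\eta_3'+\eta_2'\wedge\eta_3)$. Solutions. Put $V=e^{3s}$ and $u_0=\frac92\alpha's+b$. A pair of functions $(u,\phi)$ of $s$ with $u>0$, $\partial_su>0$, $u^2-u_0^2>0$ satisfying $$\partial_su=\frac{2V^2e^{4\phi}}{u^2-u_0^2},\qquad \partial_s\phi=-\frac{u_0\,\partial_su_0}{u^2-u_0^2}$$ defines an invariant solution of the IIB system on $I_s\times\Sigma$ ($I$ the interval of definition) by $$\omega=\tfrac12\partial_su\,ds\wedge\eta^{se}+u\,\omega_1^{se}+u_0\omega_0^{se},\qquad \Omega=e^{2\phi}e^{3s}(ds+i\eta^{se})\wedge(\omega_2^{se}+i\omega_3^{se}).$$ The family. Suppose first $\alpha'>0$. For $c>0$ let $u_c=u_0+\frac32c\alpha'$, let $s_c$ be the value of $s$ with $u_c+u_0=0$, i.e. $s_c=-(\frac92\alpha')^{-1}(b+\frac34c\alpha')$, let $\sigma=s-s_c$, and define $\phi_c$ for $\sigma>0$ by $\frac{2e^{6s}e^{4\phi_c}}{u_c^2-u_0^2}=\frac92\alpha'$. For each $c>0$ there is a unique solution $(u,\phi)$ of the ODE system, defined for small $\sigma>0$, of the form $u=u_c+\sigma^2X$, $\phi=\phi_c+\sigma Y$ with $X,Y$ smooth up to $\sigma=0$; this is the solution with squashing parameter $c$. If $\alpha'<0$, the solution with parameters $(\alpha',b)$ and $c$ is given by the pair $(u,\phi)$ associated with $(-\alpha',-b)$ and $c$ (the ODE system only depends on $u_0$ up to sign). The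 solution is forward complete if it extends to all $s\in(s_c,\infty)$ and the metric is complete on $\{s\ge s_1\}$ for every $s_1>s_c$; otherwise (for its maximal extension) it is forward incomplete. Cone. On $\mathrm C=(0,\infty)_r\times\Sigma$: $\omega_{\mathrm C}=r\,dr\wedge\eta^{se}+r^2\omega_1^{se}$, $\Omega_{\mathrm C}=(dr+ir\eta^{se})\wedge r^2(\omega_2^{se}+i\omega_3^{se})$. ''Approaches $(\omega_{\mathrm C},\Omega_{\mathrm C},e^{\phi_\infty})$'' means: after a change of variable $r=r(s)$ near infinity, $|\omega-\omega_{\mathrm C}|$, $|\Omega-\Omega_{\mathrm C}|$ (norms of the cone metric) and $|\phi-\phi_\infty|$ tend to $0$ as $r\to\infty$. *)

(* Defs.v *)
From Stdlib Require Import Reals ClassicalEpsilon.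
From Coquelicot Require Import Coquelicot.
Open Scope R_scope.

(** * Invariant forms on I x Sigma *)

(** A tangent vector of I x Sigma at the class of (s, p), p in SU(2)^2, given
    by its components in the coframe
    (ds, eta^se, eta_2, eta_3, eta_2', eta_3') at p.  The last four covectors
    depend on the choice of p in its U(1)-orbit, but the forms built below do
    not, and an invariant form is determined by its value at one such p. *)
Definition tangent : Type := (R * R * R * R * R * R)%type.

Definition ds (v : tangent) : R := fst (fst (fst (fst (fst v)))).
Definition eta_se (v : tangent) : R := snd (fst (fst (fst (fst v)))).
Definition eta2 (v : tangent) : R := snd (fst (fst (fst v))).
Definition eta3 (v : tangent) : R := snd (fst (fst v)).
Definition eta2' (v : tangent) : R := snd (fst v).
Definition eta3' (v : tangent) : R := snd v.

Definition wedge (a b : tangent -> R) : tangent -> tangent -> R :=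
  fun x y => a x * b y - a y * b x.

Definition wedge12 (a : tangent -> C) (b : tangent -> tangent -> C) :
  tangent -> tangent -> tangent -> C :=
  fun x y z => (a x * b y z - a y * b x z + a z * b x y)%C.

Definition wedge13 (a : tangent -> C) (b : tangent -> tangent -> tangent -> C) :
  tangent -> tangent -> tangent -> tangent -> C :=
  fun x y z w =>
    (a x * b y z w - a y * b x z w + a z * b x y w - a w * b x y z)%C.

Definition omega_se1 (x y : tangent) : R :=
  2 / 3 * (wedge eta2 eta3 x y - wedge eta2' eta3' x y).
Definition omega_se0 (x y : tangent) : R :=
  2 / 3 * (wedge eta2 eta3 x y + wedge eta2' eta3' x y).
Definition omega_se2 (x y : tangent) : R :=
  - (2 / 3) * (wedge eta2 eta2' x y + wedge eta3 eta3' x y).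
Definition omega_se3 (x y : tangent) : R :=
  2 / 3 * (wedge eta2 eta3' x y + wedge eta2' eta3 x y).

Definition omega_se23 (x y : tangent) : C :=
  (RtoC (omega_se2 x y) + Ci * RtoC (omega_se3 x y))%C.

(** * Almost complex structure, metric and norms *)

Definition linear_end (J : tangent -> tangent) : Prop :=
  forall (k : R) (x y : tangent),
    J (plus (scal k x) y) = plus (scal k (J x)) (J y).

Definition linear_C (a : tangent -> C) : Prop :=
  forall (k : R) (x y : tangent),
    a (plus (scal k x) y) = (RtoC k * a x + a y)%C.

(** A complex 1-form [a] is of type (1,0) for [J] iff [a (J v) = i * a v]. *)
Definition is_acs (Omega : tangent -> tangent -> tangent -> C)
    (J : tangent -> tangent) : Prop :=
  linear_end J /\
  (forall v, J (J v) = opp v) /\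
  (forall a : tangent -> C, linear_C a ->
     ((forall v, a (J v) = (Ci * a v)%C) <->
      (forall x y z w, wedge13 a Omega x y z w = RtoC 0))).

Definition acs (Omega : tangent -> tangent -> tangent -> C) :
  tangent -> tangent :=
  epsilon (inhabits (fun v : tangent => v)) (is_acs Omega).

Definition metric (omega : tangent -> tangent -> R)
    (Omega : tangent -> tangent -> tangent -> C) : tangent -> tangent -> R :=
  fun x y => omega x (acs Omega y).

(** [e 0, ..., e 5] is a [g]-orthonormal frame. *)
Definition orthonormal (g : tangent -> tangent -> R) (e : nat -> tangent) :
  Prop :=
  forall i j, (i < 6)%nat -> (j < 6)%nat ->
    g (e i) (e j) = if Nat.eqb i j then 1 else 0.

Definition frame (g : tangent -> tangent -> R) : nat -> tangent :=
  epsilon (inhabits (fun _ : nat => (0, 0, 0, 0, 0, 0))) (orthonormal g).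

(** Norms of a real 2-form and of a complex 3-form, as sums over increasing
    indices of a [g]-orthonormal frame; they do not depend on the frame. *)
Definition norm2 (g : tangent -> tangent -> R) (b : tangent -> tangent -> R) :
  R :=
  sqrt (sum_n (fun j => sum_n (fun i =>
    if Nat.ltb i j then b (frame g i) (frame g j) ^ 2 else 0) 5) 5).

Definition norm3 (g : tangent -> tangent -> R)
    (b : tangent -> tangent -> tangent -> C) : R :=
  sqrt (sum_n (fun k => sum_n (fun j => sum_n (fun i =>
    if andb (Nat.ltb i j) (Nat.ltb j k)
    then Cmod (b (frame g i) (frame g j) (frame g k)) ^ 2 else 0) 5) 5) 5).

(** * The ODE system *)

Definition u0 (alpha b s : R) : R := 9 / 2 * alpha * s + b.

Definition V (s : R) : R := exp (3 * s).

Definition solves_on (alpha b lo : R) (hi : Rbar) (u phi : R -> R) : Prop :=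
  forall s, lo < s -> Rbar_lt s hi ->
    0 < u s /\ 0 < Derive u s /\ 0 < u s ^ 2 - u0 alpha b s ^ 2 /\
    is_derive u s
      (2 * V s ^ 2 * exp (4 * phi s) / (u s ^ 2 - u0 alpha b s ^ 2)) /\
    is_derive phi s
      (- (u0 alpha b s * Derive (u0 alpha b) s /
          (u s ^ 2 - u0 alpha b s ^ 2))).

Definition omega_sol (alpha b : R) (u : R -> R) (s : R) :
  tangent -> tangent -> R :=
  fun x y => / 2 * Derive u s * wedge ds eta_se x y
             + u s * omega_se1 x y + u0 alpha b s * omega_se0 x y.

Definition Omega_sol (phi : R -> R) (s : R) :
  tangent -> tangent -> tangent -> C :=
  fun x y z => (RtoC (exp (2 * phi s) * exp (3 * s)) *
    wedge12 (fun v => RtoC (ds v) + Ci * RtoC (eta_se v)) omega_se23 x y z)%C.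

Definition metric_sol (alpha b : R) (u phi : R -> R) (s : R) :
  tangent -> tangent -> R :=
  metric (omega_sol alpha b u s) (Omega_sol phi s).

(** * The family of singular solutions *)

Definition s_sing (alpha b c : R) : R :=
  - (/ (9 / 2 * alpha) * (b + 3 / 4 * c * alpha)).

Definition u_c (alpha b c s : R) : R := u0 alpha b s + 3 / 2 * c * alpha.

(** For [0 < alpha] and [s_sing alpha b c < s], the real number [p] with
    [2 * exp (6 * s) * exp (4 * p) / (u_c^2 - u0^2) = 9 / 2 * alpha]. *)
Definition phi_c (alpha b c s : R) : R :=
  / 4 * ln (9 / 2 * alpha * (u_c alpha b c s ^ 2 - u0 alpha b s ^ 2)
            / (2 * exp (6 * s))).

(** Smoothness on [0, eps) in the sense that every derivative on (0, eps)
    extends continuously to 0. *)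
Definition smooth_up_to_0 (eps : R) (f : R -> R) : Prop :=
  forall n : nat,
    (forall t, 0 < t < eps -> ex_derive_n f n t) /\
    (exists l : R, filterlim (Derive_n f n) (at_right 0) (locally l)).

Definition squashed_solution_pos (alpha b c : R) (hi : Rbar) (u phi : R -> R) :
  Prop :=
  solves_on alpha b (s_sing alpha b c) hi u phi /\
  exists (eps : R) (X Y : R -> R),
    0 < eps /\ smooth_up_to_0 eps X /\ smooth_up_to_0 eps Y /\
    forall sigma, 0 < sigma < eps ->
      let s := s_sing alpha b c + sigma in
      u s = u_c alpha b c s + sigma ^ 2 * X sigma /\
      phi s = phi_c alpha b c s + sigma * Y sigma.

(** [(u, phi)], restricted to (s_c, hi), is the solution with parameters
    [(alpha, b)] and squashing parameter [c]. *)
Definition squashed_solution (alpha b c : R) (hi : Rbar) (u phi : R -> R) :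
  Prop :=
  if Rlt_dec 0 alpha then squashed_solution_pos alpha b c hi u phi
  else squashed_solution_pos (- alpha) (- b) c hi u phi.

Definition u_CVMN (alpha b s : R) : R :=
  if Rlt_dec 0 alpha then 9 / 2 * alpha * s + b + 3 / 2 * alpha
  else 9 / 2 * (- alpha) * s + (- b) + 3 / 2 * (- alpha).

Definition exp_2phi_CVMN_pos (alpha b s : R) : R :=
  / sqrt 3 * (9 / 2 * alpha) * exp (- (3 * s))
  * sqrt (9 / 2 * alpha * s + b + 3 / 4 * alpha).

Definition exp_2phi_CVMN (alpha b s : R) : R :=
  if Rlt_dec 0 alpha then exp_2phi_CVMN_pos alpha b s
  else exp_2phi_CVMN_pos (- alpha) (- b) s.

Definition phi_CVMN (alpha b s : R) : R := / 2 * ln (exp_2phi_CVMN alpha b s).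

(** * Completeness *)

(** SU(2) is identified with the unit quaternions. *)
Definition quat : Type := (R * R * R * R)%type.

Definition qmul (p q : quat) : quat :=
  let '(p0, p1, p2, p3) := p in
  let '(q0, q1, q2, q3) := q in
  (p0 * q0 - p1 * q1 - p2 * q2 - p3 * q3,
   p0 * q1 + p1 * q0 + p2 * q3 - p3 * q2,
   p0 * q2 - p1 * q3 + p2 * q0 + p3 * q1,
   p0 * q3 + p1 * q2 - p2 * q1 + p3 * q0).

Definition qconj (p : quat) : quat :=
  let '(p0, p1, p2, p3) := p in (p0, - p1, - p2, - p3).

Definition unit_quat (p : quat) : Prop := qmul (qconj p) p = (1, 0, 0, 0).

(** The left-invariant forms (eta_1, eta_2, eta_3) on a tangent vector [w] at
    [q].  The Maurer-Cartan form theta = q^-1 dq satisfies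
    d theta_i = - 2 theta_j /\ theta_k, so that eta_i = - theta_i satisfies
    d eta_i = 2 eta_j /\ eta_k. *)
Definition eta (q w : quat) : R * R * R :=
  let '(_, t1, t2, t3) := qmul (qconj q) w in (- t1, - t2, - t3).

(** Points of R x SU(2)^2, inside R x R^4 x R^4. *)
Definition point : Type := (R * (quat * quat))%type.

(** Projection to I x Sigma of a vector [v] tangent to I x SU(2)^2 at [x]. *)
Definition project (x v : point) : tangent :=
  let '(_, (q, q')) := x in
  let '(k, (w, w')) := v in
  let '(e1, e2, e3) := eta q w in
  let '(e1', e2', e3') := eta q' w' in
  (k, 2 / 3 * (e1 - e1'), e2, e3, e2', e3').

Definition end_region (s1 : R) (x : point) : Prop :=
  s1 <= fst x /\ unit_quat (fst (snd x)) /\ unit_quat (snd (snd x)).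

(** [path_length g s1 x y l]: the classes of [x] and [y] in I x Sigma are
    joined inside {s >= s1} by a piecewise C^1 curve of length [l] for the
    invariant metric [g].  Curves in I x Sigma are described by their lifts to
    I x SU(2)^2; motion along the U(1)-orbits has length zero. *)
Inductive path_length (g : R -> tangent -> tangent -> R) (s1 : R) :
  point -> point -> R -> Prop :=
| path_C1 (gam dgam : R -> point) :
    (forall t, 0 <= t <= 1 ->
       end_region s1 (gam t) /\ is_derive gam t (dgam t) /\
       continuous dgam t) ->
    path_length g s1 (gam 0) (gam 1)
      (RInt (fun t => sqrt (g (fst (gam t)) (project (gam t) (dgam t))
                                            (project (gam t) (dgam t)))) 0 1)
| path_cat (x y z : point) (l l' : R) :
    path_length g s1 x y l -> path_length g s1 y z l' ->
    path_length g s1 x z (l + l').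

(** Riemannian distance on {s >= s1}, pulled back to I x SU(2)^2. *)
Definition distance (g : R -> tangent -> tangent -> R) (s1 : R)
    (x y : point) : Rbar :=
  Glb_Rbar (path_length g s1 x y).

(** Points in the same U(1)-orbit are at distance zero, so that this is
    completeness of the quotient metric space {s >= s1} in I x Sigma. *)
Definition complete_end (g : R -> tangent -> tangent -> R) (s1 : R) : Prop :=
  forall x : nat -> point,
    (forall n, end_region s1 (x n)) ->
    (forall eps : posreal, exists N : nat, forall n m : nat,
       (N <= n)%nat -> (N <= m)%nat ->
       Rbar_lt (distance g s1 (x n) (x m)) eps) ->
    exists y : point, end_region s1 y /\
      forall eps : posreal, exists N : nat, forall n : nat,
        (N <= n)%nat -> Rbar_lt (distance g s1 (x n) y) eps.

(** [(U, Phi)] is an extension to (s_c, oo) of the solution [(u, phi)] with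
    squashing parameter [c], given on (s_c, hi). *)
Definition extends (alpha b c : R) (hi : Rbar) (u phi U Phi : R -> R) : Prop :=
  squashed_solution alpha b c p_infty U Phi /\
  forall s, s_sing alpha b c < s -> Rbar_lt s hi ->
    U s = u s /\ Phi s = phi s.

Definition complete_metric (alpha b c : R) (U Phi : R -> R) : Prop :=
  forall s1, s_sing alpha b c < s1 -> complete_end (metric_sol alpha b U Phi) s1.

Definition forward_complete (alpha b c : R) (hi : Rbar) (u phi : R -> R) :
  Prop :=
  exists U Phi : R -> R,
    extends alpha b c hi u phi U Phi /\ complete_metric alpha b c U Phi.

(** * Asymptotically conical solutions *)

(** The cone structure at radius [r]; [dr] is the radial covector. *)
Definition omega_cone (r : R) (dr : tangent -> R) : tangent -> tangent -> R :=
  fun x y => r * wedge dr eta_se x y + r ^ 2 * omega_se1 x y.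

Definition Omega_cone (r : R) (dr : tangent -> R) :
  tangent -> tangent -> tangent -> C :=
  wedge12 (fun v => RtoC (dr v) + Ci * RtoC (r * eta_se v))%C
          (fun x y => RtoC (r ^ 2) * omega_se23 x y)%C.

(** The comparison takes place on the s-side: the cone structure is pulled
    back by the change of variable r = r(s), for which dr = r'(s) ds.  The
    norms are constant on the orbits {s} x Sigma. *)
Definition approaches_cone (alpha b : R) (u phi : R -> R) (phi_inf : R) :
  Prop :=
  exists (r : R -> R) (S0 : R),
    (forall s, S0 < s ->
       0 < r s /\ 0 < Derive r s /\ forall n : nat, ex_derive_n r n s) /\
    is_lim r p_infty p_infty /\
    let dr s := fun v => Derive r s * ds v in
    let g s := metric (omega_cone (r s) (dr s)) (Omega_cone (r s) (dr s)) in
    is_lim (fun s => norm2 (g s) (fun x y =>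
      omega_sol alpha b u s x y - omega_cone (r s) (dr s) x y)) p_infty 0 /\
    is_lim (fun s => norm3 (g s) (fun x y z =>
      Omega_sol phi s x y z - Omega_cone (r s) (dr s) x y z)%C) p_infty 0 /\
    is_lim (fun s => Rabs (phi s - phi_inf)) p_infty 0.

(** [phi_inf] is the asymptotic value of the dilaton of the solution with
    squashing parameter [c]. *)
Definition asymptotic_dilaton (alpha b c phi_inf : R) : Prop :=
  exists U Phi : R -> R,
    squashed_solution alpha b c p_infty U Phi /\
    approaches_cone alpha b U Phi phi_inf.

(* Main.v *)
(** Write [k = 9 |alpha'| / 2], [x = u0 / k], [p = (u - u0) / k], [q = p + 2 x],
    [z = u' / k - 1].  The dilaton is recovered from
    [exp (4 phi) = k^3 (1 + z) p q / (2 exp (6 s))], with [phi' = - x / (p q)],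
    and the system becomes
    [p' = z], [z' = (1 + z) (6 - (2 + z) / p - z / q)],
    with [p = c / 3], [z = q = 0] at the singular end [x = - c / 6].
    The sign of [z' = 6 - 2 / p] at a zero of [z] decides everything.  For
    [c = 1] the solution is [p = 1 / 3], [z = 0].  For [c < 1], [z] is negative
    and bounded away from 0, so that [p] reaches 0 in finite time.  For [c > 1],
    [z] is positive and [z / p] stays above a positive constant, so that [p]
    grows exponentially; [phi'] is then integrable and [u^3 ~ exp (6 s + 4 phi)],
    which is the cone with [r = exp (s + 2 phi_inf / 3)].  The system is
    cooperative, hence [p] and [z] increase with [c], and so does the dilaton. *)

Require Import Defs.
From Stdlib Require Import Reals Lra Lia Psatz ClassicalEpsilon.
From Coquelicot Require Import Coquelicot.
Open Scope R_scope.

(** * First zeros, monotonicity and a Gronwall estimate *)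

(** The equation for [z] is the logarithmic derivative of [1 + z], a constant times
    [exp (6 s + 4 phi) / (p q)]: here [4 phi' = - 2 / p + 2 / q] and [- q' / q = - (2 + z) / q], so
    the terms [2 / q] cancel. What survives of the singularity at [q = 0] is [- z / q], which always
    pushes [z] towards 0. This sign replaces an analysis of the singular end: the sign of [z] and
    the case [c = 1] are read off from the one-sided limits of [p] and [z], although [1 / q] is not
    integrable there.

    For [c > 1] a solution is extended from an interior point. The field is not globally Lipschitz,
    so [p] and [q] are truncated from below and [z] is clamped to a range whose upper end comes from
    [z' <= 6 (1 + z)]; the solution of the modified system turns out never to leave the region where
    nothing was modified.

    On the geometric side the almost complex structure and the orthonormal frame are chosen by
    [epsilon]. The first is determined by its action on three explicit (1,0)-forms. The second stays
    arbitrary, so norms are estimated through bounds valid for every unit vector. *)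

Notation is_derive_Rminus := (is_derive_minus (K := R_AbsRing) (V := R_NormedModule)).
Notation is_derive_Rplus := (is_derive_plus (K := R_AbsRing) (V := R_NormedModule)).
Notation is_derive_Ropp := (is_derive_opp (K := R_AbsRing) (V := R_NormedModule)).
Notation is_derive_Rconst := (is_derive_const (K := R_AbsRing) (V := R_NormedModule)).

Lemma continuous_pt (f : R -> R) (x : R) : continuous f x <-> continuity_pt f x.
Proof. split; apply continuity_pt_filterlim. Qed.

Lemma is_derive_continuity_pt (f : R -> R) (x l : R) :
  is_derive f x l -> continuity_pt f x.
Proof.
  intros H. apply continuous_pt.
  apply (@ex_derive_continuous R_AbsRing R_NormedModule). now exists l.
Qed.

Lemma nondecreasing_on (f df : R -> R) (a b : R) :
  a <= b ->
  (forall t, a <= t <= b -> continuity_pt f t) ->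
  (forall t, a < t < b -> is_derive f t (df t)) ->
  (forall t, a < t < b -> 0 <= df t) ->
  f a <= f b.
Proof.
  intros Hab Hc Hd Hp.
  (* [MVT_gen] places the intermediate point in the closed interval, where [df] has no known sign at
     the endpoints; the extension by 0 covers that case. *)
  set (g := fun t => if Rlt_dec a t then if Rlt_dec t b then df t else 0 else 0).
  destruct (MVT_gen f a b g) as [c [Hc1 Hc2]].
  - rewrite Rmin_left, Rmax_right by lra. intros x Hx. unfold g.
    destruct (Rlt_dec a x); [|lra]. destruct (Rlt_dec x b); [|lra]. now apply Hd.
  - rewrite Rmin_left, Rmax_right by lra. exact Hc.
  - assert (0 <= g c).
    { unfold g. destruct (Rlt_dec a c); [|lra]. destruct (Rlt_dec c b); [|lra].
      apply Hp; lra. }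
    nra.
Qed.

Lemma first_zero (f : R -> R) (a b : R) :
  a <= b ->
  (forall t, a <= t <= b -> continuity_pt f t) ->
  0 < f a -> f b <= 0 ->
  exists t, a < t <= b /\ f t = 0 /\ forall s, a <= s < t -> 0 < f s.
Proof.
  intros Hab Hc Ha Hb.
  (* The supremum of [E] is the first zero: a positive value there could be continued to the right,
     a negative one would already occur further left. *)
  set (E := fun x => a <= x <= b /\ forall s, a <= s <= x -> 0 < f s).
  destruct (completeness E) as [m [Hub Hlub]].
  - exists b. intros x [Hx _]. lra.
  - exists a. split; [lra|]. intros s Hs. now replace s with a by lra.
  - assert (Ham : a <= m).
    { apply Hub. split; [lra|]. intros s Hs. now replace s with a by lra. }
    assert (Hmb : m <= b) by (apply Hlub; intros x [Hx _]; lra).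
    assert (Hbefore : forall s, a <= s < m -> 0 < f s).
    { intros s Hs. destruct (Rle_lt_dec (f s) 0) as [H|H]; [|exact H].
      exfalso. apply (Rlt_not_le m s); [lra|]. apply Hlub.
      intros x [Hx1 Hx2]. destruct (Rle_lt_dec x s) as [H'|H']; [exact H'|].
      specialize (Hx2 s ltac:(lra)). lra. }
    assert (Hpos : 0 < f m -> False).
    { intros Hm.
      assert (Hmb' : m < b).
      { destruct (Rlt_dec m b); [easy|]. replace b with m in Hb by lra. lra. }
      pose proof (Hc m ltac:(lra)) as Hcm. apply continuous_pt in Hcm.
      assert (Hl : locally m (fun y => 0 < f y)).
      { apply (Hcm (fun y => 0 < y)). now apply open_gt. }
      destruct Hl as [d Hd].
      pose proof (cond_pos d) as Hdp.
      set (x := Rmin b (m + d / 2)).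
      assert (Hx : m < x <= b /\ x <= m + d / 2).
      { unfold x. repeat split;
          [apply Rmin_glb_lt; lra| apply Rmin_l | apply Rmin_r]. }
      apply (Rlt_not_le x m); [lra|]. apply Hub. split; [lra|].
      intros s Hs. destruct (Rlt_dec s m); [apply Hbefore; lra|].
      apply Hd. apply Rabs_lt_between'; simpl. lra. }
    assert (Hneg : f m < 0 -> False).
    { intros Hm.
      assert (Ham' : a < m).
      { destruct (Rlt_dec a m); [easy|]. replace m with a in Hm by lra. lra. }
      pose proof (Hc m ltac:(lra)) as Hcm. apply continuous_pt in Hcm.
      assert (Hl : locally m (fun y => f y < 0)).
      { apply (Hcm (fun y => y < 0)). now apply open_lt. }
      destruct Hl as [d Hd].
      pose proof (cond_pos d) as Hdp.
      set (x := Rmax a (m - d / 2)).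
      assert (Hx : a <= x < m /\ m - d / 2 <= x).
      { unfold x. repeat split;
          [apply Rmax_l | apply Rmax_lub_lt; lra | apply Rmax_r]. }
      specialize (Hbefore x ltac:(lra)).
      specialize (Hd x). assert (f x < 0); [|lra].
      apply Hd. apply Rabs_lt_between'; simpl. lra. }
    assert (Hm0 : f m = 0) by (destruct (Rtotal_order (f m) 0) as [|[|]]; lra || tauto).
    exists m. split; [|split; [exact Hm0|exact Hbefore]].
    split; [|exact Hmb]. destruct (Rlt_dec a m); [easy|].
    replace m with a in Hm0 by lra. lra.
Qed.

Lemma smaller_on_the_left (f : R -> R) (t l a : R) :
  is_derive f t l -> 0 < l -> a < t -> exists s, a < s < t /\ f s < f t.
Proof.
  intros Hd Hl Hat. apply is_derive_Reals in Hd.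
  destruct (Hd (l / 2) ltac:(lra)) as [d Hd'].
  pose proof (cond_pos d) as Hdp.
  set (h := - (Rmin (d / 2) ((t - a) / 2))).
  assert (Hh : - d < h < 0 /\ a - t < h).
  { unfold h. pose proof (Rmin_l (d / 2) ((t - a) / 2)).
    pose proof (Rmin_r (d / 2) ((t - a) / 2)).
    assert (0 < Rmin (d / 2) ((t - a) / 2)) by (apply Rmin_glb_lt; lra). lra. }
  exists (t + h). split; [lra|].
  specialize (Hd' h ltac:(lra)).
  rewrite Rabs_left in Hd' by lra. specialize (Hd' ltac:(lra)).
  apply Rabs_lt_between in Hd'.
  assert (0 < (f (t + h) - f t) / h) by lra.
  assert (f (t + h) - f t = (f (t + h) - f t) / h * h) by (field; lra).
  nra.
Qed.

(** At its first zero [f] comes down from positive values, which a positive derivative forbids. The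
    sign of the derivative may be established with the help of positivity on the whole earlier
    segment; this is how monotonicity of [p] enters the arguments about [z]. *)
Lemma stay_positive (f df : R -> R) (a b : R) :
  (forall t, a <= t <= b -> continuity_pt f t) ->
  (forall t, a < t <= b -> is_derive f t (df t)) ->
  0 < f a ->
  (forall t, a < t <= b -> f t = 0 -> (forall s, a <= s < t -> 0 < f s) ->
     0 < df t) ->
  forall t, a <= t <= b -> 0 < f t.
Proof.
  intros Hc Hd Ha H0 t Ht.
  destruct (Rle_lt_dec (f t) 0) as [H|H]; [exfalso|exact H].
  destruct (first_zero f a t) as [m [Hm [Hfm Hbef]]]; try easy; try lra.
  { intros; apply Hc; lra. }
  destruct (smaller_on_the_left f m (df m) a) as [s [Hs Hfs]].
  - apply Hd; lra.
  - apply H0; try easy; lra.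
  - lra.
  - specialize (Hbef s ltac:(lra)). lra.
Qed.

(** A barrier argument at an endpoint where the equation is singular. Wherever [f] is nonpositive it
    increases, so a nonpositive value forces still smaller values all the way to the left, against
    the limit 0. *)
Lemma positive_from_limit (f df : R -> R) (a b : R) :
  (forall t, a < t < b -> is_derive f t (df t)) ->
  (forall t, a < t < b -> f t <= 0 -> 0 < df t) ->
  filterlim f (at_right a) (locally 0) ->
  forall t, a < t < b -> 0 < f t.
Proof.
  intros Hd Hp Hl t1 Ht1.
  destruct (Rle_lt_dec (f t1) 0) as [H1|H1]; [exfalso|exact H1].
  (* A minimum of [f] on [[t0, t]] has value at most [f t <= 0], hence positive derivative, hence
     can only sit at [t0]. *)
  assert (Hinc : forall t0 t, a < t0 < t -> t < b -> f t <= 0 -> f t0 < f t).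
  { intros t0 t Ht0 Htb Hft.
    destruct (continuity_ab_min f t0 t) as [m [Hm1 Hm2]]; [lra| |].
    { intros c Hc. apply is_derive_continuity_pt with (df c). apply Hd. lra. }
    destruct (Rlt_dec t0 m) as [Hlt|Hge].
    - exfalso. pose proof (Hm1 t ltac:(lra)) as Hmt.
      destruct (smaller_on_the_left f m (df m) t0) as [s [Hs Hfs]].
      + apply Hd; lra.
      + apply Hp; lra.
      + exact Hlt.
      + specialize (Hm1 s ltac:(lra)). lra.
    - replace m with t0 in Hm1 by lra.
      destruct (Hm1 t ltac:(lra)) as [|Heq]; [easy|exfalso].
      destruct (smaller_on_the_left f t (df t) t0) as [s [Hs Hfs]].
      + apply Hd; lra.
      + apply Hp; lra.
      + lra.
      + specialize (Hm1 s ltac:(lra)). lra. }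
  set (t2 := (a + t1) / 2).
  assert (H2 : f t2 < 0).
  { pose proof (Hinc t2 t1 ltac:(unfold t2; lra) ltac:(lra) H1). lra. }
  assert (Hl' : at_right a (fun y => f t2 < f y)).
  { apply (Hl (fun y => f t2 < y)). now apply open_gt. }
  destruct Hl' as [d Hd']. pose proof (cond_pos d).
  set (x := Rmin (a + d / 2) ((a + t2) / 2)).
  assert (Hx : a < x < t2 /\ x < a + d).
  { unfold x, t2. pose proof (Rmin_l (a + d / 2) ((a + (a + t1) / 2) / 2)).
    pose proof (Rmin_r (a + d / 2) ((a + (a + t1) / 2) / 2)).
    assert (a < Rmin (a + d / 2) ((a + (a + t1) / 2) / 2))
      by (apply Rmin_glb_lt; lra). lra. }
  specialize (Hd' x). assert (f t2 < f x).
  { apply Hd'; [apply Rabs_lt_between'; simpl|]; lra. }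
  pose proof (Hinc x t2 ltac:(lra) ltac:(unfold t2; lra) ltac:(lra)). lra.
Qed.

(** The derivative of [E exp (- W)] is [(dE - dW E) exp (- W)], which is nonpositive. [E] may have
    either sign, so the same lemma yields energy estimates and one-sided growth bounds. *)
Lemma gronwall (E dE W dW : R -> R) (a b : R) :
  a <= b ->
  (forall t, a <= t <= b -> continuity_pt E t) ->
  (forall t, a < t < b -> is_derive E t (dE t)) ->
  (forall t, a <= t <= b -> is_derive W t (dW t)) ->
  (forall t, a < t < b -> dE t <= dW t * E t) ->
  E b * exp (- W b) <= E a * exp (- W a).
Proof.
  intros Hab Hc Hd HW Hle.
  assert (HexpW : forall t, a <= t <= b ->
    is_derive (fun t => exp (- W t)) t (- dW t * exp (- W t))).
  { intros t Ht. evar_last.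
    - apply (is_derive_comp exp (fun t => - W t)).
      + apply is_derive_Reals, derivable_pt_lim_exp.
      + apply is_derive_Ropp. now apply HW.
    - reflexivity. }
  apply Ropp_le_cancel.
  apply (nondecreasing_on (fun t => - (E t * exp (- W t)))
    (fun t => - (dE t * exp (- W t) + E t * (- dW t * exp (- W t)))) a b Hab).
  - intros t Ht. apply continuity_pt_opp, continuity_pt_mult; [now apply Hc|].
    eapply is_derive_continuity_pt. now apply HexpW.
  - intros t Ht. apply is_derive_Ropp.
    apply (Derive.is_derive_mult E (fun t => exp (- W t))); [now apply Hd | apply HexpW; lra].
  - intros t Ht. pose proof (exp_pos (- W t)). specialize (Hle t Ht). nra.
Qed.

(** * Global existence for a planar system *)

Lemma geometric_limit (u : nat -> R) (K : R) :
  (forall n, Rabs (u (S n) - u n) <= K * (/ 2) ^ n) ->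
  forall n, Rabs (real (Lim_seq u) - u n) <= 2 * K * (/ 2) ^ n.
Proof.
  intros Hu.
  assert (HK : 0 <= K).
  { specialize (Hu 0%nat). pose proof (Rabs_pos (u 1%nat - u 0%nat)). simpl in Hu. lra. }
  assert (Hpow : forall n, 0 < (/ 2) ^ n) by (intros; apply pow_lt; lra).
  assert (Hk : forall n k, Rabs (u (n + k)%nat - u n) <= 2 * K * (/ 2) ^ n).
  { intros n k.
    (* The bound keeps the exact partial sum of the geometric series, so that the induction on [k]
       closes. *)
    assert (Rabs (u (n + k)%nat - u n) <= 2 * K * (/ 2) ^ n - 2 * K * (/ 2) ^ (n + k)).
    { induction k as [|k IH].
      - rewrite Nat.add_0_r, Rminus_diag, Rabs_R0. lra.
      - rewrite Nat.add_succ_r. specialize (Hu (n + k)%nat).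
        replace (u (S (n + k)) - u n)
          with ((u (S (n + k)) - u (n + k)%nat) + (u (n + k)%nat - u n)) by ring.
        eapply Rle_trans; [apply Rabs_triang|]. simpl pow. lra. }
    specialize (Hpow (n + k)%nat). nra. }
  assert (Hex : ex_finite_lim_seq u).
  { apply ex_lim_seq_cauchy_corr. intros eps.
    assert (Hl : is_lim_seq (fun n => 4 * K * (/ 2) ^ n) 0).
    { replace 0 with (4 * K * 0) by ring. apply is_lim_seq_mult'.
      - apply is_lim_seq_const.
      - apply is_lim_seq_geom. rewrite Rabs_right; lra. }
    apply is_lim_seq_spec in Hl. destruct (Hl eps) as [N HN].
    exists N. intros n m Hn Hm. specialize (HN N ltac:(lia)).
    pose proof (Hk N (n - N)%nat) as H1. pose proof (Hk N (m - N)%nat) as H2.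
    replace (N + (n - N))%nat with n in H1 by lia.
    replace (N + (m - N))%nat with m in H2 by lia.
    replace (u n - u m) with ((u n - u N) + - (u m - u N)) by ring.
    eapply Rle_lt_trans; [apply Rabs_triang|]. rewrite Rabs_Ropp.
    rewrite Rminus_0_r, Rabs_right in HN; [lra|].
    specialize (Hpow N). nra. }
  apply ex_finite_lim_seq_correct in Hex. destruct Hex as [Hex1 Hex2].
  apply Lim_seq_correct in Hex1. rewrite <- Hex2 in Hex1.
  intros n.
  assert (Hl : is_lim_seq (fun k => Rabs (u (k + n)%nat - u n))
                 (Rabs (real (Lim_seq u) - u n))).
  { apply (is_lim_seq_abs _ (Finite (Lim_seq u - u n))).
    apply is_lim_seq_minus'; [|apply is_lim_seq_const].
    now apply -> (is_lim_seq_incr_n u n). }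
  apply (is_lim_seq_le (fun k => Rabs (u (k + n)%nat - u n))
           (fun _ => 2 * K * (/ 2) ^ n) _ _) with (2 := Hl) (3 := is_lim_seq_const _).
  intros k. rewrite Nat.add_comm. apply Hk.
Qed.

Lemma zero_of_geometric_bound (x K : R) :
  (forall n, Rabs x <= K * (/ 2) ^ n) -> x = 0.
Proof.
  intros H. destruct (Req_dec x 0) as [|Hx]; [easy|exfalso].
  assert (Hl : is_lim_seq (fun n => K * (/ 2) ^ n) (K * 0)).
  { apply is_lim_seq_mult'; [apply is_lim_seq_const|].
    apply is_lim_seq_geom. rewrite Rabs_right; lra. }
  pose proof (is_lim_seq_le _ _ _ _ H (is_lim_seq_const _) Hl) as H'. simpl in H'.
  pose proof (Rabs_pos_lt x Hx). lra.
Qed.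

(* The iterates are frozen to the left of [t0], which keeps them continuous on
   the whole line. *)
Fixpoint picard (F G : R -> R -> R -> R) (t0 p0 z0 : R) (n : nat) (t : R) : R * R :=
  match n with
  | O => (p0, z0)
  | S m =>
    (p0 + RInt (fun s => F s (fst (picard F G t0 p0 z0 m s))
                             (snd (picard F G t0 p0 z0 m s))) t0 (Rmax t0 t),
     z0 + RInt (fun s => G s (fst (picard F G t0 p0 z0 m s))
                             (snd (picard F G t0 p0 z0 m s))) t0 (Rmax t0 t))
  end.

Lemma continuous_Rmax (a t : R) : continuous (Rmax a) t.
Proof.
  apply continuous_pt. intros eps Heps. exists eps. split; [exact Heps|].
  intros x [_ Hx]. simpl in *. unfold R_dist, Rmax in *.
  destruct (Rle_dec a x), (Rle_dec a t); split_Rabs; lra.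
Qed.

Lemma continuous_primitive (f : R -> R) (c t0 t : R) :
  (forall s, continuous f s) -> continuous (fun t => c + RInt f t0 (Rmax t0 t)) t.
Proof.
  intros Hf. apply (continuous_plus (V := R_NormedModule)); [apply continuous_const|].
  apply (continuous_comp (Rmax t0) (RInt f t0)); [apply continuous_Rmax|].
  apply (@ex_derive_continuous R_AbsRing R_NormedModule).
  exists (f (Rmax t0 t)). apply is_derive_RInt with t0; [|apply Hf].
  apply filter_forall. intros x. apply (@RInt_correct R_CompleteNormedModule).
  apply (@ex_RInt_continuous R_CompleteNormedModule). intros; apply Hf.
Qed.

(** The error weight [B] is continuous, hence bounded near [t], so the approximation is uniform
    there and the usual three-term estimate applies. *)
Lemma continuous_of_uniform_approx (y : R -> R) (u : nat -> R -> R) (B : R -> R) (t : R) :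
  (forall n, continuous (u n) t) -> continuous B t ->
  (forall n s, Rabs (y s - u n s) <= B s * (/ 2) ^ n) ->
  continuous y t.
Proof.
  intros Hu HB H. apply filterlim_locally. intros eps.
  set (C := Rabs (B t) + 1).
  assert (HC : 0 < C) by (unfold C; pose proof (Rabs_pos (B t)); lra).
  assert (Hl : is_lim_seq (fun n => C * (/ 2) ^ n) (C * 0)).
  { apply is_lim_seq_mult'; [apply is_lim_seq_const|].
    apply is_lim_seq_geom. rewrite Rabs_right; lra. }
  apply is_lim_seq_spec in Hl.
  pose proof (cond_pos eps) as He.
  assert (He4 : 0 < eps / 4) by lra.
  destruct (Hl (mkposreal _ He4)) as [N HN]. specialize (HN N ltac:(lia)). simpl in HN.
  assert (Hpow : 0 < (/ 2) ^ N) by (apply pow_lt; lra).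
  rewrite Rmult_0_r, Rminus_0_r, Rabs_right in HN by nra.
  assert (HBl : locally t (fun s => B s < C)).
  { apply (HB (fun x => x < C)). apply open_lt. unfold C.
    pose proof (Rle_abs (B t)). lra. }
  pose proof (proj1 (filterlim_locally _ _) (Hu N) (mkposreal _ He4)) as Hul.
  pose proof (locally_singleton _ _ HBl) as HBt. simpl in HBt.
  generalize (filter_and _ _ HBl Hul). apply filter_imp. intros s [Hs1 Hs2].
  change (Rabs (y s - y t) < eps). change (Rabs (u N s - u N t) < eps / 4) in Hs2.
  replace (y s - y t) with ((y s - u N s) + ((u N s - u N t) + - (y t - u N t))) by ring.
  pose proof (H N s) as Ha. pose proof (H N t) as Hb.
  assert (B s * (/ 2) ^ N < eps / 4) by nra.
  assert (B t * (/ 2) ^ N < eps / 4) by nra.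
  eapply Rle_lt_trans; [apply Rabs_triang|].
  eapply Rle_lt_trans; [apply Rplus_le_compat_l, Rabs_triang|].
  rewrite Rabs_Ropp. lra.
Qed.

(* The weight [exp (2 W)], [W' = L], makes the Picard map a contraction with
   factor 1/2 on the whole half-line. *)
Lemma global_existence (F G : R -> R -> R -> R) (L : R -> R) (t0 p0 z0 : R) :
  (forall p z : R -> R, (forall t, continuous p t) -> (forall t, continuous z t) ->
     forall t, continuous (fun s => F s (p s) (z s)) t /\
               continuous (fun s => G s (p s) (z s)) t) ->
  (forall t p z p' z', t0 <= t ->
     Rabs (F t p z - F t p' z') + Rabs (G t p z - G t p' z')
       <= L t * (Rabs (p - p') + Rabs (z - z'))) ->
  (forall t, continuous L t) ->
  exists p z : R -> R,
    (forall t, continuous p t) /\ (forall t, continuous z t) /\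
    p t0 = p0 /\ z t0 = z0 /\
    forall t, t0 < t -> is_derive p t (F t (p t) (z t)) /\
                        is_derive z t (G t (p t) (z t)).
Proof.
  intros Hcont HLip HLc.
  set (W := RInt L t0).
  assert (HexL : forall t, ex_RInt L t0 t).
  { intros t. apply (@ex_RInt_continuous R_CompleteNormedModule). intros; apply HLc. }
  assert (HW : forall t, is_derive W t (L t)).
  { intros t. apply is_derive_RInt with t0; [|apply HLc].
    apply filter_forall. intros x. now apply (@RInt_correct R_CompleteNormedModule). }
  assert (HLpos : forall s, t0 <= s -> 0 <= L s).
  (* The Lipschitz inequality at two points at distance 1 shows that [L] is nonnegative. *)
  { intros s Hs. pose proof (HLip s 1 0 0 0 Hs) as HL1.
    rewrite Rminus_0_r, Rminus_diag, Rabs_R0, Rabs_R1 in HL1.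
    pose proof (Rabs_pos (F s 1 0 - F s 0 0)). pose proof (Rabs_pos (G s 1 0 - G s 0 0)).
    lra. }
  assert (HWpos : forall t, t0 <= t -> 0 <= W t).
  { intros t Ht. apply RInt_ge_0; [exact Ht | apply HexL |]. intros s Hs. apply HLpos. lra. }
  set (P := fun n t => fst (picard F G t0 p0 z0 n t)).
  set (Z := fun n t => snd (picard F G t0 p0 z0 n t)).
  assert (Hc : forall n, (forall t, continuous (P n) t) /\ (forall t, continuous (Z n) t)).
  { induction n as [|n [IHp IHz]].
    - split; intros t; apply continuous_const.
    - split; intros t; apply (continuous_primitive _ _ t0 t); intros s;
        apply (Hcont (P n) (Z n)); assumption. }
  set (N := fun n t => Rabs (P (S n) t - P n t) + Rabs (Z (S n) t - Z n t)).
  assert (Hpow : forall n, 0 < (/ 2) ^ n) by (intros; apply pow_lt; lra).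
  (* The factor 1/2 of the contraction comes from this primitive: integrating [L exp (2 W)] with
     [W' = L] gives half of [exp (2 W)]. *)
  assert (HintL : forall K t, is_RInt (fun s => K * (L s * exp (2 * W s))) t0 t
                    (K * (exp (2 * W t) - exp (2 * W t0)) / 2)).
  { intros K t.
    assert (HDe : forall s, is_derive (fun s => K / 2 * exp (2 * W s)) s
                    (K * (L s * exp (2 * W s)))).
    { intros s. evar_last.
      - apply is_derive_scal. apply (is_derive_comp exp (fun s => 2 * W s)).
        + apply is_derive_Reals, derivable_pt_lim_exp.
        + apply is_derive_scal, HW.
      - unfold scal; simpl; unfold mult; simpl. field. }
    evar_last.
    - apply (@is_RInt_derive R_CompleteNormedModule (fun s => K / 2 * exp (2 * W s))).
      + intros s _. apply HDe.
      + intros s _. apply (continuous_mult (fun _ => K)); [apply continuous_const|].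
        apply (continuous_mult L); [apply HLc|].
        apply continuous_comp with (f := fun s => 2 * W s) (g := exp).
        * apply (continuous_mult (fun _ => 2)); [apply continuous_const|].
          apply (@ex_derive_continuous R_AbsRing R_NormedModule). eexists; apply HW.
        * apply continuous_exp.
    - unfold minus, plus, opp; simpl. field. }
  assert (Hint : forall (H : R -> R -> R -> R) p z, (H = F \/ H = G) ->
    (forall t, continuous p t) -> (forall t, continuous z t) ->
    forall t, ex_RInt (fun s => H s (p s) (z s)) t0 t).
  { intros H p z HH Hp Hz t. apply (@ex_RInt_continuous R_CompleteNormedModule).
    intros s _. destruct HH as [-> | ->]; apply Hcont; assumption. }
  (* The contraction estimate on [[t0, t]]: a weighted bound [K] on the difference of the inputs
     becomes [K / 2] for the outputs. It is used for consecutive iterates and again for the limit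
     against an iterate. *)
  assert (Hdiff : forall p z p' z' K t, t0 <= t ->
    (forall s, continuous p s) -> (forall s, continuous z s) ->
    (forall s, continuous p' s) -> (forall s, continuous z' s) -> 0 <= K ->
    (forall s, t0 <= s <= t -> Rabs (p s - p' s) + Rabs (z s - z' s) <= K * exp (2 * W s)) ->
    Rabs (RInt (fun s => F s (p s) (z s)) t0 t - RInt (fun s => F s (p' s) (z' s)) t0 t) +
    Rabs (RInt (fun s => G s (p s) (z s)) t0 t - RInt (fun s => G s (p' s) (z' s)) t0 t)
    <= K / 2 * exp (2 * W t)).
  { intros p z p' z' K t Ht Hp Hz Hp' Hz' HK Hb.
    pose proof (Hint F p z (or_introl eq_refl) Hp Hz t) as I1.
    pose proof (Hint F p' z' (or_introl eq_refl) Hp' Hz' t) as I2.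
    pose proof (Hint G p z (or_intror eq_refl) Hp Hz t) as I3.
    pose proof (Hint G p' z' (or_intror eq_refl) Hp' Hz' t) as I4.
    assert (Hcd : forall H, H = F \/ H = G -> forall s,
       continuous (fun s => Rabs (H s (p s) (z s) - H s (p' s) (z' s))) s).
    { intros H HH s. apply (continuous_comp (fun s => H s (p s) (z s) - H s (p' s) (z' s)) Rabs);
        [|apply continuous_Rabs].
      apply (continuous_minus (V := R_NormedModule));
        destruct HH as [-> | ->]; apply Hcont; assumption. }
    assert (Hex : forall H, H = F \/ H = G ->
       ex_RInt (fun s => Rabs (H s (p s) (z s) - H s (p' s) (z' s))) t0 t).
    { intros H HH. apply (@ex_RInt_continuous R_CompleteNormedModule).
      intros s _. now apply Hcd. }
    rewrite <- (RInt_minus (V := R_CompleteNormedModule)) by assumption.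
    rewrite <- (RInt_minus (V := R_CompleteNormedModule)) by assumption.
    pose proof (Hex F (or_introl eq_refl)) as X1.
    pose proof (Hex G (or_intror eq_refl)) as X2.
    eapply Rle_trans.
    { apply Rplus_le_compat; (apply abs_RInt_le; [exact Ht|]);
        apply (@ex_RInt_minus R_NormedModule); assumption. }
    eapply Rle_trans.
    { right. symmetry. apply (RInt_plus (V := R_CompleteNormedModule)); assumption. }
    apply Rle_trans with (K * (exp (2 * W t) - exp (2 * W t0)) / 2).
    - rewrite <- (is_RInt_unique _ _ _ _ (HintL K t)).
      apply RInt_le; [exact Ht| |eexists; apply HintL|].
      + apply (@ex_RInt_plus R_NormedModule); assumption.
      + intros s Hs. unfold plus; simpl. eapply Rle_trans; [apply HLip; lra|].
        specialize (Hb s ltac:(lra)).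
        specialize (HLpos s ltac:(lra)).
        pose proof (exp_pos (2 * W s)). nra.
    - pose proof (exp_pos (2 * W t0)). nra. }
  (* [M] is the maximum of the first increment on [[t0, T]]; the base case uses [exp (2 W) >= 1]. *)
  assert (Hbound : forall T, t0 <= T -> exists M, 0 <= M /\ forall n t, t0 <= t <= T ->
    N n t <= M * (/ 2) ^ n * exp (2 * W t)).
  { intros T HT. destruct (continuity_ab_maj (N 0%nat) t0 T HT) as [m [Hm _]].
    { intros c _. apply continuous_pt. unfold N.
      apply (continuous_plus (V := R_NormedModule)).
      - apply (continuous_comp (fun t => P 1%nat t - P 0%nat t) Rabs); [|apply continuous_Rabs].
        apply (continuous_minus (V := R_NormedModule)); apply Hc.
      - apply (continuous_comp (fun t => Z 1%nat t - Z 0%nat t) Rabs); [|apply continuous_Rabs].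
        apply (continuous_minus (V := R_NormedModule)); apply Hc. }
    assert (HNpos : forall n t, 0 <= N n t).
    { intros n t. unfold N. pose proof (Rabs_pos (P (S n) t - P n t)).
      pose proof (Rabs_pos (Z (S n) t - Z n t)). lra. }
    exists (N 0%nat m). split; [apply HNpos|].
    induction n as [|n IH]; intros t Ht.
    - specialize (Hm t Ht). specialize (HNpos 0%nat m). simpl pow.
      assert (1 <= exp (2 * W t)).
      { rewrite <- exp_0. specialize (HWpos t ltac:(lra)).
        destruct (Req_dec (W t) 0) as [-> |]; [rewrite Rmult_0_r; lra|].
        left. apply exp_increasing. lra. }
      nra.
    - unfold N. change (P (S (S n)) t) with
        (p0 + RInt (fun s => F s (P (S n) s) (Z (S n) s)) t0 (Rmax t0 t)).
      change (Z (S (S n)) t) with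
        (z0 + RInt (fun s => G s (P (S n) s) (Z (S n) s)) t0 (Rmax t0 t)).
      change (P (S n) t) with (p0 + RInt (fun s => F s (P n s) (Z n s)) t0 (Rmax t0 t)).
      change (Z (S n) t) with (z0 + RInt (fun s => G s (P n s) (Z n s)) t0 (Rmax t0 t)).
      rewrite Rmax_right by lra.
      match goal with |- Rabs (p0 + ?a - (p0 + ?b)) + Rabs (z0 + ?c - (z0 + ?d)) <= _ =>
        replace (p0 + a - (p0 + b)) with (a - b) by ring;
        replace (z0 + c - (z0 + d)) with (c - d) by ring end.
      eapply Rle_trans.
      { apply (Hdiff (P (S n)) (Z (S n)) (P n) (Z n) (N 0%nat m * (/ 2) ^ n));
          try apply Hc; try lra.
        - specialize (HNpos 0%nat m). specialize (Hpow n). nra.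
        - intros s Hs. apply IH. lra. }
      fold (N 0%nat m). rewrite <- tech_pow_Rmult. right. field. }
  set (p := fun t => real (Lim_seq (fun n => P n t))).
  set (z := fun t => real (Lim_seq (fun n => Z n t))).
  (* The iterates see [t] only through [Rmax t0 t], so bounds proved on [[t0, T]] extend to all
     [t <= T]. *)
  assert (Hfreeze : forall n t, P n (Rmax t0 t) = P n t /\ Z n (Rmax t0 t) = Z n t).
  { intros n t. assert (Hmm : Rmax t0 (Rmax t0 t) = Rmax t0 t)
      by (apply Rmax_right, Rmax_l).
    destruct n; [easy|]. unfold P, Z. simpl. now rewrite Hmm. }
  assert (Happrox : forall T, t0 <= T -> exists M, 0 <= M /\ forall n t, t <= T ->
     Rabs (p t - P n t) <= M * exp (2 * W (Rmax t0 t)) * (/ 2) ^ n /\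
     Rabs (z t - Z n t) <= M * exp (2 * W (Rmax t0 t)) * (/ 2) ^ n).
  { intros T HT. destruct (Hbound T HT) as [M [HM Hb]].
    exists (2 * M). split; [lra|]. intros n t Ht.
    assert (Hr : t0 <= Rmax t0 t <= T) by (split; [apply Rmax_l | now apply Rmax_lub]).
    rewrite (Rmult_assoc 2 M). split; [apply (geometric_limit (fun n => P n t)) | apply (geometric_limit (fun n => Z n t))]; intros k;
      specialize (Hb k _ Hr); unfold N in Hb;
      destruct (Hfreeze k t) as [E1 E2]; destruct (Hfreeze (S k) t) as [E3 E4];
      rewrite E1, E2, E3, E4 in Hb;
      pose proof (Rabs_pos (P (S k) t - P k t)); pose proof (Rabs_pos (Z (S k) t - Z k t));
      lra. }
  assert (Hcz : forall t, continuous p t /\ continuous z t).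
  { intros t. destruct (Happrox (Rmax t0 (t + 1)) (Rmax_l _ _)) as [M [HM Hap]].
    set (B := fun s => M * exp (2 * W (Rmax t0 s))).
    assert (HB : forall s, continuous B s).
    { intros s. apply (continuous_mult (fun _ => M)); [apply continuous_const|].
      apply (continuous_comp (fun s => 2 * W (Rmax t0 s)) exp); [|apply continuous_exp].
      apply (continuous_mult (fun _ => 2)); [apply continuous_const|].
      apply (continuous_comp (Rmax t0) W); [apply continuous_Rmax|].
      apply (@ex_derive_continuous R_AbsRing R_NormedModule). eexists; apply HW. }
    (* The approximation is controlled only up to [T > t]. Beyond [T] both the limit and the
       iterates are replaced by iterate 0, which makes the bound hold on the whole line without
       changing anything near [t]. *)
    assert (Hloc : forall (y : R -> R) (u : nat -> R -> R), (forall n s, continuous (u n) s) ->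
      (forall n s, s <= Rmax t0 (t + 1) -> Rabs (y s - u n s) <= B s * (/ 2) ^ n) ->
      continuous y t).
    { intros y u Hu Hy. set (T := Rmax t0 (t + 1)) in *.
      assert (HtT : t < T) by (unfold T; pose proof (Rmax_r t0 (t + 1)); lra).
      apply continuous_ext_loc with (g := fun s => if Rle_dec s T then y s else u 0%nat s).
      { exists (mkposreal (T - t) ltac:(lra)). intros s Hs.
        apply Rabs_lt_between' in Hs. simpl in Hs.
        destruct (Rle_dec s T); [easy|lra]. }
      apply continuous_of_uniform_approx with
        (u := fun n s => if Rle_dec s T then u n s else u 0%nat s) (B := B); [|apply HB|].
      - intros n. apply continuous_ext_loc with (g := u n); [|apply Hu].
        exists (mkposreal (T - t) ltac:(lra)). intros s Hs.
        apply Rabs_lt_between' in Hs. simpl in Hs.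
        destruct (Rle_dec s T); [easy|lra].
      - intros n s. destruct (Rle_dec s T) as [H|H]; [now apply Hy|].
        rewrite Rminus_diag, Rabs_R0. unfold B. specialize (Hpow n).
        pose proof (exp_pos (2 * W (Rmax t0 s))). apply Rmult_le_pos; nra. }
    split.
    - apply (Hloc p P); [apply Hc | intros n s Hs; now apply Hap].
    - apply (Hloc z Z); [apply Hc | intros n s Hs; now apply Hap]. }
  assert (Hfix : forall t, t0 <= t ->
     p t = p0 + RInt (fun s => F s (p s) (z s)) t0 t /\
     z t = z0 + RInt (fun s => G s (p s) (z s)) t0 t).
  { intros t Ht. destruct (Happrox t Ht) as [M [HM Hap]].
    (* Passing to the limit in the integral equation: the limit differs from iterate [n] by a
       weighted error of order [(/ 2) ^ n], and the Picard map halves it. *)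
    assert (Hn : forall n,
      Rabs (RInt (fun s => F s (p s) (z s)) t0 t - (P (S n) t - p0)) +
      Rabs (RInt (fun s => G s (p s) (z s)) t0 t - (Z (S n) t - z0))
      <= M * (/ 2) ^ n * exp (2 * W t)).
    { intros n. change (P (S n) t) with
        (p0 + RInt (fun s => F s (P n s) (Z n s)) t0 (Rmax t0 t)).
      change (Z (S n) t) with (z0 + RInt (fun s => G s (P n s) (Z n s)) t0 (Rmax t0 t)).
      rewrite Rmax_right by lra. rewrite 2!Rplus_minus_l.
      eapply Rle_trans.
      { apply (Hdiff p z (P n) (Z n) (2 * (M * (/ 2) ^ n))); try apply Hc; try apply Hcz; try lra.
        - specialize (Hpow n). nra.
        - intros s Hs. destruct (Hap n s ltac:(lra)) as [H1 H2].
          rewrite Rmax_right in H1, H2 by lra. lra. }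
      right. field. }
    assert (Hz : forall n, 0 < (/ 2) ^ n) by (intros; apply pow_lt; lra).
    split; apply Rminus_diag_uniq;
      apply (zero_of_geometric_bound _ (2 * (M * exp (2 * W t)))); intros n;
      specialize (Hn n); destruct (Hap (S n) t ltac:(lra)) as [H1 H2];
      rewrite Rmax_right in H1, H2 by lra; simpl pow in H1, H2;
      pose proof (exp_pos (2 * W t)); specialize (Hz n);
      pose proof (Rabs_pos (RInt (fun s => F s (p s) (z s)) t0 t - (P (S n) t - p0)));
      pose proof (Rabs_pos (RInt (fun s => G s (p s) (z s)) t0 t - (Z (S n) t - z0))).
    - replace (p t - (p0 + RInt (fun s => F s (p s) (z s)) t0 t)) with
        ((p t - P (S n) t) + - (RInt (fun s => F s (p s) (z s)) t0 t - (P (S n) t - p0))) by ring.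
      eapply Rle_trans; [apply Rabs_triang|]. rewrite Rabs_Ropp.
      assert (0 <= M * exp (2 * W t) * (/ 2) ^ n) by (apply Rmult_le_pos; nra). lra.
    - replace (z t - (z0 + RInt (fun s => G s (p s) (z s)) t0 t)) with
        ((z t - Z (S n) t) + - (RInt (fun s => G s (p s) (z s)) t0 t - (Z (S n) t - z0))) by ring.
      eapply Rle_trans; [apply Rabs_triang|]. rewrite Rabs_Ropp.
      assert (0 <= M * exp (2 * W t) * (/ 2) ^ n) by (apply Rmult_le_pos; nra). lra. }
  assert (Hder : forall H c (y : R -> R), H = F \/ H = G ->
    (forall t, t0 <= t -> y t = c + RInt (fun s => H s (p s) (z s)) t0 t) ->
    forall t, t0 < t -> is_derive y t (H t (p t) (z t))).
  { intros H c y HH Hy t Ht.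
    apply is_derive_ext_loc with (f := fun t => c + RInt (fun s => H s (p s) (z s)) t0 t).
    { exists (mkposreal (t - t0) ltac:(lra)). intros s Hs.
      apply Rabs_lt_between' in Hs. simpl in Hs. symmetry. apply Hy. lra. }
    evar_last.
    - apply is_derive_Rplus; [apply is_derive_const|].
      apply is_derive_RInt with t0.
      + apply filter_forall. intros x. apply (@RInt_correct R_CompleteNormedModule).
        apply Hint; [exact HH | apply Hcz | apply Hcz].
      + destruct HH as [-> | ->]; apply Hcont; apply Hcz.
    - apply Rplus_0_l. }
  exists p, z. split; [apply Hcz|]. split; [apply Hcz|].
  destruct (Hfix t0 ltac:(lra)) as [Hp0 Hz0].
  rewrite (RInt_point (V := R_CompleteNormedModule)) in Hp0, Hz0.
  split; [rewrite Hp0; apply Rplus_0_r|]. split; [rewrite Hz0; apply Rplus_0_r|].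
  intros t Ht. split.
  - apply (Hder F p0); [now left | intros; now apply Hfix | exact Ht].
  - apply (Hder G z0); [now right | intros; now apply Hfix | exact Ht].
Qed.

(** * The reduced system *)

Definition zfield (p q z : R) : R := (1 + z) * (6 - (2 + z) / p - z / q).

Definition reduced_at (p z : R -> R) (x : R) : Prop :=
  0 < p x /\ 0 < p x + 2 * x /\ 0 < 1 + z x /\
  is_derive p x (z x) /\ is_derive z x (zfield (p x) (p x + 2 * x) (z x)).

(** At [x = - c / 6] and [p = c / 3] the quantity [q = p + 2 x] vanishes and the equation for [z]
    degenerates, so the initial condition is imposed through one-sided limits. *)
Definition singular_start (c : R) (p z : R -> R) : Prop :=
  filterlim p (at_right (- c / 6)) (locally (c / 3)) /\
  filterlim z (at_right (- c / 6)) (locally 0).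

Lemma at_right_interval (P : R -> Prop) (a : R) :
  at_right a P -> exists b, a < b /\ forall x, a < x < b -> P x.
Proof.
  intros [d Hd]. pose proof (cond_pos d). exists (a + d). split; [lra|].
  intros x Hx. apply Hd; [apply Rabs_lt_between'; simpl|]; lra.
Qed.

Lemma reduced_continuity (p z : R -> R) (x : R) :
  reduced_at p z x -> continuity_pt p x /\ continuity_pt z x.
Proof.
  intros (_ & _ & _ & Hp & Hz). split; eapply is_derive_continuity_pt; eassumption.
Qed.

Lemma zfield_at_0 (p q : R) : zfield p q 0 = 6 - 2 / p.
Proof. unfold zfield, Rdiv. ring. Qed.

(** Near the singular end [p] is close to [c / 3 > 1 / 3], so [6 - 2 / p > 0]; if [z <= 0], the
    remaining terms [- z / p] and [- z / q] are nonnegative however large [1 / q] is. Once [z] is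
    positive, [p] increases, so [z' = 6 - 2 / p] stays positive at any later zero of [z]. *)
Lemma z_positive (c : R) (p z : R -> R) (x : R) :
  1 < c -> singular_start c p z -> - c / 6 < x ->
  (forall y, - c / 6 < y <= x -> reduced_at p z y) ->
  0 < z x /\ c / 3 <= p x.
Proof.
  intros Hc [Hp0 Hz0] Hx Hred.
  assert (Hnear : exists b, - c / 6 < b /\ forall y, - c / 6 < y < b -> 1 / 3 < p y).
  { apply at_right_interval. apply (Hp0 (fun v => 1 / 3 < v)). apply open_gt. lra. }
  destruct Hnear as [b0 [Hb0 Hnear]].
  set (b := Rmin b0 x).
  assert (Hb : - c / 6 < b <= b0 /\ b <= x).
  { unfold b. repeat split; [apply Rmin_glb_lt; lra | apply Rmin_l | apply Rmin_r]. }
  assert (Hzb : forall y, - c / 6 < y < b -> 0 < z y).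
  { apply positive_from_limit with (df := fun t => zfield (p t) (p t + 2 * t) (z t)).
    - intros t Ht. apply (Hred t). lra.
    - intros t Ht Hzt. specialize (Hnear t ltac:(lra)).
      destruct (Hred t ltac:(lra)) as (H1 & H2 & H3 & _).
      unfold zfield. apply Rmult_lt_0_compat; [exact H3|].
      assert (2 / p t < 6).
      { apply Rmult_lt_reg_r with (p t); [lra|]. field_simplify; lra. }
      assert (0 <= - z t / p t) by (apply Rle_mult_inv_pos; lra).
      assert (0 <= - z t / (p t + 2 * t)) by (apply Rle_mult_inv_pos; lra).
      unfold Rdiv in *. lra.
    - exact Hz0. }
  assert (Hz : forall y, - c / 6 < y <= x -> 0 < z y).
  { intros y Hy. destruct (Rlt_dec y b); [apply Hzb; lra|].
    set (t0 := (- c / 6 + b) / 2).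
    assert (Ht0 : - c / 6 < t0 < b) by (unfold t0; lra).
    apply (stay_positive z (fun t => zfield (p t) (p t + 2 * t) (z t)) t0 y); [| | | |lra].
    - intros t Ht. apply (reduced_continuity p), Hred. lra.
    - intros t Ht. apply (Hred t). lra.
    - apply Hzb. exact Ht0.
    - intros t Ht Hzt Hpos. rewrite Hzt, zfield_at_0.
      assert (p t0 <= p t).
      { apply (nondecreasing_on p z t0 t); [lra| | |].
        - intros s Hs. apply (reduced_continuity p z), Hred. lra.
        - intros s Hs. apply (Hred s). lra.
        - intros s Hs. left. apply Hpos. lra. }
      specialize (Hnear t0 ltac:(lra)).
      assert (2 / p t < 6); [|lra].
      apply Rmult_lt_reg_r with (p t); [lra|]. field_simplify; lra. }
  split; [apply Hz; lra|].
  (* A value of [p] below its limit at the left end would be exceeded by values close to that end,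
     although [p] increases. *)
  destruct (Rle_lt_dec (c / 3) (p x)) as [|Hlt]; [easy|exfalso].
  assert (Hl : exists b, - c / 6 < b /\ forall y, - c / 6 < y < b -> p x < p y).
  { apply at_right_interval. apply (Hp0 (fun v => p x < v)). now apply open_gt. }
  destruct Hl as [b1 [Hb1 Hl]].
  set (y := (- c / 6 + Rmin b1 x) / 2).
  assert (Hy : - c / 6 < y < b1 /\ y < x).
  { unfold y. pose proof (Rmin_l b1 x). pose proof (Rmin_r b1 x).
    assert (- c / 6 < Rmin b1 x) by (apply Rmin_glb_lt; lra). lra. }
  specialize (Hl y ltac:(lra)).
  assert (p y <= p x); [|lra].
  apply (nondecreasing_on p z y x); [lra| | |].
  - intros s Hs. apply (reduced_continuity p z), Hred. lra.
  - intros s Hs. apply (Hred s). lra.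
  - intros s Hs. left. apply Hz. lra.
Qed.

(** The mirror image of [z_positive]: for [p < 1 / 3] one has [6 - 2 / p < 0], for [z >= 0] the
    other terms have the same sign, and a negative [z] lets [p] decrease further. *)
Lemma z_negative (c : R) (p z : R -> R) (x : R) :
  0 < c < 1 -> singular_start c p z -> - c / 6 < x ->
  (forall y, - c / 6 < y <= x -> reduced_at p z y) ->
  z x < 0 /\ p x < 1 / 3.
Proof.
  intros Hc [Hp0 Hz0] Hx Hred.
  assert (Hnear : exists b, - c / 6 < b /\ forall y, - c / 6 < y < b -> p y < 1 / 3).
  { apply at_right_interval. apply (Hp0 (fun v => v < 1 / 3)). apply open_lt. lra. }
  destruct Hnear as [b0 [Hb0 Hnear]].
  set (b := Rmin b0 x).
  assert (Hb : - c / 6 < b <= b0 /\ b <= x).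
  { unfold b. repeat split; [apply Rmin_glb_lt; lra | apply Rmin_l | apply Rmin_r]. }
  assert (Hdz : forall t, - c / 6 < t <= x ->
    is_derive (fun t => - z t) t (- zfield (p t) (p t + 2 * t) (z t))).
  { intros t Ht. apply is_derive_Ropp.
    now apply (Hred t). }
  assert (H6 : forall t, 0 < p t -> p t < 1 / 3 -> 6 < 2 / p t).
  { intros t H1 H2. apply Rmult_lt_reg_r with (p t); [lra|]. field_simplify; lra. }
  assert (Hzb : forall y, - c / 6 < y < b -> 0 < - z y).
  { apply positive_from_limit with (df := fun t => - zfield (p t) (p t + 2 * t) (z t)).
    - intros t Ht. apply Hdz. lra.
    - intros t Ht Hzt. specialize (Hnear t ltac:(lra)).
      destruct (Hred t ltac:(lra)) as (H1 & H2 & H3 & _).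
      unfold zfield. specialize (H6 t H1 Hnear).
      assert (0 <= z t / p t) by (apply Rle_mult_inv_pos; lra).
      assert (0 <= z t / (p t + 2 * t)) by (apply Rle_mult_inv_pos; lra).
      assert (0 < (2 + z t) / p t + z t / (p t + 2 * t) - 6) by (unfold Rdiv in *; lra).
      nra.
    - replace 0 with (- 0) by ring.
      apply (filterlim_comp _ _ _ z Ropp _ (locally 0)); [exact Hz0|].
      apply (filterlim_opp (K := R_AbsRing) (V := R_NormedModule)). }
  assert (Hz : forall y, - c / 6 < y <= x -> 0 < - z y).
  { intros y Hy. destruct (Rlt_dec y b); [apply Hzb; lra|].
    set (t0 := (- c / 6 + b) / 2).
    assert (Ht0 : - c / 6 < t0 < b) by (unfold t0; lra).
    apply (stay_positive (fun t => - z t)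
             (fun t => - zfield (p t) (p t + 2 * t) (z t)) t0 y); [| | | |lra].
    - intros t Ht. eapply is_derive_continuity_pt. apply Hdz. lra.
    - intros t Ht. apply Hdz. lra.
    - apply Hzb. exact Ht0.
    - intros t Ht Hzt Hpos. replace (z t) with 0 by lra. rewrite zfield_at_0.
      assert (- p t0 <= - p t).
      { apply (nondecreasing_on (fun t => - p t) (fun t => - z t) t0 t); [lra| | |].
        - intros s Hs. apply continuity_pt_opp.
          apply (reduced_continuity p z), Hred. lra.
        - intros s Hs. apply is_derive_Ropp.
          apply (Hred s). lra.
        - intros s Hs. left. apply Hpos. lra. }
      specialize (Hnear t0 ltac:(lra)).
      destruct (Hred t ltac:(lra)) as (H1 & _).
      specialize (H6 t H1 ltac:(lra)). lra. }
  split; [specialize (Hz x ltac:(lra)); lra|].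
  set (y := (- c / 6 + b) / 2).
  specialize (Hnear y ltac:(unfold y; lra)).
  assert (- p y <= - p x); [|lra].
  apply (nondecreasing_on (fun t => - p t) (fun t => - z t) y x); [unfold y; lra| | |].
  - intros s Hs. apply continuity_pt_opp. apply (reduced_continuity p z), Hred. unfold y in Hs; lra.
  - intros s Hs. apply is_derive_Ropp.
    apply (Hred s). unfold y in Hs; lra.
  - intros s Hs. left. apply Hz. unfold y in Hs; lra.
Qed.

(** From [x = 0] on, [z] stays below a fixed [- e], so [p] decreases at rate at least [e] and cannot
    stay positive. *)
Lemma no_global_solution (c : R) (p z : R -> R) :
  0 < c < 1 -> singular_start c p z ->
  ~ (forall y, - c / 6 < y -> reduced_at p z y).
Proof.
  intros Hc Hs Hred.
  assert (Hneg : forall x, - c / 6 < x -> z x < 0 /\ p x < 1 / 3).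
  { intros x Hx. apply (z_negative c); try easy. intros y Hy. apply Hred. lra. }
  assert (Hdec : forall a b, - c / 6 < a <= b -> p b <= p a).
  { intros a b Hab. apply Ropp_le_cancel.
    apply (nondecreasing_on (fun t => - p t) (fun t => - z t) a b); [lra| | |].
    - intros s Hs'. apply continuity_pt_opp. apply (reduced_continuity p z), Hred. lra.
    - intros s Hs'. apply is_derive_Ropp.
      apply (Hred s). lra.
    - intros s Hs'. destruct (Hneg s ltac:(lra)). lra. }
  destruct (Hneg 0 ltac:(lra)) as [Hz0 Hp0].
  (* The first entry gives [z < - e] at [x = 0]. The second gives [3 p <= 1 - 2 e] from there on,
     which makes [6 - (2 - 2 e) / p] negative. *)
  set (e := Rmin (- z 0 / 2) ((1 - 3 * p 0) / 2)).
  assert (He : 0 < e /\ e < - z 0 /\ e <= (1 - 3 * p 0) / 2).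
  { unfold e. repeat split.
    - apply Rmin_glb_lt; lra.
    - pose proof (Rmin_l (- z 0 / 2) ((1 - 3 * p 0) / 2)). lra.
    - apply Rmin_r. }
  assert (Hze : forall x, 0 <= x -> 0 < - e - z x).
  { intros x Hx.
    apply (stay_positive (fun t => - e - z t)
             (fun t => - zfield (p t) (p t + 2 * t) (z t)) 0 x); [| | lra | | lra].
    - intros t Ht. apply continuity_pt_minus; [apply continuity_pt_const; easy|].
      apply (reduced_continuity p), Hred. lra.
    - intros t Ht. destruct (Hred t ltac:(lra)) as (_ & _ & _ & _ & Hd).
      evar_last. { apply is_derive_Rminus;
        [apply is_derive_const | exact Hd]. }
      unfold minus, plus, opp, zero; simpl. ring.
    - intros t Ht Hzt _. replace (z t) with (- e) by lra.
      destruct (Hred t ltac:(lra)) as (H1 & H2 & H3 & _).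
      pose proof (Hdec 0 t ltac:(lra)) as H4.
      unfold zfield.
      (* For [t >= 0] one has [q >= p]; this is why the barrier starts at 0 rather than at the
         singular end. *)
      assert (Hq : e / (p t + 2 * t) <= e / p t).
      { apply Rmult_le_compat_l; [lra|]. apply Rinv_le_contravar; lra. }
      assert (Hp : (6 - (2 + - e) / p t + e / p t) * p t < 0).
      { field_simplify; lra. }
      assert (6 - (2 + - e) / p t + e / p t < 0) by nra.
      assert (6 - (2 + - e) / p t - - e / (p t + 2 * t) < 0)
        by (unfold Rdiv in *; lra).
      replace (z t) with (- e) in H3 by lra. nra. }
  (* The time at which the line [p 0 - e x], which lies above [p], reaches 0. *)
  set (X := p 0 / e).
  assert (HX : 0 < X).
  { unfold X. destruct (Hred 0 ltac:(lra)) as (H1 & _). now apply Rdiv_lt_0_compat. }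
  assert (- p 0 - e * 0 <= - p X - e * X).
  { apply (nondecreasing_on (fun t => - p t - e * t) (fun t => - z t - e * 1) 0 X); [lra| | |].
    - intros s Hs'. apply continuity_pt_minus.
      + apply continuity_pt_opp. apply (reduced_continuity p z), Hred. lra.
      + apply continuity_pt_mult; [now apply continuity_pt_const|].
        apply derivable_continuous_pt, derivable_pt_id.
    - intros s Hs'. apply is_derive_Rminus.
      + apply is_derive_Ropp. apply (Hred s). lra.
      + apply is_derive_scal, (is_derive_id (K := R_AbsRing)).
    - intros s Hs'. specialize (Hze s ltac:(lra)). lra. }
  destruct (Hred X ltac:(lra)) as (H1 & _).
  assert (e * X = p 0) by (unfold X; field; lra). lra.
Qed.

Lemma bounds_on_segment (p z : R -> R) (a b : R) :
  a <= b ->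
  (forall y, a <= y <= b -> continuity_pt p y /\ continuity_pt z y /\ 0 < p y) ->
  exists m M, 0 < m /\ 0 <= M /\ forall y, a <= y <= b -> m <= p y /\ Rabs (z y) <= M.
Proof.
  intros Hab Hred.
  destruct (continuity_ab_min p a b Hab) as [ym [Hm1 Hm2]].
  { intros y Hy. now apply Hred. }
  destruct (continuity_ab_maj (fun y => Rabs (z y)) a b Hab) as [yM [HM1 HM2]].
  { intros y Hy. apply (continuity_pt_comp z Rabs); [now apply Hred | apply Rcontinuity_abs]. }
  exists (p ym), (Rabs (z yM)). split; [now apply Hred|]. split; [apply Rabs_pos|].
  intros y Hy. split; [now apply Hm1 | now apply HM1].
Qed.

(** Gronwall for the squared distance to the constant solution [(1 / 3, 0)]. The unbounded
    coefficient [1 / q] appears in the derivative only in front of [- z ^ 2], so the growth rate [K]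
    is uniform up to the singular end, where the energy tends to 0. *)
Lemma solution_c1 (p z : R -> R) (x : R) :
  singular_start 1 p z -> - (1) / 6 < x ->
  (forall y, - (1) / 6 < y <= x -> reduced_at p z y) ->
  z x = 0 /\ p x = 1 / 3.
Proof.
  intros [Hp0 Hz0] Hx Hred.
  assert (Hnear : exists b, - (1) / 6 < b /\
            forall y, - (1) / 6 < y < b -> 1 / 6 < p y /\ Rabs (z y) < 1).
  { apply at_right_interval. apply filter_and.
    - apply (Hp0 (fun v => 1 / 6 < v)). apply open_gt. lra.
    - apply (Hz0 (fun v => Rabs v < 1)).
      exists (mkposreal 1 Rlt_0_1). intros v Hv.
      apply Rabs_lt_between' in Hv. simpl in Hv. apply Rabs_def1; lra. }
  destruct Hnear as [b0 [Hb0 Hnear]].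
  set (b := (- (1) / 6 + Rmin b0 x) / 2).
  assert (Hb : - (1) / 6 < b < b0 /\ b <= x).
  { unfold b. pose proof (Rmin_l b0 x). pose proof (Rmin_r b0 x).
    assert (- (1) / 6 < Rmin b0 x) by (apply Rmin_glb_lt; lra). lra. }
  (* Close to the singular end the bounds come from the limits 1/3 and 0, on the remaining compact
     segment from continuity. *)
  assert (Hbd : exists m M, 0 < m /\ 0 <= M /\
     forall y, - (1) / 6 < y <= x -> m <= p y /\ Rabs (z y) <= M).
  { destruct (bounds_on_segment p z b x) as [m [M [Hm [HM H]]]]; [lra| |].
    { intros y Hy. destruct (Hred y ltac:(lra)) as (Hpy & _).
      destruct (reduced_continuity p z y); [apply Hred; lra | easy]. }
    exists (Rmin m (1 / 6)), (Rmax M 1).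
    split; [apply Rmin_glb_lt; lra|].
    split; [apply Rle_trans with M; [lra|apply Rmax_l]|].
    intros y Hy. destruct (Rlt_dec y b).
    - destruct (Hnear y ltac:(lra)). split.
      + apply Rle_trans with (1 / 6); [apply Rmin_r|lra].
      + apply Rle_trans with 1; [lra|apply Rmax_r].
    - destruct (H y ltac:(lra)). split.
      + apply Rle_trans with m; [apply Rmin_l|lra].
      + apply Rle_trans with M; [lra|apply Rmax_l]. }
  destruct Hbd as [m [M [Hm [HM Hbd]]]].
  set (E := fun t => z t ^ 2 + (p t - 1 / 3) ^ 2).
  assert (HEpos : forall t, 0 <= E t).
  { intros t. unfold E. pose proof (pow2_ge_0 (z t)). pose proof (pow2_ge_0 (p t - 1 / 3)). lra. }
  (* The first summand bounds the part from [z z'], using [6 - 2 / p = 6 (p - 1 / 3) / p]; the 1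
     comes from [2 (p - 1 / 3) z <= E]. *)
  set (K := 6 * (1 + M) / m + 1).
  assert (HK : 0 < K).
  { unfold K. assert (0 < 6 * (1 + M) / m) by (apply Rdiv_lt_0_compat; lra). lra. }
  assert (HdE : forall t, - (1) / 6 < t <= x ->
     is_derive E t (2 * z t * zfield (p t) (p t + 2 * t) (z t) + 2 * (p t - 1 / 3) * z t)).
  { intros t Ht. destruct (Hred t Ht) as (_ & _ & _ & Hp & Hz). unfold E.
    evar_last.
    - apply is_derive_Rplus.
      + apply is_derive_pow, Hz.
      + apply is_derive_pow. apply is_derive_Rminus;
          [exact Hp | apply is_derive_const].
    - unfold plus, minus, opp, zero; simpl. unfold plus; simpl. ring. }
  assert (HE : forall y, - (1) / 6 < y <= x -> E x * exp (- (K * x)) <= E y * exp (- (K * y))).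
  { intros y Hy.
    apply (gronwall E
      (fun t => 2 * z t * zfield (p t) (p t + 2 * t) (z t) + 2 * (p t - 1 / 3) * z t)
      (fun t => K * t) (fun _ => K * 1)); [lra| | | |].
    - intros t Ht. eapply is_derive_continuity_pt. apply HdE. lra.
    - intros t Ht. apply HdE. lra.
    - intros t _. apply is_derive_scal, (is_derive_id (K := R_AbsRing)).
    - intros t Ht. destruct (Hred t ltac:(lra)) as (H1 & H2 & H3 & _).
      destruct (Hbd t ltac:(lra)) as [H4 H5].
      (* [z z' = (1 + z) (z (6 - 2/p) - z^2/p - z^2/q)] and the last two terms help. *)
      assert (Hz2 : 2 * z t * zfield (p t) (p t + 2 * t) (z t)
                    <= 2 * ((1 + z t) * (6 / p t)) * (z t * (p t - 1 / 3))).
      { unfold zfield.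
        assert (0 < / p t) by now apply Rinv_0_lt_compat.
        assert (0 < / (p t + 2 * t)) by now apply Rinv_0_lt_compat.
        replace (2 * z t * ((1 + z t) * (6 - (2 + z t) / p t - z t / (p t + 2 * t))))
          with (2 * ((1 + z t) * (6 / p t)) * (z t * (p t - 1 / 3))
                - 2 * (1 + z t) * (z t ^ 2 * (/ p t + / (p t + 2 * t)))) by (field; lra).
        assert (0 <= (1 + z t) * (z t ^ 2 * (/ p t + / (p t + 2 * t)))); [|lra].
        apply Rmult_le_pos; [lra|]. apply Rmult_le_pos; [apply pow2_ge_0|lra]. }
      assert (Hc : (1 + z t) * (6 / p t) <= 6 * (1 + M) / m).
      { replace (6 * (1 + M) / m) with ((1 + M) * (6 / m)) by (field; lra).
        apply Rmult_le_compat; [lra|apply Rlt_le; apply Rdiv_lt_0_compat; lra| |].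
        - pose proof (Rle_abs (z t)). lra.
        - apply Rmult_le_compat_l; [lra|]. apply Rinv_le_contravar; lra. }
      assert (0 <= (1 + z t) * (6 / p t)).
      { apply Rmult_le_pos; [lra|]. apply Rlt_le, Rdiv_lt_0_compat; lra. }
      assert (Hab : Rabs (z t * (p t - 1 / 3)) <= E t / 2).
      { unfold E. pose proof (pow2_ge_0 (z t + (p t - 1 / 3))). pose proof (pow2_ge_0 (z t - (p t - 1 / 3))).
        apply Rabs_le. split; lra. }
      apply Rabs_le_between in Hab.
      pose proof (HEpos t).
      assert ((1 + z t) * (6 / p t) * (z t * (p t - 1 / 3)) <= 6 * (1 + M) / m * (E t / 2)).
      { apply Rle_trans with ((1 + z t) * (6 / p t) * (E t / 2)).
        - apply Rmult_le_compat_l; lra.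
        - apply Rmult_le_compat_r; lra. }
      unfold K. lra. }
  assert (HEx : E x <= 0).
  { destruct (Rle_lt_dec (E x) 0) as [|Hpos]; [easy|exfalso].
    (* Since [y > - 1 / 6], the weight [exp (- (K y))] is less than [exp (K / 6)]; an energy below
       [e] near the end therefore contradicts the Gronwall inequality. *)
    set (e := E x * exp (- (K * x)) / exp (K / 6)).
    assert (He : 0 < e).
    { unfold e. apply Rdiv_lt_0_compat; [|apply exp_pos].
      apply Rmult_lt_0_compat; [lra|apply exp_pos]. }
    assert (HlE : filterlim E (at_right (- (1) / 6)) (locally 0)).
    { unfold E. replace 0 with (plus (0 ^ 2) ((1 / 3 - 1 / 3) ^ 2)) by (unfold plus; simpl; field).
      refine (filterlim_comp_2 _ _ (fun a b => a + b) _ _ _).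
      - apply (filterlim_comp _ _ _ z (fun v => v ^ 2) _ (locally 0)); [exact Hz0|].
        apply (ex_derive_continuous (K := R_AbsRing) (V := R_NormedModule) (fun v => v ^ 2)).
        auto_derive; easy.
      - apply (filterlim_comp _ _ _ p (fun v => (v - 1 / 3) ^ 2) _ (locally (1 / 3))); [exact Hp0|].
        apply (ex_derive_continuous (K := R_AbsRing) (V := R_NormedModule)
                 (fun v => (v - 1 / 3) ^ 2)).
        auto_derive; easy.
      - apply (filterlim_plus (K := R_AbsRing) (V := R_NormedModule)). }
    assert (Hn : exists b', - (1) / 6 < b' /\ forall y, - (1) / 6 < y < b' -> E y < e).
    { apply at_right_interval. apply (HlE (fun v => v < e)). now apply open_lt. }
    destruct Hn as [b1 [Hb1 Hn]].
    set (y := (- (1) / 6 + Rmin b1 x) / 2).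
    assert (Hy : - (1) / 6 < y < b1 /\ y < x).
    { unfold y. pose proof (Rmin_l b1 x). pose proof (Rmin_r b1 x).
      assert (- (1) / 6 < Rmin b1 x) by (apply Rmin_glb_lt; lra). lra. }
    specialize (HE y ltac:(lra)). specialize (Hn y ltac:(lra)).
    assert (exp (- (K * y)) < exp (K / 6)) by (apply exp_increasing; nra).
    pose proof (exp_pos (- (K * y))). pose proof (exp_pos (K / 6)).
    assert (e * exp (K / 6) = E x * exp (- (K * x))) by (unfold e; field; lra).
    pose proof (HEpos y). nra. }
  unfold E in HEx. pose proof (pow2_ge_0 (z x)). pose proof (pow2_ge_0 (p x - 1 / 3)).
  split; [|apply Rminus_diag_uniq]; apply Rsqr_0_uniq; unfold Rsqr; nra.
Qed.

(* The system is cooperative: both [p' = z] and [z' = zfield] are monotone in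
   the other unknown. *)
Lemma comparison (c c' : R) (p z p' z' : R -> R) (x : R) :
  1 < c -> c < c' -> singular_start c p z -> singular_start c' p' z' ->
  - c / 6 < x ->
  (forall y, - c / 6 < y <= x -> reduced_at p z y) ->
  (forall y, - c' / 6 < y <= x -> reduced_at p' z' y) ->
  z x < z' x /\ p x < p' x.
Proof.
  intros Hc Hcc [Hp0 Hz0] Hs' Hx Hred Hred'.
  set (xc := - c / 6) in *.
  assert (Hxc : - c' / 6 < xc) by (unfold xc; lra).
  assert (Hpos' : forall y, - c' / 6 < y <= x -> 0 < z' y /\ c' / 3 <= p' y).
  { intros y Hy. apply (z_positive c'); try easy; try lra.
    intros w Hw. apply Hred'. lra. }
  assert (Hpos : forall y, - c / 6 < y <= x -> 0 < z y /\ c / 3 <= p y).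
  { intros y Hy. apply (z_positive c); try easy; try lra.
    intros w Hw. apply Hred. unfold xc; lra. }
  destruct (Hpos' xc ltac:(lra)) as [Hz'c _].
  (* At [xc] the solution with parameter [c'] is already past its own singular end: [z'] is positive
     and [p' >= c' / 3], while [z] and [p] start from 0 and [c / 3 < c' / 3]. Strict inequalities
     therefore hold just to the right of [xc]. *)
  assert (Hnear : exists b, xc < b /\ forall y, xc < y < b ->
            (p y < c' / 3 /\ z y < z' xc / 2) /\ z' xc / 2 < z' y).
  { apply at_right_interval. repeat apply filter_and.
    - apply (Hp0 (fun v => v < c' / 3)). apply open_lt. lra.
    - apply (Hz0 (fun v => v < z' xc / 2)). apply open_lt. lra.
    - assert (Hcz : continuous z' xc).
      { apply continuous_pt, (reduced_continuity p'), Hred'. lra. }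
      apply filter_le_within. apply (Hcz (fun v => z' xc / 2 < v)). apply open_gt. lra. }
  destruct Hnear as [b0 [Hb0 Hnear]].
  set (t0 := (xc + Rmin b0 x) / 2).
  assert (Ht0 : xc < t0 < b0 /\ t0 < x).
  { unfold t0. pose proof (Rmin_l b0 x). pose proof (Rmin_r b0 x).
    assert (xc < Rmin b0 x) by (apply Rmin_glb_lt; lra). lra. }
  destruct (Hnear t0 ltac:(lra)) as [[Hn1 Hn2] Hn3].
  assert (Hpt0 : p t0 < p' t0) by (destruct (Hpos' t0 ltac:(lra)); lra).
  assert (Hdp : forall t, t0 <= t <= x -> is_derive (fun t => p' t - p t) t (z' t - z t)).
  { intros t Ht. apply is_derive_Rminus.
    - apply Hred'. lra.
    - apply Hred. lra. }
  assert (Hmono : forall t, t0 <= t <= x -> (forall s, t0 <= s < t -> 0 < z' s - z s) ->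
            p t < p' t).
  { intros t Ht Hzs.
    assert (p' t0 - p t0 <= p' t - p t); [|lra].
    apply (nondecreasing_on (fun t => p' t - p t) (fun t => z' t - z t) t0 t); [lra| | |].
    - intros s Hs. eapply is_derive_continuity_pt. apply Hdp. lra.
    - intros s Hs. apply Hdp. lra.
    - intros s Hs. left. apply Hzs. lra. }
  set (df := fun t => zfield (p' t) (p' t + 2 * t) (z' t) - zfield (p t) (p t + 2 * t) (z t)).
  assert (Hdz : forall t, t0 <= t <= x -> is_derive (fun t => z' t - z t) t (df t)).
  { intros t Ht. apply is_derive_Rminus.
    - apply Hred'. lra.
    - apply Hred. lra. }
  assert (Hz : forall t, t0 <= t <= x -> 0 < z' t - z t).
  { apply (stay_positive (fun t => z' t - z t) df).
    - intros t Ht. eapply is_derive_continuity_pt. apply Hdz. lra.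
    - intros t Ht. apply Hdz. lra.
    - lra.
    - intros t Ht Hzt Hzs. specialize (Hmono t ltac:(lra) Hzs).
      destruct (Hred t ltac:(lra)) as (H1 & H2 & _).
      destruct (Hpos t ltac:(fold xc; lra)) as [H3 _].
      unfold df. replace (z' t) with (z t) by lra. unfold zfield.
      assert (/ p' t < / p t) by (apply Rinv_lt_contravar; [apply Rmult_lt_0_compat|]; lra).
      assert (/ (p' t + 2 * t) < / (p t + 2 * t))
        by (apply Rinv_lt_contravar; [apply Rmult_lt_0_compat|]; lra).
      unfold Rdiv.
      replace (_ - _) with ((1 + z t) * ((2 + z t) * (/ p t - / p' t) +
                 z t * (/ (p t + 2 * t) - / (p' t + 2 * t)))) by ring.
      apply Rmult_lt_0_compat; [lra|].
      assert (0 < (2 + z t) * (/ p t - / p' t)) by (apply Rmult_lt_0_compat; lra).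
      assert (0 < z t * (/ (p t + 2 * t) - / (p' t + 2 * t))) by (apply Rmult_lt_0_compat; lra).
      lra. }
  split.
  - specialize (Hz x ltac:(lra)). lra.
  - apply Hmono; [lra|]. intros s Hs. apply Hz. lra.
Qed.

(** * Lipschitz bounds and uniqueness away from the singular end *)

Definition lipschitz_constant (m M : R) : R :=
  6 + 4 * (1 + M) / m + 2 * (1 + M) ^ 2 / m ^ 2.

Lemma Rinv_lipschitz (m p p' : R) :
  0 < m -> m <= p -> m <= p' -> Rabs (/ p - / p') <= Rabs (p - p') / m ^ 2.
Proof.
  intros Hm Hp Hp'.
  replace (/ p - / p') with (- (p - p') * / (p * p')) by (field; lra).
  rewrite Rabs_mult, Rabs_Ropp. unfold Rdiv. apply Rmult_le_compat_l; [apply Rabs_pos|].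
  rewrite Rabs_right by (apply Rle_ge, Rlt_le, Rinv_0_lt_compat; nra).
  apply Rinv_le_contravar; nra.
Qed.

(** The coefficient [6 + 4 (1 + M) / m] collects the variation in [z] of the two factors of
    [zfield], and [2 (1 + M) ^ 2 / m ^ 2] the variation in [p] and [q]. A single [d] bounds both
    differences because in the application [q - q' = p - p']. *)
Lemma zfield_lipschitz (m M p q z p' q' z' d : R) :
  0 < m -> 0 <= M -> m <= p -> m <= q -> m <= p' -> m <= q' ->
  Rabs z <= M -> Rabs z' <= M -> Rabs (p - p') <= d -> Rabs (q - q') <= d ->
  Rabs (zfield p q z - zfield p' q' z') <= lipschitz_constant m M * (d + Rabs (z - z')).
Proof.
  intros Hm HM Hp Hq Hp' Hq' Hz Hz' Hdp Hdq.
  assert (Hi : forall v, m <= v -> 0 < / v <= / m).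
  { intros v Hv. split; [apply Rinv_0_lt_compat; lra | apply Rinv_le_contravar; lra]. }
  assert (Hd : 0 <= d) by (pose proof (Rabs_pos (p - p')); lra).
  assert (Hm2 : forall v, Rabs v <= d -> Rabs v / m ^ 2 <= d * (/ m) ^ 2).
  { intros v Hv. rewrite pow_inv. apply Rmult_le_compat_r; [|lra].
    apply Rlt_le, Rinv_0_lt_compat, pow_lt, Hm. }
  pose proof (Rle_trans _ _ _ (Rinv_lipschitz m p p' Hm Hp Hp') (Hm2 _ Hdp)) as Hip.
  pose proof (Rle_trans _ _ _ (Rinv_lipschitz m q q' Hm Hq Hq') (Hm2 _ Hdq)) as Hiq.
  pose proof (Hi p Hp) as Ip. pose proof (Hi q Hq) as Iq.
  unfold zfield, lipschitz_constant, Rdiv.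
  pose proof (Hi m (Rle_refl m)) as Im.
  replace (_ - _) with
    ((z - z') * (6 - (2 + z) * / p - z * / q) + - ((1 + z') * ((z - z') * / p + (z - z') * / q))
     + - ((1 + z') * ((2 + z') * (/ p - / p') + z' * (/ q - / q')))) by ring.
  rewrite <- pow_inv.
  set (i := / m) in *. set (ip := / p) in *. set (iq := / q) in *.
  set (D := Rabs (z - z')). assert (HD : 0 <= D) by apply Rabs_pos.
  assert (T1 : Rabs ((z - z') * (6 - (2 + z) * ip - z * iq)) <= D * (6 + (2 + M) * i + M * i)).
  { rewrite Rabs_mult. apply Rmult_le_compat_l; [exact HD|].
    replace (6 - (2 + z) * ip - z * iq) with (6 + (- ((2 + z) * ip) + - (z * iq))) by ring.
    eapply Rle_trans; [apply Rabs_triang|]. rewrite (Rabs_right 6) by lra.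
    rewrite Rplus_assoc. apply Rplus_le_compat_l.
    eapply Rle_trans; [apply Rabs_triang|]. rewrite !Rabs_Ropp, !Rabs_mult.
    rewrite (Rabs_right ip), (Rabs_right iq) by lra.
    apply Rplus_le_compat; apply Rmult_le_compat; try apply Rabs_pos; try lra.
    eapply Rle_trans; [apply Rabs_triang|]. rewrite Rabs_right by lra. lra. }
  assert (Z1 : Rabs (1 + z') <= 1 + M).
  { eapply Rle_trans; [apply Rabs_triang|]. rewrite Rabs_R1. lra. }
  assert (Z2 : Rabs (2 + z') <= 2 + M).
  { eapply Rle_trans; [apply Rabs_triang|]. rewrite (Rabs_right 2) by lra. lra. }
  assert (T2 : Rabs ((1 + z') * ((z - z') * ip + (z - z') * iq)) <= (1 + M) * (D * i + D * i)).
  { rewrite Rabs_mult. apply Rmult_le_compat; try apply Rabs_pos; [exact Z1|].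
    eapply Rle_trans; [apply Rabs_triang|]. rewrite !Rabs_mult.
    rewrite (Rabs_right ip), (Rabs_right iq) by lra. fold D.
    apply Rplus_le_compat; apply Rmult_le_compat_l; lra. }
  assert (T3 : Rabs ((1 + z') * ((2 + z') * (ip - / p') + z' * (iq - / q')))
               <= (1 + M) * ((2 + M) * (d * i ^ 2) + M * (d * i ^ 2))).
  { rewrite Rabs_mult. apply Rmult_le_compat; try apply Rabs_pos; [exact Z1|].
    eapply Rle_trans; [apply Rabs_triang|]. rewrite !Rabs_mult.
    apply Rplus_le_compat; apply Rmult_le_compat; try apply Rabs_pos; lra. }
  eapply Rle_trans; [apply Rabs_triang|]. rewrite Rabs_Ropp.
  eapply Rle_trans; [apply Rplus_le_compat_r, Rabs_triang|]. rewrite Rabs_Ropp.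
  assert (0 <= i ^ 2) by apply pow2_ge_0.
  assert (0 <= M * i) by (apply Rmult_le_pos; lra).
  assert (0 <= d * i) by (apply Rmult_le_pos; lra).
  assert (0 <= d * (M * i)) by (apply Rmult_le_pos; lra).
  assert (0 <= D * ((1 + M) ^ 2 * i ^ 2)).
  { apply Rmult_le_pos; [lra|]. apply Rmult_le_pos; [apply pow2_ge_0|lra]. }
  nra.
Qed.

(** At a regular starting point compactness bounds [p] and [q] from below and [z] in absolute value,
    and Gronwall applies to the squared distance. The equations are asked only to the right of [a],
    which is what [continuation] provides at its starting point. *)
Lemma uniqueness (p z p' z' : R -> R) (a b : R) :
  a <= b -> p a = p' a -> z a = z' a ->
  0 < p a -> 0 < p a + 2 * a ->
  (forall y, a <= y <= b -> continuity_pt p y /\ continuity_pt z y) ->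
  (forall y, a <= y <= b -> continuity_pt p' y /\ continuity_pt z' y) ->
  (forall y, a < y <= b -> reduced_at p z y) ->
  (forall y, a < y <= b -> reduced_at p' z' y) ->
  p b = p' b /\ z b = z' b.
Proof.
  intros Hab Hpa Hza Hp0 Hq0 Hc Hc' Hred Hred'.
  assert (Hlow : forall p z, 0 < p a -> 0 < p a + 2 * a ->
     (forall y, a <= y <= b -> continuity_pt p y /\ continuity_pt z y) ->
     (forall y, a < y <= b -> reduced_at p z y) ->
     exists m M, 0 < m /\ 0 <= M /\
       forall y, a <= y <= b -> m <= p y /\ m <= p y + 2 * y /\ Rabs (z y) <= M).
  { clear. intros p z Hp Hq Hc Hred.
    destruct (Rle_dec a b) as [Hab|]; [|exists 1, 1; repeat split; lra].
    assert (Hpos : forall y, a <= y <= b -> 0 < p y /\ 0 < p y + 2 * y).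
    { intros y Hy. destruct (Req_dec y a) as [-> |]; [easy|].
      destruct (Hred y ltac:(lra)) as (H1 & H2 & _). easy. }
    destruct (bounds_on_segment p z a b Hab) as [m [M [Hm [HM H]]]].
    { intros y Hy. destruct (Hc y Hy), (Hpos y Hy). easy. }
    destruct (bounds_on_segment (fun y => p y + 2 * y) z a b Hab) as [m' [M' [Hm' [HM' H']]]].
    { intros y Hy. destruct (Hc y Hy), (Hpos y Hy). repeat split; try easy.
      apply continuity_pt_plus; [easy|].
      apply continuity_pt_mult; [now apply continuity_pt_const|].
      apply derivable_continuous_pt, derivable_pt_id. }
    exists (Rmin m m'), M. split; [now apply Rmin_glb_lt|]. split; [easy|].
    intros y Hy. destruct (H y Hy), (H' y Hy). pose proof (Rmin_l m m'). pose proof (Rmin_r m m').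
    repeat split; lra. }
  destruct (Hlow p z Hp0 Hq0 Hc Hred) as [m1 [M1 [Hm1 [HM1 B1]]]].
  destruct (Hlow p' z') as [m2 [M2 [Hm2 [HM2 B2]]]]; try easy; try (rewrite <- Hpa; lra).
  set (m := Rmin m1 m2). set (M := Rmax M1 M2).
  assert (Hm : 0 < m) by now apply Rmin_glb_lt.
  pose proof (Rmin_l m1 m2 : m <= _) as Lm1. pose proof (Rmin_r m1 m2 : m <= _) as Lm2.
  pose proof (Rmax_l M1 M2 : _ <= M) as LM1. pose proof (Rmax_r M1 M2 : _ <= M) as LM2.
  set (K := lipschitz_constant m M).
  assert (HK : 0 <= K).
  { unfold K, lipschitz_constant.
    assert (0 <= 4 * (1 + M) / m) by (apply Rle_mult_inv_pos; lra).
    assert (0 <= 2 * (1 + M) ^ 2 / m ^ 2); [|lra].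
    apply Rle_mult_inv_pos; [nra | now apply pow_lt]. }
  set (E := fun t => (p t - p' t) ^ 2 + (z t - z' t) ^ 2).
  set (dE := fun t => 2 * (p t - p' t) * (z t - z' t) + 2 * (z t - z' t) *
     (zfield (p t) (p t + 2 * t) (z t) - zfield (p' t) (p' t + 2 * t) (z' t))).
  (* In the rate [1 + 3 K], the 1 comes from [2 u w <= u ^ 2 + w ^ 2] and the 3 from
     [2 |w| (|u| + |w|) <= 3 (u ^ 2 + w ^ 2)], where [u] and [w] are the differences of [p] and of
     [z]. *)
  assert (HE : E b * exp (- ((1 + 3 * K) * b)) <= E a * exp (- ((1 + 3 * K) * a))).
  { apply (gronwall E dE (fun t => (1 + 3 * K) * t) (fun _ => (1 + 3 * K) * 1)); [exact Hab| | | |].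
    - intros t Ht. destruct (Hc t Ht), (Hc' t Ht).
      assert (Hsq : forall f, continuity_pt f t -> continuity_pt (fun t => f t ^ 2) t).
      { intros f Hf. apply (continuity_pt_comp f (fun v => v ^ 2)); [exact Hf|].
        apply derivable_continuous_pt, derivable_pt_pow. }
      apply continuity_pt_plus; apply Hsq; now apply continuity_pt_minus.
    - intros t Ht. destruct (Hred t ltac:(lra)) as (_ & _ & _ & D1 & D2).
      destruct (Hred' t ltac:(lra)) as (_ & _ & _ & D3 & D4). unfold E, dE.
      evar_last.
      + apply is_derive_Rplus;
          apply is_derive_pow; apply is_derive_Rminus;
          eassumption.
      + unfold plus, minus, opp; simpl. unfold plus; simpl. ring.
    - intros t _. apply is_derive_scal, (is_derive_id (K := R_AbsRing)).
    - intros t Ht. destruct (B1 t ltac:(lra)) as (X1 & X2 & X3).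
      destruct (B2 t ltac:(lra)) as (Y1 & Y2 & Y3).
      pose proof (zfield_lipschitz m M (p t) (p t + 2 * t) (z t) (p' t) (p' t + 2 * t) (z' t)
        (Rabs (p t - p' t)) Hm ltac:(lra) ltac:(lra) ltac:(lra) ltac:(lra) ltac:(lra)
        ltac:(lra) ltac:(lra) ltac:(lra)) as HL.
      replace (p t + 2 * t - (p' t + 2 * t)) with (p t - p' t) in HL by ring.
      specialize (HL ltac:(lra)). fold K in HL. unfold dE, E.
      set (u := p t - p' t) in *. set (w := z t - z' t) in *.
      set (v := zfield _ _ _ - zfield _ _ _) in *.
      assert (W1 : 2 * u * w <= u ^ 2 + w ^ 2) by (pose proof (pow2_ge_0 (u - w)); lra).
      assert (W2 : w * v <= Rabs w * (K * (Rabs u + Rabs w))).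
      { eapply Rle_trans; [apply Rle_abs|]. rewrite Rabs_mult.
        apply Rmult_le_compat_l; [apply Rabs_pos|exact HL]. }
      assert (W3 : 2 * (Rabs w * (Rabs u + Rabs w)) <= 3 * (u ^ 2 + w ^ 2)).
      { rewrite <- (pow2_abs u), <- (pow2_abs w).
        pose proof (pow2_ge_0 (Rabs u - Rabs w)). pose proof (pow2_ge_0 (Rabs u)).
        pose proof (pow2_ge_0 (Rabs w)). lra. }
      pose proof (Rmult_le_compat_l K _ _ HK W3). lra. }
  assert (HEa : E a = 0) by (unfold E; rewrite Hpa, Hza; ring).
  rewrite HEa, Rmult_0_l in HE.
  pose proof (exp_pos (- ((1 + 3 * K) * b))).
  assert (HEb : E b <= 0) by nra.
  unfold E in HEb.
  pose proof (pow2_ge_0 (p b - p' b)). pose proof (pow2_ge_0 (z b - z' b)).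
  split; apply Rminus_diag_uniq; apply Rsqr_0_uniq; unfold Rsqr; lra.
Qed.

(** * Continuation and growth for squashing parameter above 1 *)

(** For [B >= 0] this is the projection onto [[0, B]]. Written with [Rmax] alone, it inherits
    continuity and the Lipschitz constant 1 from [Rmax]. *)
Definition clamp (B z : R) : R := B - Rmax 0 (B - Rmax 0 z).

Lemma Rmax_lipschitz (a x y : R) : Rabs (Rmax a x - Rmax a y) <= Rabs (x - y).
Proof. unfold Rmax. destruct (Rle_dec a x), (Rle_dec a y); split_Rabs; lra. Qed.

Lemma clamp_lipschitz (B x y : R) : Rabs (clamp B x - clamp B y) <= Rabs (x - y).
Proof.
  unfold clamp.
  replace (_ - _) with (- (Rmax 0 (B - Rmax 0 x) - Rmax 0 (B - Rmax 0 y))) by ring.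
  rewrite Rabs_Ropp. eapply Rle_trans; [apply Rmax_lipschitz|].
  replace (_ - _) with (- (Rmax 0 x - Rmax 0 y)) by ring.
  rewrite Rabs_Ropp. apply Rmax_lipschitz.
Qed.

Lemma clamp_bounds (B z : R) : 0 <= B -> 0 <= clamp B z <= B.
Proof. unfold clamp, Rmax. intros H. repeat destruct (Rle_dec _ _); lra. Qed.

Lemma clamp_id (B z : R) : 0 <= z <= B -> clamp B z = z.
Proof. unfold clamp, Rmax. intros H. repeat destruct (Rle_dec _ _); lra. Qed.

Lemma clamp_le (B z : R) : 0 <= z -> clamp B z <= z.
Proof. unfold clamp, Rmax. intros H. repeat destruct (Rle_dec _ _); lra. Qed.

Lemma continuity_pt_zfield (p q z : R -> R) (t : R) :
  continuity_pt p t -> continuity_pt q t -> continuity_pt z t ->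
  p t <> 0 -> q t <> 0 ->
  continuity_pt (fun t => zfield (p t) (q t) (z t)) t.
Proof.
  intros Hp Hq Hz Hp0 Hq0. unfold zfield.
  assert (Hk : forall k, continuity_pt (fun _ => k) t) by (intros; now apply continuity_pt_const).
  apply continuity_pt_mult; [now apply continuity_pt_plus|].
  apply continuity_pt_minus; [apply continuity_pt_minus; [easy|]|].
  - apply continuity_pt_div; [now apply continuity_pt_plus | easy | easy].
  - now apply continuity_pt_div.
Qed.

(** The modified system is globally Lipschitz in [(p, z)] at each time. Along its solution [p]
    increases since the clamped [z] is nonnegative, so [p] and [q] stay above [m]; [z] stays
    positive since [z' = 6 - 2 / p > 0] at a zero; and [z <= B]. Hence the modification is never
    active. *)
Lemma continuation (t0 p0 z0 : R) :
  1 / 3 < p0 -> 0 < p0 + 2 * t0 -> 0 < z0 ->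
  exists p z : R -> R, p t0 = p0 /\ z t0 = z0 /\
    (forall t, continuity_pt p t) /\ (forall t, continuity_pt z t) /\
    forall t, t0 < t -> reduced_at p z t.
Proof.
  intros Hp0 Hq0 Hz0.
  set (m := Rmin p0 (p0 + 2 * t0)).
  assert (Hm : 0 < m <= p0 /\ m <= p0 + 2 * t0).
  { unfold m. repeat split; [apply Rmin_glb_lt; lra | apply Rmin_l | apply Rmin_r]. }
  (* The solution of [B' = 6 B] with [B t0 = 1 + z0]: it dominates [1 + z] because positive [p],
     [q], [z] give [z' <= 6 (1 + z)]. *)
  set (B := fun t => (1 + z0) * exp (6 * (t - t0))).
  assert (HB : forall t, 0 < B t).
  { intros t. apply Rmult_lt_0_compat; [lra|apply exp_pos]. }
  assert (HdB : forall t, is_derive B t (6 * B t)).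
  { intros t. unfold B. auto_derive; [easy|]. unfold Rminus. ring. }
  set (F := fun t (_ z : R) => clamp (B t) z).
  set (G := fun t p z => zfield (Rmax m p) (Rmax m (p + 2 * t)) (clamp (B t) z)).
  assert (HcB : forall t, continuity_pt B t) by (intros t; eapply is_derive_continuity_pt, HdB).
  assert (HcM : forall a f t, continuity_pt f t -> continuity_pt (fun t => Rmax a (f t)) t).
  { intros a f t Hf. apply (continuity_pt_comp f (Rmax a)); [exact Hf|].
    apply continuous_pt, continuous_Rmax. }
  assert (Hk : forall k t, continuity_pt (fun _ => k) t)
    by (intros; now apply continuity_pt_const).
  assert (Hcl : forall z t, continuity_pt z t -> continuity_pt (fun t => clamp (B t) (z t)) t).
  { intros z t Hz. apply continuity_pt_minus; [apply HcB|].
    apply HcM. apply continuity_pt_minus; [apply HcB | now apply HcM]. }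
  assert (Hid : forall t, continuity_pt (fun t => 2 * t) t).
  { intros t. apply continuity_pt_mult; [apply Hk|].
    apply derivable_continuous_pt, derivable_pt_id. }
  destruct (global_existence F G (fun t => 1 + lipschitz_constant m (B t)) t0 p0 z0)
    as (p & z & Hcp & Hcz & Hpt0 & Hzt0 & Hode).
  - intros p z Hp Hz t.
    specialize (Hp t). specialize (Hz t). apply continuous_pt in Hp, Hz.
    rewrite !continuous_pt. split; [now apply Hcl|]. unfold G.
    apply continuity_pt_zfield; [now apply HcM | | now apply Hcl | |].
    + apply HcM. now apply continuity_pt_plus.
    + pose proof (Rmax_l m (p t)). lra.
    + pose proof (Rmax_l m (p t + 2 * t)). lra.
  - intros t p z p' z' _. unfold F, G.
    pose proof (clamp_lipschitz (B t) z z') as Hcz.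
    pose proof (clamp_bounds (B t) z (Rlt_le _ _ (HB t))).
    pose proof (clamp_bounds (B t) z' (Rlt_le _ _ (HB t))).
    assert (Hz : Rabs (zfield (Rmax m p) (Rmax m (p + 2 * t)) (clamp (B t) z) -
       zfield (Rmax m p') (Rmax m (p' + 2 * t)) (clamp (B t) z')) <=
       lipschitz_constant m (B t) * (Rabs (p - p') + Rabs (clamp (B t) z - clamp (B t) z'))).
    { apply zfield_lipschitz; try apply Rmax_l; try lra.
      - apply Rabs_le; lra.
      - apply Rabs_le; lra.
      - apply Rmax_lipschitz.
      - eapply Rle_trans; [apply Rmax_lipschitz|]. right. f_equal. ring. }
    assert (HK : 0 <= lipschitz_constant m (B t)).
    { specialize (HB t). unfold lipschitz_constant.
      assert (0 <= 4 * (1 + B t) / m) by (apply Rle_mult_inv_pos; lra).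
      assert (0 <= 2 * (1 + B t) ^ 2 / m ^ 2); [|lra].
      apply Rle_mult_inv_pos; [|apply pow_lt; lra].
      pose proof (pow2_ge_0 (1 + B t)). lra. }
    pose proof (Rabs_pos (p - p')).
    pose proof (Rmult_le_compat_l _ _ _ HK (Rplus_le_compat_l (Rabs (p - p')) _ _ Hcz)).
    lra.
  - intros t. apply continuous_pt. unfold lipschitz_constant.
    assert (Hc1 : continuity_pt (fun t => 1 + B t) t) by (apply continuity_pt_plus; easy).
    assert (Hpm : 0 < m ^ 2) by (apply pow_lt; lra).
    repeat apply continuity_pt_plus; try apply Hk.
    + apply continuity_pt_div; [|apply Hk|lra]. now apply continuity_pt_mult.
    + apply continuity_pt_div; [|apply Hk|lra]. apply continuity_pt_mult; [apply Hk|].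
      apply (continuity_pt_comp _ (fun v => v ^ 2)); [exact Hc1|].
      apply derivable_continuous_pt, derivable_pt_pow.
  - assert (Hcp' : forall t, continuity_pt p t) by (intros; apply continuous_pt, Hcp).
    assert (Hcz' : forall t, continuity_pt z t) by (intros; apply continuous_pt, Hcz).
    assert (Hp : forall t, t0 <= t -> p0 <= p t).
    { intros t Ht. rewrite <- Hpt0.
      apply (nondecreasing_on p (fun t => F t (p t) (z t))); try easy.
      - intros s Hs. apply Hode. lra.
      - intros s Hs. apply clamp_bounds. left. apply HB. }
    assert (HmP : forall t, t0 <= t -> Rmax m (p t) = p t /\ Rmax m (p t + 2 * t) = p t + 2 * t).
    { intros t Ht. specialize (Hp t Ht). split; apply Rmax_right; lra. }
    assert (Hz : forall t, t0 <= t -> 0 < z t).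
    { intros t Ht.
      apply (stay_positive z (fun t => G t (p t) (z t)) t0 t); try easy; try lra.
      - intros s Hs. apply Hode. lra.
      - intros s Hs Hzs _. unfold G. rewrite Hzs.
        rewrite (clamp_id (B s) 0) by (specialize (HB s); lra).
        destruct (HmP s ltac:(lra)) as [-> _]. rewrite zfield_at_0.
        specialize (Hp s ltac:(lra)).
        assert (2 / p s < 6); [|lra].
        apply Rmult_lt_reg_r with (p s); [lra|]. field_simplify; lra. }
    (* The clamp is still present here, but it only lowers a positive [z], so the modified field is
       again at most [6 (1 + z)]. *)
    assert (HzB : forall t, t0 <= t -> z t <= B t).
    { intros t Ht.
      assert (H : (1 + z t - B t) * exp (- (6 * t)) <= (1 + z t0 - B t0) * exp (- (6 * t0))).
      { apply (gronwall (fun t => 1 + z t - B t) (fun t => G t (p t) (z t) - 6 * B t)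
                 (fun t => 6 * t) (fun _ => 6 * 1)); [exact Ht| | | |].
        - intros s _. apply continuity_pt_minus; [|apply HcB].
          now apply continuity_pt_plus.
        - intros s Hs. destruct (Hode s ltac:(lra)) as [_ Hd].
          evar_last.
          + apply is_derive_Rminus; [|apply HdB].
            apply (is_derive_Rplus
                     (fun _ => 1) z); [apply is_derive_const|exact Hd].
          + unfold minus, plus, opp, zero; simpl. ring.
        - intros s _. apply is_derive_scal, (is_derive_id (K := R_AbsRing)).
        - intros s Hs. unfold G. destruct (HmP s ltac:(lra)) as [-> ->].
          specialize (Hp s ltac:(lra)). specialize (Hz s ltac:(lra)).
          pose proof (clamp_bounds (B s) (z s) (Rlt_le _ _ (HB s))) as Hc1.
          pose proof (clamp_le (B s) (z s) (Rlt_le _ _ Hz)) as Hc2.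
          unfold zfield. set (w := clamp (B s) (z s)) in *.
          assert (0 <= (2 + w) / p s) by (apply Rle_mult_inv_pos; lra).
          assert (0 <= w / (p s + 2 * s)) by (apply Rle_mult_inv_pos; lra).
          assert ((1 + w) * (6 - (2 + w) / p s - w / (p s + 2 * s)) <= (1 + w) * 6)
            by (apply Rmult_le_compat_l; lra).
          lra. }
      assert (HB0 : B t0 = 1 + z0).
      { unfold B. replace (6 * (t0 - t0)) with 0 by ring. rewrite exp_0. ring. }
      rewrite HB0, Hzt0, Rminus_diag, Rmult_0_l in H.
      pose proof (exp_pos (- (6 * t))).
      assert (1 + z t - B t <= 0) by nra. lra. }
    exists p, z. do 4 (split; [easy|]).
    intros t H. refine (conj _ (conj _ (conj _ (conj _ _)))).
    + specialize (Hp t ltac:(lra)). lra.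
    + specialize (Hp t ltac:(lra)). lra.
    + specialize (Hz t ltac:(lra)). lra.
    + destruct (Hode t H) as [Hd _]. unfold F in Hd. rewrite clamp_id in Hd; [exact Hd|].
      split; [apply Rlt_le, Hz; lra | apply HzB; lra].
    + destruct (Hode t H) as [_ Hd]. unfold G in Hd. rewrite clamp_id in Hd.
      * destruct (HmP t ltac:(lra)) as [E1 E2]. now rewrite E1, E2 in Hd.
      * split; [apply Rlt_le, Hz; lra | apply HzB; lra].
Qed.

(** The ratio [z / p] stays above [f], so [p' >= f p]. At a first contact [z = f p] one has
    [z / q <= f], because [x > 0] gives [q >= p]; hence [6 - 2 / p - z / p - z / q >= 4 f] and
    [z' >= 4 f (1 + z) > f z]. *)
Lemma exponential_growth (p z : R -> R) (x1 : R) :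
  0 < x1 -> 1 / 3 < p x1 ->
  (forall x, x1 <= x -> reduced_at p z x) -> (forall x, x1 <= x -> 0 < z x) ->
  exists f, 0 < f /\ forall x, x1 <= x -> p x1 * exp (f * (x - x1)) <= p x.
Proof.
  intros Hx1 Hp1 Hred Hz.
  assert (Hp : forall x, x1 <= x -> p x1 <= p x).
  { intros x Hx. apply (nondecreasing_on p z); [exact Hx| | |].
    - intros s Hs. apply (reduced_continuity p z), Hred. lra.
    - intros s Hs. apply Hred. lra.
    - intros s Hs. left. apply Hz. lra. }
  assert (H6 : 0 < 6 - 2 / p x1).
  { assert (2 / p x1 < 6); [|lra].
    apply Rmult_lt_reg_r with (p x1); [lra|]. field_simplify; lra. }
  (* The first entry makes [z > f p] strict at [x1]; the second gives [6 - 2 / p >= 6 f], as [p]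
     only increases. *)
  set (f := Rmin (z x1 / p x1 / 2) ((6 - 2 / p x1) / 6)).
  assert (Hzp : 0 < z x1 / p x1) by (apply Rdiv_lt_0_compat; [apply Hz|]; lra).
  assert (Hf : 0 < f /\ f <= z x1 / p x1 / 2 /\ 6 * f <= 6 - 2 / p x1).
  { unfold f. pose proof (Rmin_r (z x1 / p x1 / 2) ((6 - 2 / p x1) / 6)).
    repeat split; [apply Rmin_glb_lt; lra | apply Rmin_l | lra]. }
  exists f. split; [lra|].
  assert (Hd : forall t, x1 <= t -> is_derive (fun t => z t - f * p t) t
                 (zfield (p t) (p t + 2 * t) (z t) - f * z t)).
  { intros t Ht. apply is_derive_Rminus.
    - apply Hred. lra.
    - apply is_derive_scal, Hred. lra. }
  assert (Hzf : forall x, x1 <= x -> 0 < z x - f * p x).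
  { intros x Hx. apply (stay_positive (fun t => z t - f * p t)
       (fun t => zfield (p t) (p t + 2 * t) (z t) - f * z t) x1 x); [| | | |lra].
    - intros t Ht. eapply is_derive_continuity_pt, Hd. lra.
    - intros t Ht. apply Hd. lra.
    - assert (z x1 = z x1 / p x1 * p x1) by (field; lra). nra.
    - intros t Ht Hzt _. specialize (Hp t ltac:(lra)). specialize (Hz t ltac:(lra)).
      assert (Hft : z t / p t = f) by (replace (z t) with (f * p t) by lra; field; lra).
      assert (Hq : z t / (p t + 2 * t) <= z t / p t).
      { apply Rmult_le_compat_l; [lra|]. apply Rinv_le_contravar; lra. }
      assert (H2 : 2 / p t <= 2 / p x1).
      { apply Rmult_le_compat_l; [lra|]. apply Rinv_le_contravar; lra. }
      unfold zfield.
      replace ((2 + z t) / p t) with (2 / p t + z t / p t) by (field; lra).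
      rewrite Hft in *.
      assert (4 * f <= 6 - (2 / p t + f) - z t / (p t + 2 * t)) by lra.
      nra. }
  intros x Hx.
  assert (H : - p x * exp (- (f * x)) <= - p x1 * exp (- (f * x1))).
  { apply (gronwall (fun t => - p t) (fun t => - z t) (fun t => f * t) (fun _ => f * 1));
      [exact Hx| | | |].
    - intros t Ht. apply continuity_pt_opp, (reduced_continuity p z), Hred. lra.
    - intros t Ht. apply is_derive_Ropp.
      apply Hred. lra.
    - intros t _. apply is_derive_scal, (is_derive_id (K := R_AbsRing)).
    - intros t Ht. specialize (Hzf t ltac:(lra)). lra. }
  apply Rmult_le_reg_r with (exp (- (f * x))); [apply exp_pos|].
  rewrite Rmult_assoc, <- exp_plus.
  replace (f * (x - x1) + - (f * x)) with (- (f * x1)) by ring. lra.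
Qed.

Lemma nonincreasing_limit (f : R -> R) (a K : R) :
  (forall x y, a <= x <= y -> f y <= f x) -> (forall x, a <= x -> K <= f x) ->
  exists l : R, is_lim f p_infty l.
Proof.
  intros Hdec HK.
  destruct (completeness (fun v => exists x, a <= x /\ v = - f x)) as [m [Hub Hlub]].
  - exists (- K). intros v [x [Hx ->]]. specialize (HK x Hx). lra.
  - exists (- f a). exists a. split; [lra|easy].
  - exists (- m). apply is_lim_spec. intros eps. pose proof (cond_pos eps).
    assert (Hx : exists x, a <= x /\ f x < - m + eps).
    { destruct (Classical_Prop.classic (exists x, a <= x /\ f x < - m + eps)) as [|Hn]; [easy|].
      exfalso. assert (m <= m - eps); [|lra]. apply Hlub. intros v [x [Hx ->]].
      destruct (Rlt_dec (f x) (- m + eps)); [|lra]. exfalso. apply Hn. now exists x. }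
    destruct Hx as [x [Hx1 Hx2]]. exists x. intros y Hy.
    assert (- f y <= m) by (apply Hub; exists y; split; [lra|easy]).
    specialize (Hdec x y ltac:(lra)). apply Rabs_def1; lra.
Qed.

(** For [x > 0] the dilaton decreases, and [q >= 2 x] bounds its rate by [1 / (2 p)], which decays
    exponentially. So it is bounded below by its value at [x1] minus the integral of that
    majorant. *)
Lemma dilaton_limit (p z phi : R -> R) (x1 : R) :
  0 < x1 -> 1 / 3 < p x1 ->
  (forall x, x1 <= x -> reduced_at p z x) -> (forall x, x1 <= x -> 0 < z x) ->
  (forall x, x1 <= x -> is_derive phi x (- (x / (p x * (p x + 2 * x))))) ->
  exists l : R, is_lim phi p_infty l.
Proof.
  intros Hx1 Hp1 Hred Hz Hphi.
  destruct (exponential_growth p z x1 Hx1 Hp1 Hred Hz) as [f [Hf Hg]].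
  set (C := / (2 * p x1)).
  assert (HC : 0 < C) by (apply Rinv_0_lt_compat; lra).
  assert (Hpp : forall x, x1 <= x -> 0 < p x) by (intros x Hx; now apply Hred).
  apply nonincreasing_limit with (a := x1) (K := phi x1 - C / f).
  - intros x y Hxy. apply Ropp_le_cancel.
    apply (nondecreasing_on (fun t => - phi t) (fun t => t / (p t * (p t + 2 * t)))); [lra| | |].
    + intros t Ht. apply continuity_pt_opp. eapply is_derive_continuity_pt, Hphi. lra.
    + intros t Ht. rewrite <- (Ropp_involutive (_ / _)).
      apply is_derive_Ropp. apply Hphi. lra.
    + intros t Ht. specialize (Hpp t ltac:(lra)).
      apply Rle_mult_inv_pos; [lra|]. apply Rmult_lt_0_compat; lra.
  - intros x Hx.
    set (N := fun t => phi t - C / f * exp (- f * (t - x1))).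
    assert (HdN : forall t, x1 <= t -> is_derive N t
              (- (t / (p t * (p t + 2 * t))) + C * exp (- f * (t - x1)))).
    { intros t Ht. unfold N. evar_last.
      - apply is_derive_Rminus; [apply Hphi; lra|].
        apply is_derive_scal. auto_derive; [easy|reflexivity].
      - unfold minus, plus, opp; simpl. unfold Rminus; field. specialize (Hpp t Ht). repeat split; lra. }
    assert (HN : N x1 <= N x).
    { apply (nondecreasing_on N _ x1 x Hx
        (fun t Ht => is_derive_continuity_pt _ _ _ (HdN t (proj1 Ht)))
        (fun t Ht => HdN t (Rlt_le _ _ (proj1 Ht)))).
      intros t Ht. specialize (Hpp t ltac:(lra)). specialize (Hg t ltac:(lra)).
      assert (t / (p t * (p t + 2 * t)) <= C * exp (- f * (t - x1))); [|lra].
      apply Rle_trans with (/ (2 * p t)).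
      - apply Rmult_le_reg_r with (2 * p t * (p t + 2 * t)); [apply Rmult_lt_0_compat; lra|].
        field_simplify; lra.
      - unfold C. replace (- f * (t - x1)) with (- (f * (t - x1))) by ring.
        rewrite exp_Ropp, <- Rinv_mult. apply Rinv_le_contravar; [|lra].
        apply Rmult_lt_0_compat; [lra|apply exp_pos]. }
    unfold N in HN. replace (- f * (x1 - x1)) with 0 in HN by ring. rewrite exp_0 in HN.
    pose proof (exp_pos (- f * (x - x1))).
    assert (0 < C / f) by (apply Rdiv_lt_0_compat; lra). nra.
Qed.

Lemma exp_decay (k C eps : R) : 0 < k -> 0 < eps ->
  exists X, forall x, X < x -> Rabs (C * exp (- (k * x))) < eps.
Proof.
  intros Hk He. exists (Rmax 0 (Rabs C / (eps * k))). intros x Hx.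
  assert (H0 : 0 < x) by (pose proof (Rmax_l 0 (Rabs C / (eps * k))); lra).
  assert (H1 : Rabs C / (eps * k) < x) by (pose proof (Rmax_r 0 (Rabs C / (eps * k))); lra).
  rewrite Rabs_mult, (Rabs_right (exp _)) by (apply Rle_ge, Rlt_le, exp_pos).
  rewrite exp_Ropp. pose proof (exp_pos (k * x)).
  apply Rmult_lt_reg_r with (exp (k * x)); [easy|].
  rewrite Rmult_assoc, Rinv_l, Rmult_1_r by lra.
  pose proof (exp_ineq1_le (k * x)).
  assert (Rabs C < x * (eps * k)).
  { assert (0 < eps * k) by nra.
    apply Rmult_lt_reg_r with (/ (eps * k)); [now apply Rinv_0_lt_compat|].
    rewrite Rmult_assoc, Rinv_r by lra. unfold Rdiv in H1. lra. }
  assert (0 < k * x) by nra. nra.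
Qed.

(** The rule of l'Hopital with denominator [exp (k x)]: subtracting [(l + eps / 3) exp (k x)] or
    [(l - eps / 3) exp (k x)] makes [h] eventually monotone, and after division only a decaying
    constant is left. *)
Lemma lhopital_exp (h g : R -> R) (k x1 l : R) :
  0 < k -> (forall x, x1 <= x -> is_derive h x (g x * (k * exp (k * x)))) ->
  is_lim g p_infty l -> is_lim (fun x => h x * exp (- (k * x))) p_infty l.
Proof.
  intros Hk Hh Hg. apply is_lim_spec in Hg. apply is_lim_spec. intros eps.
  pose proof (cond_pos eps) as He.
  assert (He3 : 0 < eps / 3) by lra.
  destruct (Hg (mkposreal _ He3)) as [X HX]. simpl in HX.
  set (a := Rmax (X + 1) x1).
  assert (Ha : X < a /\ x1 <= a).
  { unfold a. pose proof (Rmax_l (X + 1) x1). pose proof (Rmax_r (X + 1) x1). lra. }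
  assert (Hexp : forall c t, is_derive (fun t => c * exp (k * t)) t (c * (k * exp (k * t)))).
  { intros c t. auto_derive; [easy|ring]. }
  assert (Hup : forall x, a <= x -> h x - (l + eps / 3) * exp (k * x)
                                   <= h a - (l + eps / 3) * exp (k * a)).
  { intros x Hx. apply Ropp_le_cancel.
    assert (Hd : forall t, a <= t -> is_derive (fun t => - (h t - (l + eps / 3) * exp (k * t))) t
       (- (g t * (k * exp (k * t)) - (l + eps / 3) * (k * exp (k * t))))).
    { intros t Ht. apply is_derive_Ropp.
      apply is_derive_Rminus; [apply Hh; lra|apply Hexp]. }
    apply (nondecreasing_on _ _ a x Hx
        (fun t Ht => is_derive_continuity_pt _ _ _ (Hd t (proj1 Ht)))
        (fun t Ht => Hd t (Rlt_le _ _ (proj1 Ht)))).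
    intros t Ht. specialize (HX t ltac:(lra)). apply Rabs_def2 in HX.
    assert (0 < k * exp (k * t)) by (apply Rmult_lt_0_compat; [easy|apply exp_pos]). nra. }
  assert (Hlo : forall x, a <= x -> h a - (l - eps / 3) * exp (k * a)
                                   <= h x - (l - eps / 3) * exp (k * x)).
  { intros x Hx.
    assert (Hd : forall t, a <= t -> is_derive (fun t => h t - (l - eps / 3) * exp (k * t)) t
       (g t * (k * exp (k * t)) - (l - eps / 3) * (k * exp (k * t)))).
    { intros t Ht.
      apply is_derive_Rminus; [apply Hh; lra|apply Hexp]. }
    apply (nondecreasing_on _ _ a x Hx
        (fun t Ht => is_derive_continuity_pt _ _ _ (Hd t (proj1 Ht)))
        (fun t Ht => Hd t (Rlt_le _ _ (proj1 Ht)))).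
    intros t Ht. specialize (HX t ltac:(lra)). apply Rabs_def2 in HX.
    assert (0 < k * exp (k * t)) by (apply Rmult_lt_0_compat; [easy|apply exp_pos]). nra. }
  destruct (exp_decay k (h a - (l + eps / 3) * exp (k * a)) (eps / 3) Hk He3) as [X1 HX1].
  destruct (exp_decay k (h a - (l - eps / 3) * exp (k * a)) (eps / 3) Hk He3) as [X2 HX2].
  exists (Rmax a (Rmax X1 X2)). intros x Hx.
  pose proof (Rmax_l a (Rmax X1 X2)). pose proof (Rmax_r a (Rmax X1 X2)).
  pose proof (Rmax_l X1 X2). pose proof (Rmax_r X1 X2).
  specialize (Hup x ltac:(lra)). specialize (Hlo x ltac:(lra)).
  specialize (HX1 x ltac:(lra)). specialize (HX2 x ltac:(lra)).
  apply Rabs_def2 in HX1, HX2.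
  pose proof (exp_pos (- (k * x))) as Hp.
  assert (Hee : exp (k * x) * exp (- (k * x)) = 1).
  { rewrite <- exp_plus. replace (k * x + - (k * x)) with 0 by ring. apply exp_0. }
  apply (Rmult_le_compat_r _ _ _ (Rlt_le _ _ Hp)) in Hup, Hlo.
  rewrite Rmult_minus_distr_r, Rmult_assoc, Hee in Hup.
  rewrite (Rmult_minus_distr_r (h x)), (Rmult_assoc (l - _) (exp (k * x))), Hee in Hlo.
  apply Rabs_def1; lra.
Qed.

(** * The almost complex structure and the metric *)

Ltac unfold_tangent := repeat progress (unfold scal, plus, opp, mult; simpl).

(** [theta1], [theta2], [theta3] span the (1,0)-forms: [omega_se23] is [- 2 / 3] times the wedge of
    [theta2] and [theta3]. The sign in [theta3] reverses the orientation on the second factor, as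
    the minus sign in [omega_se1] does. *)
Definition theta1 (a b : R) (v : tangent) : C := (RtoC (a * ds v) + Ci * RtoC (b * eta_se v))%C.
Definition theta2 (v : tangent) : C := (RtoC (eta2 v) + Ci * RtoC (eta3 v))%C.
Definition theta3 (v : tangent) : C := (RtoC (eta2' v) - Ci * RtoC (eta3' v))%C.

Definition J_split (a b : R) (v : tangent) : tangent :=
  (- (b / a) * eta_se v, a / b * ds v, - eta3 v, eta2 v, eta3' v, - eta2' v).

Lemma omega_se23_theta (x y : tangent) :
  omega_se23 x y = (RtoC (- (2 / 3)) * (theta2 x * theta3 y - theta2 y * theta3 x))%C.
Proof.
  unfold omega_se23, omega_se2, omega_se3, wedge, theta2, theta3.
  apply injective_projections; simpl; ring.
Qed.

Lemma tangent_eq (x y : tangent) :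
  ds x = ds y -> eta_se x = eta_se y -> eta2 x = eta2 y -> eta3 x = eta3 y ->
  eta2' x = eta2' y -> eta3' x = eta3' y -> x = y.
Proof.
  destruct x as [[[[[x1 x2] x3] x4] x5] x6], y as [[[[[y1 y2] y3] y4] y5] y6].
  unfold ds, eta_se, eta2, eta3, eta2', eta3'. simpl. intros; now subst.
Qed.

Lemma linear_C_theta1 (a b : R) : linear_C (theta1 a b).
Proof.
  intros k [[[[[x1 x2] x3] x4] x5] x6] [[[[[y1 y2] y3] y4] y5] y6].
  unfold theta1, ds, eta_se. apply injective_projections; simpl;
    unfold_tangent; ring.
Qed.

Lemma linear_C_theta2 : linear_C theta2.
Proof.
  intros k [[[[[x1 x2] x3] x4] x5] x6] [[[[[y1 y2] y3] y4] y5] y6].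
  unfold theta2, eta2, eta3. apply injective_projections; simpl;
    unfold_tangent; ring.
Qed.

Lemma linear_C_theta3 : linear_C theta3.
Proof.
  intros k [[[[[x1 x2] x3] x4] x5] x6] [[[[[y1 y2] y3] y4] y5] y6].
  unfold theta3, eta2', eta3'. apply injective_projections; simpl;
    unfold_tangent; ring.
Qed.

Lemma linear_C_expand (al : tangent -> C) (v : tangent) :
  linear_C al ->
  al v = (RtoC (ds v) * al (1, 0, 0, 0, 0, 0) + RtoC (eta_se v) * al (0, 1, 0, 0, 0, 0)
        + RtoC (eta2 v) * al (0, 0, 1, 0, 0, 0) + RtoC (eta3 v) * al (0, 0, 0, 1, 0, 0)
        + RtoC (eta2' v) * al (0, 0, 0, 0, 1, 0) + RtoC (eta3' v) * al (0, 0, 0, 0, 0, 1))%C.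
Proof.
  intros Hl.
  (* Linearity at two zero vectors reads [al 0 = al 0 + al 0]. *)
  assert (H0 : al (0, 0, 0, 0, 0, 0) = RtoC 0).
  { pose proof (Hl 1 (0, 0, 0, 0, 0, 0) (0, 0, 0, 0, 0, 0)) as H.
    replace (plus _ _) with ((0, 0, 0, 0, 0, 0) : tangent) in H.
    - destruct (al (0, 0, 0, 0, 0, 0)) as [p q].
      unfold RtoC, Cplus, Cmult in H. simpl in H. injection H; intros.
      apply injective_projections; simpl; lra.
    - apply tangent_eq; unfold ds, eta_se, eta2, eta3, eta2', eta3'; unfold_tangent; ring. }
  destruct v as [[[[[v1 v2] v3] v4] v5] v6].
  unfold ds, eta_se, eta2, eta3, eta2', eta3'; simpl.
  assert (E : (v1, v2, v3, v4, v5, v6) =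
    plus (scal v1 ((1, 0, 0, 0, 0, 0) : tangent))
    (plus (scal v2 ((0, 1, 0, 0, 0, 0) : tangent))
    (plus (scal v3 ((0, 0, 1, 0, 0, 0) : tangent))
    (plus (scal v4 ((0, 0, 0, 1, 0, 0) : tangent))
    (plus (scal v5 ((0, 0, 0, 0, 1, 0) : tangent))
    (plus (scal v6 ((0, 0, 0, 0, 0, 1) : tangent)) ((0, 0, 0, 0, 0, 0) : tangent))))))).
  { apply tangent_eq; unfold ds, eta_se, eta2, eta3, eta2', eta3'; unfold_tangent; ring. }
  rewrite E, !Hl, H0. ring.
Qed.

(** The common shape of the solution, with [a = b = 1], and of the cone pulled back by [r(s)], with
    [a = r'] and [b = r]; one computation of [J] serves both. *)
Definition split_form (a b c : R) (Omega : tangent -> tangent -> tangent -> C) : Prop :=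
  forall x y z, Omega x y z = (RtoC c * wedge12 (theta1 a b) omega_se23 x y z)%C.

Lemma wedge13_split (a b c : R) Omega (al : tangent -> C) (A1 A2 A3 : C) (x y z w : tangent) :
  split_form a b c Omega ->
  (forall v, al v = A1 * theta1 a b v + A2 * theta2 v + A3 * theta3 v)%C ->
  wedge13 al Omega x y z w = RtoC 0.
Proof.
  intros HO Hal. unfold wedge13. rewrite !HO. unfold wedge12.
  rewrite !omega_se23_theta, !Hal. ring.
Qed.

Lemma Ceq_scale (k : C) (x y : C) : k <> RtoC 0 -> (k * (x - y) = RtoC 0)%C -> x = y.
Proof.
  intros Hk H. assert (Hd : (x - y)%C = RtoC 0).
  { replace (x - y)%C with (/ k * (k * (x - y)))%C by (field; exact Hk).
    rewrite H. ring. }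
  replace x with (x - y + y)%C by ring. rewrite Hd. ring.
Qed.

Lemma RtoC_neq_0 (x : R) : x <> 0 -> RtoC x <> RtoC 0.
Proof. intros Hx H. apply Hx. now injection H. Qed.

(** Both conditions on [al] say that it is a combination of [theta1], [theta2], [theta3]. This
    supplies the witness without which [epsilon] says nothing about [acs]. *)
Lemma J_split_acs (a b c : R) Omega :
  a <> 0 -> b <> 0 -> c <> 0 -> split_form a b c Omega -> is_acs Omega (J_split a b).
Proof.
  intros Ha Hb Hc HO. split; [|split].
  - intros k [[[[[x1 x2] x3] x4] x5] x6] [[[[[y1 y2] y3] y4] y5] y6].
    apply tangent_eq; unfold J_split, ds, eta_se, eta2, eta3, eta2', eta3'; unfold_tangent; ring.
  - intros [[[[[x1 x2] x3] x4] x5] x6].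
    apply tangent_eq; unfold J_split, ds, eta_se, eta2, eta3, eta2', eta3'; unfold_tangent;
      field; tauto.
  - intros al Hl.
    set (a1 := al (1, 0, 0, 0, 0, 0)). set (a2 := al (0, 1, 0, 0, 0, 0)).
    set (a3 := al (0, 0, 1, 0, 0, 0)). set (a4 := al (0, 0, 0, 1, 0, 0)).
    set (a5 := al (0, 0, 0, 0, 1, 0)). set (a6 := al (0, 0, 0, 0, 0, 1)).
    pose proof (fun v => linear_C_expand al v Hl) as He.
    fold a1 a2 a3 a4 a5 a6 in He.
    assert (Hab : RtoC a <> RtoC 0 /\ RtoC b <> RtoC 0 /\ RtoC c <> RtoC 0)
      by (repeat split; now apply RtoC_neq_0).
    destruct Hab as (Ha' & Hb' & Hc').
    split; intros H.
    + assert (E1 : (RtoC (a / b) * a2 = Ci * a1)%C).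
      { pose proof (H (1, 0, 0, 0, 0, 0)) as H1. rewrite He in H1. fold a1 in H1.
        rewrite <- H1. unfold J_split, ds, eta_se, eta2, eta3, eta2', eta3'; simpl.
        rewrite !Rmult_1_r, !Rmult_0_r, Ropp_0. ring. }
      assert (E2 : (a4 = Ci * a3)%C).
      { pose proof (H (0, 0, 1, 0, 0, 0)) as H1. rewrite He in H1. fold a3 in H1.
        rewrite <- H1. unfold J_split, ds, eta_se, eta2, eta3, eta2', eta3'; simpl.
        rewrite !Rmult_0_r, !Ropp_0. ring. }
      assert (E3 : (a6 = - (Ci * a5))%C).
      { pose proof (H (0, 0, 0, 0, 1, 0)) as H1. rewrite He in H1. fold a5 in H1.
        rewrite <- H1. unfold J_split, ds, eta_se, eta2, eta3, eta2', eta3'; simpl.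
        rewrite !Rmult_0_r, !Ropp_0, RtoC_opp. ring. }
      assert (E1' : (a2 = RtoC (b / a) * (Ci * a1))%C).
      { rewrite <- E1, Cmult_assoc, <- RtoC_mult.
        replace (b / a * (a / b)) with 1 by (field; tauto). ring. }
      intros x y z w. apply (wedge13_split a b c Omega al (a1 / RtoC a) a3 a5 x y z w HO).
      intros v. rewrite He, E1', E2, E3. unfold theta1, theta2, theta3.
      rewrite RtoC_div, !RtoC_mult by exact Ha. field. exact Ha'.
    (* Each basis quadruple used below contains two vectors dual to one [theta] and one vector for
       each of the other two, so the vanishing wedge reduces to one relation between two
       coefficients. *)
    + assert (E1 : (RtoC a * a2 = Ci * RtoC b * a1)%C).
      { pose proof (H (1, 0, 0, 0, 0, 0) (0, 1, 0, 0, 0, 0) (0, 0, 1, 0, 0, 0) (0, 0, 0, 0, 1, 0)) as H1.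
        unfold wedge13 in H1. rewrite !HO in H1. unfold wedge12 in H1.
        rewrite !omega_se23_theta in H1. fold a1 a2 a3 a5 in H1.
        unfold theta1, theta2, theta3, ds, eta_se, eta2, eta3, eta2', eta3' in H1. simpl in H1.
        rewrite !Rmult_1_r, !Rmult_0_r in H1.
        apply (Ceq_scale (RtoC c * RtoC (2 / 3))); [|rewrite <- H1, RtoC_opp; ring].
        rewrite <- RtoC_mult. apply RtoC_neq_0. lra. }
      assert (E2 : (a4 = Ci * a3)%C).
      { pose proof (H (1, 0, 0, 0, 0, 0) (0, 0, 1, 0, 0, 0) (0, 0, 0, 1, 0, 0) (0, 0, 0, 0, 1, 0)) as H1.
        unfold wedge13 in H1. rewrite !HO in H1. unfold wedge12 in H1.
        rewrite !omega_se23_theta in H1. fold a1 a3 a4 a5 in H1.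
        unfold theta1, theta2, theta3, ds, eta_se, eta2, eta3, eta2', eta3' in H1. simpl in H1.
        rewrite !Rmult_1_r, !Rmult_0_r in H1.
        apply (Ceq_scale (RtoC (- (c * a * (2 / 3))))); [|rewrite <- H1, !RtoC_opp, !RtoC_mult; ring].
        apply RtoC_neq_0. pose proof (Rmult_integral_contrapositive c a (conj Hc Ha)). lra. }
      assert (E3 : (a6 = - (Ci * a5))%C).
      { pose proof (H (1, 0, 0, 0, 0, 0) (0, 0, 1, 0, 0, 0) (0, 0, 0, 0, 1, 0) (0, 0, 0, 0, 0, 1)) as H1.
        unfold wedge13 in H1. rewrite !HO in H1. unfold wedge12 in H1.
        rewrite !omega_se23_theta in H1. fold a1 a3 a5 a6 in H1.
        unfold theta1, theta2, theta3, ds, eta_se, eta2, eta3, eta2', eta3' in H1. simpl in H1.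
        rewrite !Rmult_1_r, !Rmult_0_r in H1.
        apply (Ceq_scale (RtoC (c * a * (2 / 3)))); [|rewrite <- H1, !RtoC_opp, !RtoC_mult; ring].
        apply RtoC_neq_0. pose proof (Rmult_integral_contrapositive c a (conj Hc Ha)). lra. }
      assert (E1' : (a2 = Ci * RtoC b * a1 / RtoC a)%C).
      { rewrite <- E1. field. exact Ha'. }
      intros v. rewrite (He v), (He (J_split a b v)), E1', E2, E3.
      unfold J_split. unfold ds, eta_se, eta2, eta3, eta2', eta3'. simpl.
      rewrite !RtoC_opp, !RtoC_mult, !RtoC_opp, !RtoC_div by assumption.
      field_simplify_eq; [|repeat split; assumption..].
      apply injective_projections; simpl; ring.
Qed.

(** The structure picked by [epsilon] satisfies [is_acs], whose criterion applied to the three forms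
    [theta1], [theta2], [theta3] gives six real equations that determine its value on [v]. *)
Lemma acs_split (a b c : R) Omega (v : tangent) :
  a <> 0 -> b <> 0 -> c <> 0 -> split_form a b c Omega -> acs Omega v = J_split a b v.
Proof.
  intros Ha Hb Hc HO.
  assert (HJ : is_acs Omega (acs Omega)).
  { unfold acs. apply epsilon_spec. exists (J_split a b). now apply J_split_acs with c. }
  destruct HJ as (_ & _ & HJ).
  assert (H1 : theta1 a b (acs Omega v) = (Ci * theta1 a b v)%C).
  { apply HJ; [apply linear_C_theta1|]. intros x y z w.
    apply (wedge13_split a b c Omega _ (RtoC 1) (RtoC 0) (RtoC 0) x y z w HO). intros; ring. }
  assert (H2 : theta2 (acs Omega v) = (Ci * theta2 v)%C).
  { apply HJ; [apply linear_C_theta2|]. intros x y z w.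
    apply (wedge13_split a b c Omega _ (RtoC 0) (RtoC 1) (RtoC 0) x y z w HO). intros; ring. }
  assert (H3 : theta3 (acs Omega v) = (Ci * theta3 v)%C).
  { apply HJ; [apply linear_C_theta3|]. intros x y z w.
    apply (wedge13_split a b c Omega _ (RtoC 0) (RtoC 0) (RtoC 1) x y z w HO). intros; ring. }
  destruct (acs Omega v) as [[[[[w1 w2] w3] w4] w5] w6].
  destruct v as [[[[[v1 v2] v3] v4] v5] v6].
  unfold theta1, theta2, theta3, ds, eta_se, eta2, eta3, eta2', eta3',
    Cplus, Cminus, Copp, Cmult, RtoC, Ci in *. simpl in *.
  injection H1 as H1a H1b. injection H2 as H2a H2b. injection H3 as H3a H3b.
  assert (E1 : a * w1 = - (b * v2)) by lra.
  assert (E2 : b * w2 = a * v1) by lra.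
  apply tangent_eq; unfold J_split, ds, eta_se, eta2, eta3, eta2', eta3'; simpl; try lra.
  - apply Rmult_eq_reg_l with a; [|exact Ha]. rewrite E1. field. exact Ha.
  - apply Rmult_eq_reg_l with b; [|exact Hb]. rewrite E2. field. exact Hb.
Qed.

(** * Diagonal metrics and norm estimates on the cone *)

Definition diagonal_metric (k1 k2 k3 k4 : R) (x y : tangent) : R :=
  k1 * (ds x * ds y) + k2 * (eta_se x * eta_se y)
  + k3 * (eta2 x * eta2 y + eta3 x * eta3 y) + k4 * (eta2' x * eta2' y + eta3' x * eta3' y).

Lemma metric_split (a b c l u v : R) omega Omega (x y : tangent) :
  a <> 0 -> b <> 0 -> c <> 0 -> split_form a b c Omega ->
  (forall x y, omega x y = l * wedge ds eta_se x y + u * omega_se1 x y + v * omega_se0 x y) ->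
  metric omega Omega x y =
    diagonal_metric (l * (a / b)) (l * (b / a)) (2 / 3 * (u + v)) (2 / 3 * (u - v)) x y.
Proof.
  intros Ha Hb Hc HO Ho. unfold metric. rewrite (acs_split a b c) by assumption.
  rewrite Ho. unfold diagonal_metric, omega_se1, omega_se0, wedge, J_split,
    ds, eta_se, eta2, eta3, eta2', eta3'. simpl. field. tauto.
Qed.

Lemma split_form_sol (phi : R -> R) (s : R) :
  split_form 1 1 (exp (2 * phi s) * exp (3 * s)) (Omega_sol phi s).
Proof.
  intros x y z. unfold Omega_sol, wedge12, theta1. rewrite !Rmult_1_l. reflexivity.
Qed.

Lemma split_form_cone (r rho : R) :
  split_form rho r (r ^ 2) (Omega_cone r (fun v => rho * ds v)).
Proof. intros x y z. unfold Omega_cone, wedge12, theta1. ring. Qed.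

Lemma metric_sol_diagonal (alpha b : R) (u phi : R -> R) (s : R) (x y : tangent) :
  metric_sol alpha b u phi s x y =
  diagonal_metric (Derive u s / 2) (Derive u s / 2)
    (2 / 3 * (u s + u0 alpha b s)) (2 / 3 * (u s - u0 alpha b s)) x y.
Proof.
  unfold metric_sol.
  rewrite (metric_split 1 1 (exp (2 * phi s) * exp (3 * s)) (/ 2 * Derive u s) (u s)
             (u0 alpha b s)); try lra.
  - f_equal; field.
  - apply Rgt_not_eq, Rmult_lt_0_compat; apply exp_pos.
  - apply split_form_sol.
  - intros. unfold omega_sol. ring.
Qed.

Lemma metric_cone_diagonal (r rho : R) (x y : tangent) :
  0 < r -> 0 < rho ->
  metric (omega_cone r (fun v => rho * ds v)) (Omega_cone r (fun v => rho * ds v)) x y =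
  diagonal_metric (rho ^ 2) (r ^ 2) (2 / 3 * r ^ 2) (2 / 3 * r ^ 2) x y.
Proof.
  intros Hr Hrho.
  rewrite (metric_split rho r (r ^ 2) (r * rho) (r ^ 2) 0); try lra.
  - f_equal; try field; lra.
  - apply Rgt_not_eq, pow_lt, Hr.
  - apply split_form_cone.
  - intros. unfold omega_cone, wedge. ring.
Qed.

(** The rescaled coordinate vectors only show that an orthonormal frame exists; the one that [frame]
    selects remains unknown. *)
Lemma diagonal_orthonormal (k1 k2 k3 k4 : R) (g : tangent -> tangent -> R) :
  0 < k1 -> 0 < k2 -> 0 < k3 -> 0 < k4 ->
  (forall x y, g x y = diagonal_metric k1 k2 k3 k4 x y) ->
  orthonormal g (frame g).
Proof.
  intros H1 H2 H3 H4 Hg. unfold frame. apply epsilon_spec.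
  exists (fun i => match i with
    | 0%nat => (/ sqrt k1, 0, 0, 0, 0, 0) | 1%nat => (0, / sqrt k2, 0, 0, 0, 0)
    | 2%nat => (0, 0, / sqrt k3, 0, 0, 0) | 3%nat => (0, 0, 0, / sqrt k3, 0, 0)
    | 4%nat => (0, 0, 0, 0, / sqrt k4, 0) | _ => (0, 0, 0, 0, 0, / sqrt k4) end).
  assert (Hs : forall k, 0 < k -> k * (/ sqrt k * / sqrt k) = 1).
  { intros k Hk. pose proof (sqrt_lt_R0 k Hk).
    rewrite <- (sqrt_sqrt k) at 1 by lra. field. lra. }
  intros i j Hi Hj. rewrite Hg. unfold diagonal_metric, ds, eta_se, eta2, eta3, eta2', eta3'.
  pose proof (Hs k1 H1). pose proof (Hs k2 H2). pose proof (Hs k3 H3). pose proof (Hs k4 H4).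
  destruct i as [|[|[|[|[|[|i]]]]]]; try lia;
    destruct j as [|[|[|[|[|[|j]]]]]]; try lia; simpl; lra.
Qed.

(** Each summand of the metric is nonnegative, hence at most 1. Estimates of this kind are
    insensitive to the choice of the orthonormal frame. *)
Lemma unit_components (k1 k2 k3 k4 : R) (x : tangent) :
  0 < k1 -> 0 < k2 -> 0 < k3 -> 0 < k4 -> diagonal_metric k1 k2 k3 k4 x x = 1 ->
  Rabs (ds x) <= / sqrt k1 /\ Rabs (eta_se x) <= / sqrt k2 /\
  (Rabs (eta2 x) <= / sqrt k3 /\ Rabs (eta3 x) <= / sqrt k3) /\
  (Rabs (eta2' x) <= / sqrt k4 /\ Rabs (eta3' x) <= / sqrt k4).
Proof.
  intros H1 H2 H3 H4 Hx. unfold diagonal_metric in Hx.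
  assert (P : forall k w, 0 < k -> 0 <= k * (w * w)).
  { intros. apply Rmult_le_pos; [lra|apply Rle_0_sqr]. }
  pose proof (P k1 (ds x) H1). pose proof (P k2 (eta_se x) H2).
  pose proof (P k3 (eta2 x) H3). pose proof (P k3 (eta3 x) H3).
  pose proof (P k4 (eta2' x) H4). pose proof (P k4 (eta3' x) H4).
  assert (Hb : forall k w, 0 < k -> k * (w * w) <= 1 -> Rabs w <= / sqrt k).
  { intros k w Hk Hw. pose proof (sqrt_lt_R0 k Hk).
    apply Rmult_le_reg_l with (sqrt k); [easy|]. rewrite Rinv_r by lra.
    rewrite <- (Rabs_right (sqrt k)) by lra. rewrite <- Rabs_mult.
    rewrite <- Rabs_R1. apply Rsqr_le_abs_0. unfold Rsqr.
    replace (sqrt k * w * (sqrt k * w)) with (sqrt k * sqrt k * (w * w)) by ring.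
    rewrite sqrt_sqrt by lra. lra. }
  repeat split; apply Hb; lra.
Qed.

Lemma wedge_bound (f h : tangent -> R) (A B : R) (x y : tangent) :
  Rabs (f x) <= A -> Rabs (f y) <= A -> Rabs (h x) <= B -> Rabs (h y) <= B ->
  Rabs (wedge f h x y) <= 2 * (A * B).
Proof.
  intros. unfold wedge, Rminus. eapply Rle_trans; [apply Rabs_triang|].
  rewrite Rabs_Ropp, !Rabs_mult.
  assert (Rabs (f x) * Rabs (h y) <= A * B) by (apply Rmult_le_compat; try apply Rabs_pos; lra).
  assert (Rabs (f y) * Rabs (h x) <= A * B) by (apply Rmult_le_compat; try apply Rabs_pos; lra).
  lra.
Qed.

Lemma norm2_le (g b : tangent -> tangent -> R) (B : R) :
  0 <= B -> (forall i j, (i < 6)%nat -> (j < 6)%nat -> Rabs (b (frame g i) (frame g j)) <= B) ->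
  norm2 g b <= 6 * B.
Proof.
  intros HB Hb. unfold norm2. rewrite <- (sqrt_pow2 (6 * B)) by lra.
  apply sqrt_le_1_alt.
  assert (H : forall i j, (i < 6)%nat -> (j < 6)%nat ->
    (if Nat.ltb i j then b (frame g i) (frame g j) ^ 2 else 0) <= B ^ 2).
  { intros i j Hi Hj. destruct (Nat.ltb i j).
    - rewrite <- pow2_abs. apply pow_incr. split; [apply Rabs_pos|now apply Hb].
    - apply pow2_ge_0. }
  apply Rle_trans with (sum_n (fun j => sum_n (fun i => B ^ 2) 5) 5).
  - rewrite !sum_n_Reals. apply sum_Rle. intros j Hj. rewrite !sum_n_Reals.
    apply sum_Rle. intros i Hi. apply H; lia.
  - rewrite !sum_n_const. simpl. pose proof (pow2_ge_0 B). lra.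
Qed.

(** There are [6 ^ 3 = 216 <= 15 ^ 2] index triples, those out of order contributing 0. The factor 6
    for 2-forms is likewise the square root of 36. *)
Lemma norm3_le (g : tangent -> tangent -> R) (b : tangent -> tangent -> tangent -> C) (B : R) :
  0 <= B ->
  (forall i j k, (i < 6)%nat -> (j < 6)%nat -> (k < 6)%nat ->
     Cmod (b (frame g i) (frame g j) (frame g k)) <= B) ->
  norm3 g b <= 15 * B.
Proof.
  intros HB Hb. unfold norm3. rewrite <- (sqrt_pow2 (15 * B)) by lra.
  apply sqrt_le_1_alt.
  assert (H : forall i j k, (i < 6)%nat -> (j < 6)%nat -> (k < 6)%nat ->
    (if andb (Nat.ltb i j) (Nat.ltb j k)
     then Cmod (b (frame g i) (frame g j) (frame g k)) ^ 2 else 0) <= B ^ 2).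
  { intros i j k Hi Hj Hk. destruct (andb _ _).
    - apply pow_incr. split; [apply Cmod_ge_0|now apply Hb].
    - apply pow2_ge_0. }
  apply Rle_trans with (sum_n (fun k => sum_n (fun j => sum_n (fun i => B ^ 2) 5) 5) 5).
  - rewrite !sum_n_Reals. apply sum_Rle. intros k Hk. rewrite !sum_n_Reals.
    apply sum_Rle. intros j Hj. rewrite !sum_n_Reals.
    apply sum_Rle. intros i Hi. apply H; lia.
  - rewrite !sum_n_const. simpl. pose proof (pow2_ge_0 B). lra.
Qed.

Lemma cone_frame_components (r rho : R) (i : nat) :
  0 < r -> 0 < rho -> (i < 6)%nat ->
  let e := frame (metric (omega_cone r (fun v => rho * ds v))
                         (Omega_cone r (fun v => rho * ds v))) i in
  Rabs (ds e) <= / rho /\ Rabs (eta_se e) <= / r /\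
  (Rabs (eta2 e) <= / sqrt (2 / 3 * r ^ 2) /\ Rabs (eta3 e) <= / sqrt (2 / 3 * r ^ 2)) /\
  (Rabs (eta2' e) <= / sqrt (2 / 3 * r ^ 2) /\ Rabs (eta3' e) <= / sqrt (2 / 3 * r ^ 2)).
Proof.
  intros Hr Hrho Hi e.
  assert (H1 : 0 < rho ^ 2) by now apply pow_lt.
  assert (H2 : 0 < r ^ 2) by now apply pow_lt.
  pose proof (diagonal_orthonormal (rho ^ 2) (r ^ 2) (2 / 3 * r ^ 2) (2 / 3 * r ^ 2) _
    H1 H2 ltac:(lra) ltac:(lra) (fun x y => metric_cone_diagonal r rho x y Hr Hrho)) as Ho.
  specialize (Ho i i Hi Hi). rewrite Nat.eqb_refl, metric_cone_diagonal in Ho by assumption.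
  rewrite <- (sqrt_pow2 rho) at 1 by lra. rewrite <- (sqrt_pow2 r) at 1 by lra.
  apply unit_components; try lra. exact Ho.
Qed.

Lemma omega_se_bounds (k : R) (x y : tangent) :
  0 < k ->
  (forall v, v = x \/ v = y -> Rabs (eta2 v) <= / sqrt k /\ Rabs (eta3 v) <= / sqrt k /\
     Rabs (eta2' v) <= / sqrt k /\ Rabs (eta3' v) <= / sqrt k) ->
  Rabs (omega_se1 x y) <= 8 / 3 / k /\ Rabs (omega_se0 x y) <= 8 / 3 / k /\
  Rabs (omega_se2 x y) <= 8 / 3 / k /\ Rabs (omega_se3 x y) <= 8 / 3 / k.
Proof.
  intros Hk Hc.
  destruct (Hc x (or_introl eq_refl)) as (X2 & X3 & X2' & X3').
  destruct (Hc y (or_intror eq_refl)) as (Y2 & Y3 & Y2' & Y3').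
  assert (Hs : / sqrt k * / sqrt k = / k) by (rewrite <- Rinv_mult, sqrt_sqrt; lra).
  assert (W : forall f h, Rabs (f x) <= / sqrt k -> Rabs (f y) <= / sqrt k ->
     Rabs (h x) <= / sqrt k -> Rabs (h y) <= / sqrt k -> Rabs (wedge f h x y) <= 2 * / k).
  { intros f h F1 F2 F3 F4. rewrite <- Hs. now apply wedge_bound. }
  unfold omega_se1, omega_se0, omega_se2, omega_se3.
  pose proof (W eta2 eta3 X2 Y2 X3 Y3) as W1. pose proof (W eta2' eta3' X2' Y2' X3' Y3') as W2.
  pose proof (W eta2 eta2' X2 Y2 X2' Y2') as W3. pose proof (W eta3 eta3' X3 Y3 X3' Y3') as W4.
  pose proof (W eta2 eta3' X2 Y2 X3' Y3') as W5. pose proof (W eta2' eta3 X2' Y2' X3 Y3) as W6.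
  apply Rabs_le_between in W1, W2, W3, W4, W5, W6.
  unfold Rdiv. repeat split; apply Rabs_le; split; lra.
Qed.

Lemma cone_omega_se_bounds (r rho : R) (i j : nat) :
  0 < r -> 0 < rho -> (i < 6)%nat -> (j < 6)%nat ->
  let e := frame (metric (omega_cone r (fun v => rho * ds v))
                         (Omega_cone r (fun v => rho * ds v))) in
  Rabs (omega_se1 (e i) (e j)) <= 4 / r ^ 2 /\ Rabs (omega_se0 (e i) (e j)) <= 4 / r ^ 2 /\
  Rabs (omega_se2 (e i) (e j)) <= 4 / r ^ 2 /\ Rabs (omega_se3 (e i) (e j)) <= 4 / r ^ 2.
Proof.
  intros Hr Hrho Hi Hj e.
  assert (H2 : 0 < r ^ 2) by now apply pow_lt.
  replace (4 / r ^ 2) with (8 / 3 / (2 / 3 * r ^ 2)) by (field; lra).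
  apply omega_se_bounds; [lra|].
  intros v [-> | ->];
    [destruct (cone_frame_components r rho i Hr Hrho Hi) as (_ & _ & (A1 & A2) & A3 & A4)
    |destruct (cone_frame_components r rho j Hr Hrho Hj) as (_ & _ & (A1 & A2) & A3 & A4)];
    repeat split; assumption.
Qed.

(** On unit vectors [ds] is at most [1 / rho], [eta_se] at most [1 / r], and each [omega_se] form at
    most [4 / r ^ 2]; the constants 12 and 24 are 6 times 2 and 6 times 4. *)
Lemma norm2_cone_le (r rho l u v : R) (b : tangent -> tangent -> R) :
  0 < r -> 0 < rho ->
  (forall x y, b x y = l * wedge ds eta_se x y + u * omega_se1 x y + v * omega_se0 x y) ->
  norm2 (metric (omega_cone r (fun v => rho * ds v)) (Omega_cone r (fun v => rho * ds v))) b
    <= 12 * (Rabs l / (rho * r)) + 24 * ((Rabs u + Rabs v) / r ^ 2).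
Proof.
  intros Hr Hrho Hb.
  assert (H2 : 0 < / r ^ 2) by now apply Rinv_0_lt_compat, pow_lt.
  assert (H3 : 0 < / (rho * r)) by (apply Rinv_0_lt_compat, Rmult_lt_0_compat; lra).
  replace (12 * (Rabs l / (rho * r)) + 24 * ((Rabs u + Rabs v) / r ^ 2))
    with (6 * (Rabs l * (2 * / (rho * r)) + Rabs u * (4 / r ^ 2) + Rabs v * (4 / r ^ 2)))
    by (field; lra).
  pose proof (Rabs_pos l). pose proof (Rabs_pos u). pose proof (Rabs_pos v).
  apply norm2_le.
  - unfold Rdiv. repeat apply Rplus_le_le_0_compat; apply Rmult_le_pos; lra.
  - intros i j Hi Hj. rewrite Hb.
    destruct (cone_omega_se_bounds r rho i j Hr Hrho Hi Hj) as (B1 & B2 & _).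
    destruct (cone_frame_components r rho i Hr Hrho Hi) as (A1 & A2 & _).
    destruct (cone_frame_components r rho j Hr Hrho Hj) as (A3 & A4 & _).
    eapply Rle_trans; [apply Rabs_triang|]. rewrite (Rabs_mult v).
    apply Rplus_le_compat; [|apply Rmult_le_compat_l; lra].
    eapply Rle_trans; [apply Rabs_triang|]. rewrite !Rabs_mult.
    apply Rplus_le_compat; apply Rmult_le_compat_l; try lra.
    rewrite Rinv_mult. now apply wedge_bound.
Qed.

Lemma norm3_cone_le (r rho A B : R) (b : tangent -> tangent -> tangent -> C) :
  0 < r -> 0 < rho ->
  (forall x y z, b x y z = wedge12 (theta1 A B) omega_se23 x y z) ->
  norm3 (metric (omega_cone r (fun v => rho * ds v)) (Omega_cone r (fun v => rho * ds v))) b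
    <= 360 * ((Rabs A / rho + Rabs B / r) / r ^ 2).
Proof.
  intros Hr Hrho Hb.
  assert (H1 : 0 < / r) by now apply Rinv_0_lt_compat.
  assert (H2 : 0 < / r ^ 2) by now apply Rinv_0_lt_compat, pow_lt.
  assert (H3 : 0 < / rho) by now apply Rinv_0_lt_compat.
  set (K := Rabs A / rho + Rabs B / r).
  assert (HK : 0 <= K).
  { unfold K. apply Rplus_le_le_0_compat; apply Rle_mult_inv_pos; try apply Rabs_pos; lra. }
  replace (360 * (K / r ^ 2)) with (15 * (3 * (K * (8 / r ^ 2)))) by (field; lra).
  assert (H8 : 0 < 8 / r ^ 2) by (unfold Rdiv; lra).
  apply norm3_le; [apply Rmult_le_pos; [lra|apply Rmult_le_pos; lra]|].
  set (e := frame _).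
  assert (HCi : forall x, Cmod (Ci * RtoC x) = Rabs x).
  { intros x. rewrite Cmod_mult, Cmod_R. replace (Cmod Ci) with 1; [ring|].
    unfold Cmod, Ci; simpl. replace (0 * (0 * 1) + 1 * (1 * 1)) with 1 by ring. now rewrite sqrt_1. }
  assert (HT : forall i, (i < 6)%nat -> Cmod (theta1 A B (e i)) <= K).
  { intros i Hi. destruct (cone_frame_components r rho i Hr Hrho Hi) as (A1 & A2 & _).
    fold e in A1, A2. unfold theta1. eapply Rle_trans; [apply Cmod_triangle|].
    rewrite HCi, Cmod_R, !Rabs_mult.
    apply Rplus_le_compat; apply Rmult_le_compat_l; try apply Rabs_pos; assumption. }
  assert (HW : forall i j, (i < 6)%nat -> (j < 6)%nat -> Cmod (omega_se23 (e i) (e j)) <= 8 / r ^ 2).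
  { intros i j Hi Hj.
    destruct (cone_omega_se_bounds r rho i j Hr Hrho Hi Hj) as (_ & _ & B1 & B2).
    fold e in B1, B2. unfold omega_se23. eapply Rle_trans; [apply Cmod_triangle|].
    rewrite HCi, Cmod_R. lra. }
  assert (HP : forall i j k, (i < 6)%nat -> (j < 6)%nat -> (k < 6)%nat ->
     Cmod (theta1 A B (e i) * omega_se23 (e j) (e k)) <= K * (8 / r ^ 2)).
  { intros i j k Hi Hj Hk. rewrite Cmod_mult.
    apply Rmult_le_compat; try apply Cmod_ge_0; [now apply HT | now apply HW]. }
  intros i j k Hi Hj Hk. rewrite Hb. unfold wedge12, Cminus.
  eapply Rle_trans; [apply Cmod_triangle|].
  eapply Rle_trans; [apply Rplus_le_compat_r, Cmod_triangle|].
  rewrite Cmod_opp.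
  pose proof (HP i j k Hi Hj Hk). pose proof (HP j i k Hj Hi Hk). pose proof (HP k i j Hk Hi Hj).
  lra.
Qed.

(** * Completeness of the end *)

Lemma continuous_fst_comp {U V : UniformSpace} (f : R -> U * V) (t : R) :
  continuous f t -> continuous (fun t => fst (f t)) t.
Proof.
  intros Hf. apply (continuous_comp f fst); [exact Hf|].
  intros P [e He]. exists e. intros y [Hy _]. now apply He.
Qed.

Lemma continuous_snd_comp {U V : UniformSpace} (f : R -> U * V) (t : R) :
  continuous f t -> continuous (fun t => snd (f t)) t.
Proof.
  intros Hf. apply (continuous_comp f snd); [exact Hf|].
  intros P [e He]. exists e. intros y [_ Hy]. now apply He.
Qed.

Lemma continuous_pair {U V : UniformSpace} (f : R -> U) (g : R -> V) (t : R) :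
  continuous f t -> continuous g t -> continuous (fun t => (f t, g t)) t.
Proof.
  intros Hf Hg P [e He].
  assert (H1 : locally t (fun s => ball (f t) e (f s))) by (apply Hf; now exists e).
  assert (H2 : locally t (fun s => ball (g t) e (g s))) by (apply Hg; now exists e).
  unfold filtermap.   generalize (filter_and _ _ H1 H2). apply filter_imp. intros s [A B]. apply He. now split.
Qed.

Lemma is_derive_fst {U V : NormedModule R_AbsRing} (f : R -> U * V) (t : R) (l : U * V) :
  is_derive (V := prod_NormedModule R_AbsRing U V) f t l ->
  is_derive (fun t => fst (f t)) t (fst l).
Proof.
  intros Hf. unfold is_derive in *.
  apply (filterdiff_comp' (K := R_AbsRing) (V := prod_NormedModule R_AbsRing U V) f fst t
           _ fst Hf).
  apply filterdiff_linear, is_linear_fst.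
Qed.

Lemma is_derive_pair {U V : NormedModule R_AbsRing} (f : R -> U) (g : R -> V) (t : R) l m :
  is_derive f t l -> is_derive g t m ->
  is_derive (V := prod_NormedModule R_AbsRing U V) (fun t => (f t, g t)) t (l, m).
Proof.
  intros Hf Hg. unfold is_derive in *.
  apply (filterdiff_comp'_2 (W := prod_NormedModule R_AbsRing U V) f g (fun a b => (a, b)) t
    (fun y => scal y l) (fun y => scal y m) (fun a b => (a, b))); [exact Hf|exact Hg|].
  apply filterdiff_linear.
  apply (is_linear_ext (fun x : prod_NormedModule R_AbsRing U V => x)).
  - now intros [x y].
  - apply is_linear_id.
Qed.

(** The index map is only asked to satisfy [n <= phi n]. This condition is stable under composition,
    as needed for several coordinates in turn, and still preserves limits. *)
Lemma bolzano_weierstrass (u : nat -> R) (M : R) :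
  (forall n, Rabs (u n) <= M) ->
  exists (phi : nat -> nat) (l : R), (forall n, (n <= phi n)%nat) /\
    is_lim_seq (fun n => u (phi n)) l.
Proof.
  intros Hu.
  destruct (Bolzano_Weierstrass u (fun x => - M <= x <= M)) as [l Hl].
  - apply compact_P3.
  - intros n. apply Rabs_le_between, Hu.
  - assert (Hex : forall n, exists p, (n <= p)%nat /\ Rabs (u p - l) < / (INR n + 1)).
    { intros n.
      assert (Hp : 0 < / (INR n + 1)) by (apply Rinv_0_lt_compat; pose proof (pos_INR n); lra).
      destruct (Hl (disc l (mkposreal _ Hp)) n) as [p [Hp1 Hp2]].
      - exists (mkposreal _ Hp). now intros x.
      - exists p. now split. }
    exists (fun n => proj1_sig (constructive_indefinite_description _ (Hex n))), l. split.
    + intros n. destruct (constructive_indefinite_description _ (Hex n)). simpl. tauto.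
    + apply is_lim_seq_spec. intros eps.
      destruct (nfloor_ex (/ eps)) as [N HN].
      { apply Rlt_le, Rinv_0_lt_compat, cond_pos. }
      exists N. intros n Hn.
      destruct (constructive_indefinite_description _ (Hex n)) as [p [Hp1 Hp2]]. simpl.
      eapply Rlt_trans; [exact Hp2|]. apply le_INR in Hn. pose proof (cond_pos eps).
      rewrite <- (Rinv_inv eps). apply Rinv_lt_contravar; [|lra].
      apply Rmult_lt_0_compat; [now apply Rinv_0_lt_compat|]. pose proof (pos_INR n). lra.
Qed.

Lemma is_lim_seq_reindex (u : nat -> R) (phi : nat -> nat) (l : R) :
  (forall n, (n <= phi n)%nat) -> is_lim_seq u l -> is_lim_seq (fun n => u (phi n)) l.
Proof.
  intros Hphi Hu. apply (is_lim_seq_subseq u); [|exact Hu].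
  intros P [N HN]. exists N. intros n Hn. apply HN. specialize (Hphi n). lia.
Qed.

Lemma bolzano_weierstrass_family (u : nat -> nat -> R) (K : nat) :
  (forall k, exists M, forall n, Rabs (u k n) <= M) ->
  exists (phi : nat -> nat) (l : nat -> R), (forall n, (n <= phi n)%nat) /\
    forall k, (k < K)%nat -> is_lim_seq (fun n => u k (phi n)) (l k).
Proof.
  intros Hu. induction K as [|K (phi & l & Hphi & Hl)].
  - exists (fun n => n), (fun _ => 0). split; [lia|]. intros; lia.
  - destruct (Hu K) as [M HM].
    destruct (bolzano_weierstrass (fun n => u K (phi n)) M) as (psi & m & Hpsi & Hm).
    { intros n. apply HM. }
    exists (fun n => phi (psi n)), (fun k => if Nat.eqb k K then m else l k). split.
    + intros n. specialize (Hphi (psi n)). specialize (Hpsi n). lia.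
    + intros k Hk. destruct (Nat.eqb_spec k K) as [-> |Hne]; [exact Hm|].
      apply (is_lim_seq_reindex (fun n => u k (phi n)) psi); [exact Hpsi|].
      apply Hl. lia.
Qed.

(** * Paths between unit quaternions *)

Definition qnorm2 (q : quat) : R :=
  let '(q0, q1, q2, q3) := q in q0 ^ 2 + q1 ^ 2 + q2 ^ 2 + q3 ^ 2.

Lemma unit_quat_qnorm2 (q : quat) : unit_quat q <-> qnorm2 q = 1.
Proof.
  destruct q as [[[q0 q1] q2] q3]. unfold unit_quat, qmul, qconj, qnorm2. split.
  - intros H. injection H. intros. lra.
  - intros H. f_equal; [f_equal; [f_equal|]|]; lra.
Qed.

Lemma project_ds (x v : point) : ds (project x v) = fst v.
Proof.
  destruct x as [s [q q']], v as [k [w w']]. unfold project.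
  destruct (eta q w) as [[e1 e2] e3], (eta q' w') as [[e1' e2'] e3']. reflexivity.
Qed.

Lemma continuous_eta (q w : R -> quat) (t : R) :
  continuous q t -> continuous w t ->
  continuity_pt (fun t => fst (fst (eta (q t) (w t)))) t /\
  continuity_pt (fun t => snd (fst (eta (q t) (w t)))) t /\
  continuity_pt (fun t => snd (eta (q t) (w t))) t.
Proof.
  assert (Hcomp : forall f : R -> quat, continuous f t ->
    continuity_pt (fun t => fst (fst (fst (f t)))) t /\
    continuity_pt (fun t => snd (fst (fst (f t)))) t /\
    continuity_pt (fun t => snd (fst (f t))) t /\ continuity_pt (fun t => snd (f t)) t).
  { intros f Hf.
    pose proof (continuous_fst_comp f t Hf) as H1.
    pose proof (continuous_fst_comp (fun t => fst (f t)) t H1) as H2.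
    repeat split; apply continuous_pt.
    - exact (continuous_fst_comp (fun t => fst (fst (f t))) t H2).
    - exact (continuous_snd_comp (fun t => fst (fst (f t))) t H2).
    - exact (continuous_snd_comp (fun t => fst (f t)) t H1).
    - exact (continuous_snd_comp f t Hf). }
  intros Hq Hw. destruct (Hcomp q Hq) as (Q0 & Q1 & Q2 & Q3).
  destruct (Hcomp w Hw) as (W0 & W1 & W2 & W3).
  set (q0 := fun t => fst (fst (fst (q t)))) in *. set (q1 := fun t => snd (fst (fst (q t)))) in *.
  set (q2 := fun t => snd (fst (q t))) in *. set (q3 := fun t => snd (q t)) in *.
  set (w0 := fun t => fst (fst (fst (w t)))) in *. set (w1 := fun t => snd (fst (fst (w t)))) in *.
  set (w2 := fun t => snd (fst (w t))) in *. set (w3 := fun t => snd (w t)) in *.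
  assert (E : forall s, eta (q s) (w s) =
    (- (q0 s * w1 s + - q1 s * w0 s + - q2 s * w3 s - - q3 s * w2 s),
     - (q0 s * w2 s - - q1 s * w3 s + - q2 s * w0 s + - q3 s * w1 s),
     - (q0 s * w3 s + - q1 s * w2 s - - q2 s * w1 s + - q3 s * w0 s))).
  { intros s. unfold q0, q1, q2, q3, w0, w1, w2, w3.
    destruct (q s) as [[[a0 a1] a2] a3], (w s) as [[[b0 b1] b2] b3]. reflexivity. }
  assert (X : forall f g : R -> R, (forall s, f s = g s) -> continuity_pt f t -> continuity_pt g t).
  { intros f g Hfg Hf. apply continuous_pt. apply continuous_ext with f; [exact Hfg|].
    now apply continuous_pt. }
  repeat split; (eapply X; [intros s; rewrite E; reflexivity|]); simpl;
    repeat first [apply continuity_pt_opp | apply continuity_pt_plus | apply continuity_pt_minus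
                 | apply continuity_pt_mult]; assumption.
Qed.

Definition speed (g : R -> tangent -> tangent -> R) (x v : point) : R :=
  sqrt (g (fst x) (project x v) (project x v)).

Lemma project_components (x v : point) :
  eta_se (project x v) = 2 / 3 * (fst (fst (eta (fst (snd x)) (fst (snd v))))
                                 - fst (fst (eta (snd (snd x)) (snd (snd v))))) /\
  eta2 (project x v) = snd (fst (eta (fst (snd x)) (fst (snd v)))) /\
  eta3 (project x v) = snd (eta (fst (snd x)) (fst (snd v))) /\
  eta2' (project x v) = snd (fst (eta (snd (snd x)) (snd (snd v)))) /\
  eta3' (project x v) = snd (eta (snd (snd x)) (snd (snd v))).
Proof.
  destruct x as [s [q q']], v as [k [w w']]. unfold project. simpl.
  destruct (eta q w) as [[e1 e2] e3], (eta q' w') as [[e1' e2'] e3'].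
  unfold eta_se, eta2, eta3, eta2', eta3'. simpl. tauto.
Qed.

Definition qcomp (i : nat) (q : quat) : R :=
  match i with
  | 0%nat => fst (fst (fst q)) | 1%nat => snd (fst (fst q))
  | 2%nat => snd (fst q) | _ => snd q
  end.

Definition normalized (a d D t : R) : R := (a + t * d) / sqrt (1 - t * (1 - t) * D).

Definition dnormalized (a d D t : R) : R :=
  d / sqrt (1 - t * (1 - t) * D)
  - (a + t * d) * ((- (1 - 2 * t) * D) / (2 * sqrt (1 - t * (1 - t) * D)))
    / sqrt (1 - t * (1 - t) * D) ^ 2.

Lemma is_derive_affine (a d t : R) : is_derive (fun t => a + t * d) t d.
Proof. auto_derive; [easy|ring]. Qed.

Lemma is_derive_normalized (a d D t : R) :
  0 < 1 - t * (1 - t) * D -> is_derive (normalized a d D) t (dnormalized a d D t).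
Proof.
  intros HN. pose proof (sqrt_lt_R0 _ HN) as HS. unfold normalized, dnormalized.
  evar_last.
  - apply (is_derive_div (fun t => a + t * d) (fun t => sqrt (1 - t * (1 - t) * D)) t d
      ((- (1 - 2 * t) * D) / (2 * sqrt (1 - t * (1 - t) * D)))); [| |lra].
    + apply is_derive_affine.
    + auto_derive; [unfold Rminus in HN; exact HN|].
      unfold Rminus in *. field. lra.
  - field. lra.
Qed.

Lemma continuous_dnormalized (a d D t : R) :
  0 < 1 - t * (1 - t) * D -> continuous (dnormalized a d D) t.
Proof.
  intros HN. pose proof (sqrt_lt_R0 _ HN) as HS.
  apply (@ex_derive_continuous R_AbsRing R_NormedModule). unfold dnormalized.
  auto_derive. unfold Rminus in *.
  repeat split; try exact HN; try apply Rgt_not_eq; try lra;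
    repeat apply Rmult_lt_0_compat; lra.
Qed.

(* The chord from [q] to [y], projected radially to the sphere; on the chord
   [|q + t (y - q)|^2 = 1 - t (1 - t) |y - q|^2]. *)
Lemma quat_path (q y : quat) (delta : R) :
  unit_quat q -> unit_quat y -> delta <= 1 / 2 ->
  (forall i, Rabs (qcomp i y - qcomp i q) <= delta) ->
  exists Q dQ : R -> quat, Q 0 = q /\ Q 1 = y /\
    forall t, 0 <= t <= 1 ->
      unit_quat (Q t) /\ is_derive Q t (dQ t) /\ continuous dQ t /\
      Rabs (fst (fst (eta (Q t) (dQ t)))) <= 8 * delta /\
      Rabs (snd (fst (eta (Q t) (dQ t)))) <= 8 * delta /\
      Rabs (snd (eta (Q t) (dQ t))) <= 8 * delta.
Proof.
  intros Hq Hy Hd Hc. apply unit_quat_qnorm2 in Hq, Hy.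
  destruct q as [[[q0 q1] q2] q3], y as [[[y0 y1] y2] y3].
  pose proof (Hc 0%nat) as C0. pose proof (Hc 1%nat) as C1.
  pose proof (Hc 2%nat) as C2. pose proof (Hc 3%nat) as C3.
  unfold qcomp in C0, C1, C2, C3. simpl in C0, C1, C2, C3. unfold qnorm2 in Hq, Hy.
  assert (Hdd : exists d0 d1 d2 d3, y0 = q0 + d0 /\ y1 = q1 + d1 /\ y2 = q2 + d2 /\ y3 = q3 + d3).
  { exists (y0 - q0), (y1 - q1), (y2 - q2), (y3 - q3). repeat split; ring. }
  destruct Hdd as (d0 & d1 & d2 & d3 & -> & -> & -> & ->).
  rewrite Rplus_minus_l in C0, C1, C2, C3.
  set (D := d0 ^ 2 + d1 ^ 2 + d2 ^ 2 + d3 ^ 2).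
  (* Comparison of [|q + d| = 1] with [|q| = 1]; this makes the squared norm on the chord depend on
     [D] alone. *)
  assert (HD : 2 * (q0 * d0 + q1 * d1 + q2 * d2 + q3 * d3) = - D) by (unfold D; lra).
  assert (Hdelta : 0 <= delta) by (pose proof (Rabs_pos d0); lra).
  assert (Hsq : forall v, Rabs v <= delta -> 0 <= v ^ 2 <= / 4).
  { intros v Hv. split; [apply pow2_ge_0|]. rewrite <- pow2_abs.
    replace (/ 4) with ((1 / 2) ^ 2) by field. apply pow_incr. split; [apply Rabs_pos|lra]. }
  assert (HD1 : 0 <= D <= 1).
  { unfold D. pose proof (Hsq _ C0). pose proof (Hsq _ C1). pose proof (Hsq _ C2).
    pose proof (Hsq _ C3). lra. }
  assert (HN : forall t, 0 <= t <= 1 -> 1 / 2 <= 1 - t * (1 - t) * D).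
  { intros t Ht. assert (0 <= t * (1 - t) <= 1 / 4).
    { pose proof (pow2_ge_0 (t - 1 / 2)). split; nra. }
    nra. }
  exists (fun t => (normalized q0 d0 D t, normalized q1 d1 D t, normalized q2 d2 D t,
                    normalized q3 d3 D t)),
    (fun t => (dnormalized q0 d0 D t, dnormalized q1 d1 D t, dnormalized q2 d2 D t,
               dnormalized q3 d3 D t)).
  split; [|split].
  - unfold normalized. replace (1 - 0 * (1 - 0) * D) with 1 by ring. rewrite sqrt_1.
    f_equal; [f_equal; [f_equal|]|]; field.
  - unfold normalized. replace (1 - 1 * (1 - 1) * D) with 1 by ring. rewrite sqrt_1.
    f_equal; [f_equal; [f_equal|]|]; field.
  - intros t Ht. specialize (HN t Ht).
    assert (HN0 : 0 < 1 - t * (1 - t) * D) by lra.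
    split; [|split; [|split]].
    + apply unit_quat_qnorm2. unfold qnorm2, normalized.
      pose proof (sqrt_lt_R0 _ HN0) as HS. pose proof (sqrt_sqrt _ (Rlt_le _ _ HN0)) as HSS.
      set (S := sqrt (1 - t * (1 - t) * D)) in *.
      replace (((q0 + t * d0) / S) ^ 2 + ((q1 + t * d1) / S) ^ 2 + ((q2 + t * d2) / S) ^ 2 +
               ((q3 + t * d3) / S) ^ 2)
        with (((q0 ^ 2 + q1 ^ 2 + q2 ^ 2 + q3 ^ 2) + t * (2 * (q0 * d0 + q1 * d1 + q2 * d2 + q3 * d3))
              + t ^ 2 * D) / (S * S)) by (unfold D; field; lra).
      rewrite Hq, HD, HSS. field. lra.
    + repeat apply (is_derive_pair (V := R_NormedModule)); now apply is_derive_normalized.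
    + repeat apply continuous_pair; now apply continuous_dnormalized.
    + assert (Hq1 : forall v, v ^ 2 <= 1 -> Rabs v <= 1).
      { intros v Hv. rewrite <- Rabs_R1. apply Rsqr_le_abs_0. unfold Rsqr. lra. }
      pose proof (pow2_ge_0 q0). pose proof (pow2_ge_0 q1). pose proof (pow2_ge_0 q2).
      pose proof (pow2_ge_0 q3).
      assert (Q0 : Rabs q0 <= 1) by (apply Hq1; lra). assert (Q1 : Rabs q1 <= 1) by (apply Hq1; lra).
      assert (Q2 : Rabs q2 <= 1) by (apply Hq1; lra). assert (Q3 : Rabs q3 <= 1) by (apply Hq1; lra).
      (* In the imaginary part of the conjugate of [Q] times [dQ], the derivative of the normalising
         factor contributes a real multiple of [|Q| ^ 2] and drops out. Four products of size
         [delta] remain, divided by a squared norm of at least 1/2: this is the 8. *)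
      assert (HB : forall a b c d e f g h, Rabs a <= 1 -> Rabs b <= 1 -> Rabs c <= 1 -> Rabs d <= 1 ->
        Rabs e <= delta -> Rabs f <= delta -> Rabs g <= delta -> Rabs h <= delta ->
        Rabs ((a * e + b * f + c * g + d * h) / (1 - t * (1 - t) * D)) <= 8 * delta).
      { intros a b c d e f g0 h A1 A2 A3 A4 A5 A6 A7 A8.
        assert (HP : forall u v, Rabs u <= 1 -> Rabs v <= delta -> - delta <= u * v <= delta).
        { intros u v Hu Hv. apply Rabs_le_between. rewrite Rabs_mult.
          replace delta with (1 * delta) by ring.
          apply Rmult_le_compat; try apply Rabs_pos; assumption. }
        pose proof (HP a e A1 A5). pose proof (HP b f A2 A6). pose proof (HP c g0 A3 A7).
        pose proof (HP d h A4 A8).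
        assert (Hi : 0 < / (1 - t * (1 - t) * D) <= 2).
        { split; [now apply Rinv_0_lt_compat|]. replace 2 with (/ (1 / 2)) by field.
          apply Rinv_le_contravar; lra. }
        unfold Rdiv. rewrite Rabs_mult, (Rabs_right (/ _)) by lra.
        assert (Rabs (a * e + b * f + c * g0 + d * h) <= 4 * delta) by (apply Rabs_le; lra).
        pose proof (Rabs_pos (a * e + b * f + c * g0 + d * h)). nra. }
      pose proof (sqrt_lt_R0 _ HN0) as HS. pose proof (sqrt_sqrt _ (Rlt_le _ _ HN0)) as HSS.
      unfold eta, qmul, qconj, normalized, dnormalized. simpl fst. simpl snd.
      set (N := 1 - t * (1 - t) * D) in *. set (S := sqrt N) in *.
      set (m := - (1 - 2 * t) * D).
      assert (HSS' : forall v, v / N = v / (S * S)) by (intros; now rewrite HSS).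
      repeat split.
      * pose proof (HB q0 q1 q2 q3 (- d1) d0 d3 (- d2)) as Hb. rewrite !Rabs_Ropp in Hb.
        specialize (Hb Q0 Q1 Q2 Q3 C1 C0 C3 C2). rewrite HSS' in Hb.
        eapply Rle_trans; [right; apply (f_equal Rabs)|exact Hb]. field. lra.
      * pose proof (HB q0 q1 q2 q3 (- d2) (- d3) d0 d1) as Hb. rewrite !Rabs_Ropp in Hb.
        specialize (Hb Q0 Q1 Q2 Q3 C2 C3 C0 C1). rewrite HSS' in Hb.
        eapply Rle_trans; [right; apply (f_equal Rabs)|exact Hb]. field. lra.
      * pose proof (HB q0 q1 q2 q3 (- d3) d2 (- d1) d0) as Hb. rewrite !Rabs_Ropp in Hb.
        specialize (Hb Q0 Q1 Q2 Q3 C3 C2 C1 C0). rewrite HSS' in Hb.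
        eapply Rle_trans; [right; apply (f_equal Rabs)|exact Hb]. field. lra.
Qed.

Section Completeness.

Context (g : R -> tangent -> tangent -> R) (k1 k2 k3 : R -> R) (s1 kappa : R).
Context (g_diagonal : forall s x y, g s x y = diagonal_metric (k1 s) (k1 s) (k2 s) (k3 s) x y).
Context (k_positive : forall s, s1 <= s -> 0 < k1 s /\ 0 < k2 s /\ 0 < k3 s).
Context (k_continuous : forall s, s1 <= s ->
  continuity_pt k1 s /\ continuity_pt k2 s /\ continuity_pt k3 s).
Context (kappa_pos : 0 < kappa) (kappa_le : forall s, s1 <= s -> kappa ^ 2 <= k1 s).

Lemma continuous_speed (gam dgam : R -> point) (t : R) :
  s1 <= fst (gam t) -> continuous gam t -> continuous dgam t ->
  continuous (fun t => speed g (gam t) (dgam t)) t.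
Proof.
  intros Hs Hg Hd.
  pose proof (continuous_fst_comp gam t Hg) as G1.
  pose proof (continuous_snd_comp gam t Hg) as G2.
  pose proof (continuous_fst_comp dgam t Hd) as D1.
  pose proof (continuous_snd_comp dgam t Hd) as D2.
  destruct (continuous_eta (fun t => fst (snd (gam t))) (fun t => fst (snd (dgam t))) t
     (continuous_fst_comp _ t G2) (continuous_fst_comp _ t D2)) as (E1 & E2 & E3).
  destruct (continuous_eta (fun t => snd (snd (gam t))) (fun t => snd (snd (dgam t))) t
     (continuous_snd_comp _ t G2) (continuous_snd_comp _ t D2)) as (E1' & E2' & E3').
  apply continuous_pt in G1, D1.
  destruct (k_continuous (fst (gam t)) Hs) as (K1 & K2 & K3).
  apply (continuous_comp (fun t => g (fst (gam t)) (project (gam t) (dgam t))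
           (project (gam t) (dgam t))) sqrt); [|apply continuous_sqrt].
  apply continuous_ext with (f := fun t =>
    k1 (fst (gam t)) * (fst (dgam t) * fst (dgam t)) +
    k1 (fst (gam t)) * ((2 / 3 * (fst (fst (eta (fst (snd (gam t))) (fst (snd (dgam t)))))
        - fst (fst (eta (snd (snd (gam t))) (snd (snd (dgam t))))))) *
      (2 / 3 * (fst (fst (eta (fst (snd (gam t))) (fst (snd (dgam t)))))
        - fst (fst (eta (snd (snd (gam t))) (snd (snd (dgam t)))))))) +
    k2 (fst (gam t)) * (snd (fst (eta (fst (snd (gam t))) (fst (snd (dgam t))))) *
                        snd (fst (eta (fst (snd (gam t))) (fst (snd (dgam t))))) +
                        snd (eta (fst (snd (gam t))) (fst (snd (dgam t)))) *
                        snd (eta (fst (snd (gam t))) (fst (snd (dgam t))))) +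
    k3 (fst (gam t)) * (snd (fst (eta (snd (snd (gam t))) (snd (snd (dgam t))))) *
                        snd (fst (eta (snd (snd (gam t))) (snd (snd (dgam t))))) +
                        snd (eta (snd (snd (gam t))) (snd (snd (dgam t)))) *
                        snd (eta (snd (snd (gam t))) (snd (snd (dgam t)))))).
  - intros s. rewrite g_diagonal. unfold diagonal_metric.
    destruct (project_components (gam s) (dgam s)) as (-> & -> & -> & -> & ->).
    rewrite project_ds. reflexivity.
  - apply continuous_pt.
    assert (KC : forall k : R -> R, continuity_pt k (fst (gam t)) ->
              continuity_pt (fun t => k (fst (gam t))) t).
    { intros k Hk. exact (continuity_pt_comp (fun t => fst (gam t)) k t G1 Hk). }
    pose proof (KC k1 K1). pose proof (KC k2 K2). pose proof (KC k3 K3).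
    repeat first [assumption | apply continuity_pt_plus | apply continuity_pt_opp
                 | apply continuity_pt_mult | now apply continuity_pt_const].
Qed.

(** The [ds] part alone makes the speed at least [kappa |s'|]. Hence a Cauchy sequence stays in a
    bounded range of [s]. *)
Lemma length_lower_bound (x y : point) (l : R) :
  path_length g s1 x y l -> kappa * Rabs (fst y - fst x) <= l.
Proof.
  induction 1 as [gam dgam Hgam | x y z l l' _ IH1 _ IH2].
  - assert (Hcs : forall t, 0 <= t <= 1 -> continuous (fun t => speed g (gam t) (dgam t)) t).
    { intros t Ht. destruct (Hgam t Ht) as ((Hs & _) & Hd & Hc).
      apply continuous_speed; [exact Hs | | exact Hc].
      exact (ex_derive_continuous _ _ (ex_intro _ (dgam t) Hd)). }
    assert (Hex : ex_RInt (fun t => speed g (gam t) (dgam t)) 0 1).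
    { apply (@ex_RInt_continuous R_CompleteNormedModule). intros t Ht.
      rewrite Rmin_left, Rmax_right in Ht by lra. now apply Hcs. }
    assert (Hle : forall t, 0 <= t <= 1 ->
              kappa * Rabs (fst (dgam t)) <= speed g (gam t) (dgam t)).
    { intros t Ht. destruct (Hgam t Ht) as ((Hs & _) & _ & _).
      unfold speed. rewrite <- (sqrt_pow2 (kappa * Rabs (fst (dgam t)))).
      2: { apply Rmult_le_pos; [lra|apply Rabs_pos]. }
      apply sqrt_le_1_alt. rewrite Rpow_mult_distr, pow2_abs, g_diagonal.
      unfold diagonal_metric. rewrite project_ds.
      set (v := project (gam t) (dgam t)).
      destruct (k_positive _ Hs) as (P1 & P2 & P3).
      assert (Q : forall k a b, 0 < k -> 0 <= k * (a * a + b * b)).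
      { intros. apply Rmult_le_pos; [lra|].
        apply Rplus_le_le_0_compat; apply Rle_0_sqr. }
      pose proof (Q _ (eta2 v) (eta3 v) P2). pose proof (Q _ (eta2' v) (eta3' v) P3).
      pose proof (Q _ (eta_se v) 0 P1).
      pose proof (Rmult_le_compat_r _ _ _ (pow2_ge_0 (fst (dgam t))) (kappa_le _ Hs)).
      lra. }
    assert (Hint : is_RInt (fun t => fst (dgam t)) 0 1 (fst (gam 1) - fst (gam 0))).
    { apply (@is_RInt_derive R_CompleteNormedModule (fun t => fst (gam t))).
      - intros t Ht. rewrite Rmin_left, Rmax_right in Ht by lra.
        destruct (Hgam t Ht) as (_ & Hd & _). exact (is_derive_fst gam t (dgam t) Hd).
      - intros t Ht. rewrite Rmin_left, Rmax_right in Ht by lra.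
        destruct (Hgam t Ht) as (_ & _ & Hc). exact (continuous_fst_comp dgam t Hc). }
    (* Testing with both signs gives the bound for the absolute value of the integral of [s']. *)
    assert (Hb : forall e, e = 1 \/ e = -1 -> kappa * (e * (fst (gam 1) - fst (gam 0))) <=
               RInt (fun t => speed g (gam t) (dgam t)) 0 1).
    { intros e He.
      assert (Hint' : is_RInt (fun t => kappa * (e * fst (dgam t))) 0 1
                        (kappa * (e * (fst (gam 1) - fst (gam 0))))).
      { apply (is_RInt_scal (V := R_NormedModule)), (is_RInt_scal (V := R_NormedModule)), Hint. }
      rewrite <- (is_RInt_unique _ _ _ _ Hint').
      apply RInt_le; [lra | now exists (kappa * (e * (fst (gam 1) - fst (gam 0)))) | exact Hex |].
      intros t Ht. eapply Rle_trans; [|apply Hle; lra].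
      apply Rmult_le_compat_l; [lra|].
      destruct He as [-> | ->]; pose proof (Rle_abs (fst (dgam t)));
        pose proof (Rle_abs (- fst (dgam t))); rewrite ?Rabs_Ropp in *; lra. }
    pose proof (Hb 1 (or_introl eq_refl)). pose proof (Hb (-1) (or_intror eq_refl)).
    unfold speed in *. unfold Rabs. destruct (Rcase_abs _); lra.
  - replace (fst z - fst x) with ((fst y - fst x) + (fst z - fst y)) by ring.
    pose proof (Rmult_le_compat_l kappa _ _ (Rlt_le _ _ kappa_pos)
                  (Rabs_triang (fst y - fst x) (fst z - fst y))).
    lra.
Qed.

(** Closeness in the nine Euclidean coordinates gives closeness in the Riemannian distance, with a
    constant depending on the metric over the range of [s] involved. The path moves linearly in [s]
    and along [quat_path] in both quaternions. *)
Lemma short_path (x y : point) (delta K : R) :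
  end_region s1 x -> end_region s1 y -> delta <= 1 / 2 ->
  Rabs (fst y - fst x) <= delta ->
  (forall i, Rabs (qcomp i (fst (snd y)) - qcomp i (fst (snd x))) <= delta) ->
  (forall i, Rabs (qcomp i (snd (snd y)) - qcomp i (snd (snd x))) <= delta) ->
  (forall s, s1 <= s <= Rmax (fst x) (fst y) -> k1 s <= K /\ k2 s <= K /\ k3 s <= K) ->
  exists l, path_length g s1 x y l /\ l <= 20 * sqrt K * delta.
Proof.
  destruct x as [a [q q']], y as [b [w w']]. simpl fst. simpl snd.
  intros (Ha & Hq & Hq') (Hb & Hw & Hw') Hd Hs Hc Hc' HK. simpl in Ha, Hq, Hq', Hb, Hw, Hw'.
  destruct (quat_path q w delta Hq Hw Hd Hc) as (Q & dQ & HQ0 & HQ1 & HQ).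
  destruct (quat_path q' w' delta Hq' Hw' Hd Hc') as (Q' & dQ' & HQ0' & HQ1' & HQ').
  assert (Hdelta : 0 <= delta) by (pose proof (Rabs_pos (b - a)); lra).
  set (gam := fun t => (a + t * (b - a), (Q t, Q' t)) : point).
  set (dgam := fun t => (b - a, (dQ t, dQ' t)) : point).
  assert (Hgam : forall t, 0 <= t <= 1 ->
     end_region s1 (gam t) /\ is_derive gam t (dgam t) /\ continuous dgam t).
  { intros t Ht. destruct (HQ t Ht) as (U & Dq & Cq & _).
    destruct (HQ' t Ht) as (U' & Dq' & Cq' & _).
    split; [|split].
    - repeat split; simpl; [nra | exact U | exact U'].
    - apply (is_derive_pair (U := R_NormedModule) (fun t => a + t * (b - a))).
      + apply is_derive_affine.
      + apply is_derive_pair; assumption.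
    - exact (continuous_pair (fun _ => b - a) (fun t => (dQ t, dQ' t)) t
               (continuous_const _ _) (continuous_pair dQ dQ' t Cq Cq')). }
  exists (RInt (fun t => speed g (gam t) (dgam t)) 0 1). split.
  - replace ((a, (q, q')) : point) with (gam 0).
    + replace ((b, (w, w')) : point) with (gam 1).
      * exact (path_C1 g s1 gam dgam Hgam).
      * unfold gam. rewrite HQ1, HQ1'. f_equal. ring.
    + unfold gam. rewrite HQ0, HQ0'. f_equal. ring.
  - assert (Hcs : forall t, 0 <= t <= 1 -> continuous (fun t => speed g (gam t) (dgam t)) t).
    { intros t Ht. destruct (Hgam t Ht) as ((Hst & _) & Hdd & Hcc).
      apply continuous_speed; [exact Hst | | exact Hcc].
      exact (ex_derive_continuous _ _ (ex_intro _ (dgam t) Hdd)). }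
    assert (Hr : RInt (fun _ => 20 * sqrt K * delta) 0 1 = 20 * sqrt K * delta).
    { rewrite RInt_const. unfold scal; simpl; unfold mult; simpl. ring. }
    rewrite <- Hr. apply RInt_le; [lra| | |].
    + apply (@ex_RInt_continuous R_CompleteNormedModule). intros t Ht.
      rewrite Rmin_left, Rmax_right in Ht by lra. now apply Hcs.
    + apply ex_RInt_const.
    + intros t Ht. destruct (HQ t ltac:(lra)) as (_ & _ & _ & E1 & E2 & E3).
      destruct (HQ' t ltac:(lra)) as (_ & _ & _ & E1' & E2' & E3').
      assert (Hst : s1 <= fst (gam t) <= Rmax a b).
      { simpl. pose proof (Rmax_l a b). pose proof (Rmax_r a b). split; nra. }
      destruct (HK _ Hst) as (L1 & L2 & L3).
      destruct (k_positive _ (proj1 Hst)) as (P1 & P2 & P3).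
      assert (HK0 : 0 < K) by lra.
      (* The squared speed is at most [(1 + 121 + 128 + 128) K delta ^ 2], and 378 is below
         [20 ^ 2]; the 121 comes from [2 / 3 (8 + 8) <= 11], and 128 is [2 * 8 ^ 2]. *)
      replace (20 * sqrt K * delta) with (sqrt (K * (400 * delta ^ 2))).
      2: { rewrite sqrt_mult by nra. replace (400 * delta ^ 2) with ((20 * delta) ^ 2) by ring.
           rewrite sqrt_pow2 by lra. ring. }
      apply sqrt_le_1_alt. rewrite g_diagonal. unfold diagonal_metric. rewrite project_ds.
      destruct (project_components (gam t) (dgam t)) as (-> & -> & -> & -> & ->).
      simpl fst in *. simpl snd in *.
      assert (HS : forall v e, Rabs v <= e -> 0 <= v * v <= e ^ 2).
      { intros v e Hv. split; [apply Rle_0_sqr|].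
        replace (v * v) with (Rabs v ^ 2) by (rewrite pow2_abs; ring).
        apply pow_incr. split; [apply Rabs_pos|exact Hv]. }
      set (e1 := fst (fst (eta (Q t) (dQ t)))) in *.
      set (e1' := fst (fst (eta (Q' t) (dQ' t)))) in *.
      assert (E : Rabs (2 / 3 * (e1 - e1')) <= 11 * delta).
      { apply Rabs_le_between in E1, E1'. apply Rabs_le. lra. }
      pose proof (HS _ _ Hs) as S0. pose proof (HS _ _ E) as S1.
      pose proof (HS _ _ E2) as S2. pose proof (HS _ _ E3) as S3.
      pose proof (HS _ _ E2') as S2'. pose proof (HS _ _ E3') as S3'.
      assert (HM : forall k v B, 0 < k -> k <= K -> 0 <= v <= B -> k * v <= K * B)
        by (intros; apply Rmult_le_compat; lra).
      pose proof (HM _ _ _ P1 L1 S0). pose proof (HM _ _ _ P1 L1 S1).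
      set (B2 := snd (fst (eta (Q t) (dQ t))) * snd (fst (eta (Q t) (dQ t))) +
                 snd (eta (Q t) (dQ t)) * snd (eta (Q t) (dQ t))) in *.
      set (B3 := snd (fst (eta (Q' t) (dQ' t))) * snd (fst (eta (Q' t) (dQ' t))) +
                 snd (eta (Q' t) (dQ' t)) * snd (eta (Q' t) (dQ' t))) in *.
      pose proof (HM _ B2 (128 * delta ^ 2) P2 L2 ltac:(unfold B2; lra)).
      pose proof (HM _ B3 (128 * delta ^ 2) P3 L3 ltac:(unfold B3; lra)).
      assert (0 <= K * delta ^ 2) by (apply Rmult_le_pos; [lra|apply pow2_ge_0]).
      lra.
Qed.

Lemma distance_lt (x y : point) (e : R) :
  Rbar_lt (distance g s1 x y) e <-> exists l, path_length g s1 x y l /\ l < e.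
Proof.
  destruct (Glb_Rbar_correct (path_length g s1 x y)) as [Hlb Hglb].
  unfold distance. split.
  - intros H. destruct (classic (exists l, path_length g s1 x y l /\ l < e)) as [|Hn]; [easy|].
    exfalso. apply (Rbar_lt_not_le _ _ H). apply Hglb. intros l Hl. simpl.
    destruct (Rlt_dec l e); [|lra]. exfalso. apply Hn. now exists l.
  - intros [l [Hl1 Hl2]]. apply Rbar_le_lt_trans with l; [now apply Hlb | exact Hl2].
Qed.

(** A Cauchy sequence has bounded [s], and the unit quaternions are compact, so a subsequence
    converges in coordinates. By [short_path] it comes close to the limit in the Riemannian
    distance, and the Cauchy property carries this over to the full sequence. *)
Lemma diagonal_complete_end : complete_end g s1.
Proof.
  intros x Hx HC.
  assert (Hs : exists M, forall n, Rabs (fst (x n)) <= M).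
  { destruct (HC (mkposreal 1 Rlt_0_1)) as [N HN].
    assert (Hfin : exists M, forall n, (n < N)%nat -> Rabs (fst (x n)) <= M).
    { clear. induction N as [|N [M HM]]; [exists 0; intros; lia|].
      exists (Rmax M (Rabs (fst (x N)))). intros n Hn.
      destruct (Nat.eq_dec n N) as [-> |]; [apply Rmax_r|].
      eapply Rle_trans; [apply HM; lia|apply Rmax_l]. }
    destruct Hfin as [M HM]. exists (Rmax M (Rabs (fst (x N)) + / kappa)). intros n.
    destruct (Nat.lt_ge_cases n N) as [Hn|Hn].
    - eapply Rle_trans; [now apply HM|apply Rmax_l].
    - eapply Rle_trans; [|apply Rmax_r].
      destruct (proj1 (distance_lt _ _ _) (HN N n (le_n N) Hn)) as [l [Hl1 Hl2]].
      apply length_lower_bound in Hl1. simpl in Hl2.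
      assert (Rabs (fst (x n) - fst (x N)) <= / kappa).
      { apply Rmult_le_reg_l with kappa; [exact kappa_pos|]. rewrite Rinv_r by lra. lra. }
      replace (fst (x n)) with (fst (x N) + (fst (x n) - fst (x N))) by ring.
      eapply Rle_trans; [apply Rabs_triang|]. lra. }
  assert (Hu : forall q i, unit_quat q -> Rabs (qcomp i q) <= 1).
  { intros q i Hq. apply unit_quat_qnorm2 in Hq. destruct q as [[[q0 q1] q2] q3].
    unfold qnorm2 in Hq. pose proof (pow2_ge_0 q0). pose proof (pow2_ge_0 q1).
    pose proof (pow2_ge_0 q2). pose proof (pow2_ge_0 q3).
    rewrite <- Rabs_R1. apply Rsqr_le_abs_0. unfold Rsqr, qcomp.
    destruct i as [|[|[|i]]]; simpl; lra. }
  (* The nine coordinates: [s], then four components of each quaternion. *)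
  set (u := fun k n => match k with
    | 0%nat => fst (x n)
    | S k => if Nat.ltb k 4 then qcomp k (fst (snd (x n))) else qcomp (k - 4) (snd (snd (x n)))
    end).
  destruct (bolzano_weierstrass_family u 9) as (psi & l & Hpsi & Hl).
  { intros [|k]; [exact Hs|]. exists 1. intros n. destruct (Hx n) as (_ & U1 & U2).
    unfold u. destruct (Nat.ltb k 4); now apply Hu. }
  set (y := (l 0%nat, ((l 1%nat, l 2%nat, l 3%nat, l 4%nat), (l 5%nat, l 6%nat, l 7%nat, l 8%nat)))
         : point).
  pose proof (Hl 0%nat ltac:(lia)) as L0. pose proof (Hl 1%nat ltac:(lia)) as L1.
  pose proof (Hl 2%nat ltac:(lia)) as L2. pose proof (Hl 3%nat ltac:(lia)) as L3.
  pose proof (Hl 4%nat ltac:(lia)) as L4. pose proof (Hl 5%nat ltac:(lia)) as L5.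
  pose proof (Hl 6%nat ltac:(lia)) as L6. pose proof (Hl 7%nat ltac:(lia)) as L7.
  pose proof (Hl 8%nat ltac:(lia)) as L8. unfold u in L0, L1, L2, L3, L4, L5, L6, L7, L8.
  simpl in L0, L1, L2, L3, L4, L5, L6, L7, L8.
  assert (Hqlim : forall (a : nat -> quat) (l0 l1 l2 l3 : R), (forall n, unit_quat (a n)) ->
     is_lim_seq (fun n => fst (fst (fst (a n)))) l0 -> is_lim_seq (fun n => snd (fst (fst (a n)))) l1 ->
     is_lim_seq (fun n => snd (fst (a n))) l2 -> is_lim_seq (fun n => snd (a n)) l3 ->
     unit_quat (l0, l1, l2, l3)).
  { intros a l0 l1 l2 l3 Ha A0 A1 A2 A3. apply unit_quat_qnorm2. unfold qnorm2.
    assert (P : forall v m, is_lim_seq v (Finite m) -> is_lim_seq (fun n => v n ^ 2) (m ^ 2)).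
    { intros v m Hv. apply (is_lim_seq_ext (fun n => v n * v n)); [intros; ring|].
      replace (m ^ 2) with (m * m) by ring. now apply is_lim_seq_mult'. }
    pose proof (is_lim_seq_plus' _ _ _ _ (is_lim_seq_plus' _ _ _ _
      (is_lim_seq_plus' _ _ _ _ (P _ _ A0) (P _ _ A1)) (P _ _ A2)) (P _ _ A3)) as HP.
    apply (is_lim_seq_ext _ (fun _ => 1)) in HP.
    - apply is_lim_seq_unique in HP. rewrite Lim_seq_const in HP. now injection HP.
    - intros n. specialize (Ha n). apply unit_quat_qnorm2 in Ha.
      destruct (a n) as [[[a0 a1] a2] a3]. exact Ha. }
  assert (Hy : end_region s1 y).
  { split; [|split]; simpl.
    - apply (is_lim_seq_le (fun _ => s1) _ s1 (l 0%nat)) with (3 := L0); [|apply is_lim_seq_const].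
      intros n. apply Hx.
    - apply (Hqlim (fun n => fst (snd (x (psi n))))); try assumption. intros n. apply Hx.
    - apply (Hqlim (fun n => snd (snd (x (psi n))))); try assumption. intros n. apply Hx. }
  exists y. split; [exact Hy|]. intros eps.
  (* The margin 1 suffices because the term of the sequence chosen below lies within
     [delta <= 1 / 2] of the limit. *)
  assert (HK : exists K, forall s, s1 <= s <= l 0%nat + 1 -> k1 s <= K /\ k2 s <= K /\ k3 s <= K).
  { assert (Hr : s1 <= l 0%nat + 1) by (destruct Hy as [Hy _]; simpl in Hy; lra).
    destruct (continuity_ab_maj k1 _ _ Hr) as [m1 [M1 _]]; [intros c Hc; now apply k_continuous|].
    destruct (continuity_ab_maj k2 _ _ Hr) as [m2 [M2 _]]; [intros c Hc; now apply k_continuous|].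
    destruct (continuity_ab_maj k3 _ _ Hr) as [m3 [M3 _]]; [intros c Hc; now apply k_continuous|].
    exists (Rmax (k1 m1) (Rmax (k2 m2) (k3 m3))). intros s Hss.
    specialize (M1 s Hss). specialize (M2 s Hss). specialize (M3 s Hss).
    pose proof (Rmax_l (k1 m1) (Rmax (k2 m2) (k3 m3))).
    pose proof (Rmax_r (k1 m1) (Rmax (k2 m2) (k3 m3))).
    pose proof (Rmax_l (k2 m2) (k3 m3)). pose proof (Rmax_r (k2 m2) (k3 m3)). lra. }
  destruct HK as [K HK].
  pose proof (cond_pos eps) as He. pose proof (sqrt_pos K) as HsK.
  set (delta := Rmin (1 / 2) (eps / 2 / (20 * sqrt K + 1))).
  assert (Hdelta : 0 < delta /\ delta <= 1 / 2 /\ 20 * sqrt K * delta < eps / 2).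
  { assert (0 < eps / 2 / (20 * sqrt K + 1)) by (apply Rdiv_lt_0_compat; lra).
    unfold delta. pose proof (Rmin_r (1 / 2) (eps / 2 / (20 * sqrt K + 1))) as Hm.
    repeat split; [apply Rmin_glb_lt; lra | apply Rmin_l |].
    set (d := Rmin _ _) in *.
    assert (0 < d) by (unfold d; apply Rmin_glb_lt; lra).
    apply (Rmult_le_compat_r (20 * sqrt K + 1)) in Hm; [|lra].
    replace (eps / 2 / (20 * sqrt K + 1) * (20 * sqrt K + 1)) with (eps / 2) in Hm by (field; lra).
    lra. }
  destruct Hdelta as (Hd1 & Hd2 & Hd3).
  destruct (HC (mkposreal (eps / 2) ltac:(lra))) as [N HN].
  (* One term in the Cauchy tail that is near [y] is enough: every later term reaches [y] through
     it. *)
  assert (Hclose : exists m, (N <= m)%nat /\ forall k, (k < 9)%nat -> Rabs (u k m - l k) < delta).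
  { assert (Hev : forall K, (K <= 9)%nat -> exists m, forall n, (m <= n)%nat ->
       forall k, (k < K)%nat -> Rabs (u k (psi n) - l k) < delta).
    { induction K0 as [|K0 IH]; intros HK9; [exists 0%nat; intros; lia|].
      destruct (IH ltac:(lia)) as [m Hm].
      pose proof (Hl K0 ltac:(lia)) as HlK. apply is_lim_seq_spec in HlK.
      destruct (HlK (mkposreal _ Hd1)) as [m' Hm'].
      exists (Nat.max m m'). intros n Hn k Hk.
      destruct (Nat.eq_dec k K0) as [-> |]; [apply Hm'; lia | apply Hm; lia]. }
    destruct (Hev 9%nat (le_n 9)) as [m Hm].
    exists (psi (Nat.max m N)). split.
    - specialize (Hpsi (Nat.max m N)). lia.
    - apply Hm. lia. }
  destruct Hclose as (m & HmN & Hm).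
  destruct (short_path (x m) y delta K (Hx m) Hy Hd2) as [l2 [Hl2a Hl2b]].
  - rewrite Rabs_minus_sym. left. apply (Hm 0%nat). lia.
  - intros i. rewrite Rabs_minus_sym. left.
    destruct i as [|[|[|i]]];
      [apply (Hm 1%nat)|apply (Hm 2%nat)|apply (Hm 3%nat)|apply (Hm 4%nat)]; lia.
  - intros i. rewrite Rabs_minus_sym. left.
    destruct i as [|[|[|i]]];
      [apply (Hm 5%nat)|apply (Hm 6%nat)|apply (Hm 7%nat)|apply (Hm 8%nat)]; lia.
  - intros s [Hs1 Hs2]. apply HK. split; [exact Hs1|].
    pose proof (Hm 0%nat ltac:(lia)) as Hm0. unfold u in Hm0. apply Rabs_def2 in Hm0.
    eapply Rle_trans; [exact Hs2|]. apply Rmax_lub; simpl; lra.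
  - exists N. intros n Hn. apply distance_lt.
    destruct (proj1 (distance_lt _ _ _) (HN n m Hn HmN)) as [l1 [Hl1a Hl1b]].
    exists (l1 + l2). split; [now apply path_cat with (x m)|]. simpl in Hl1b. lra.
Qed.

End Completeness.

(** * Reduction of the IIB system *)

Definition slope (a : R) : R := 9 / 2 * a.
(** The function [u0] vanishes at [s = - shift a b], so [s + shift a b] is the variable [x] of the
    reduced system. *)
Definition shift (a b : R) : R := b / slope a.

Definition p_of (a b : R) (u : R -> R) (x : R) : R := u (x - shift a b) / slope a - x.
Definition z_of (a b : R) (u : R -> R) (x : R) : R := Derive u (x - shift a b) / slope a - 1.

Definition u_of (a b : R) (p : R -> R) (s : R) : R :=
  slope a * (p (s + shift a b) + (s + shift a b)).
Definition phi_of (a b : R) (p z : R -> R) (s : R) : R :=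
  let x := s + shift a b in
  / 4 * ln (slope a ^ 3 * (1 + z x) * (p x * (p x + 2 * x)) / (2 * exp (6 * s))).

Lemma slope_pos (a : R) : 0 < a -> 0 < slope a.
Proof. unfold slope. lra. Qed.

Lemma u0_shift (a b s : R) : 0 < a -> u0 a b s = slope a * (s + shift a b).
Proof. intros Ha. unfold u0, shift, slope. field. lra. Qed.

Lemma is_derive_u0 (a b s : R) : is_derive (u0 a b) s (slope a).
Proof. unfold u0, slope. auto_derive; [easy|ring]. Qed.

Lemma s_sing_shift (a b c : R) : 0 < a -> s_sing a b c + shift a b = - c / 6.
Proof. intros Ha. unfold s_sing, shift, slope. field. lra. Qed.

Lemma V_sqr (s : R) : V s ^ 2 = exp (6 * s).
Proof. unfold V. simpl. rewrite Rmult_1_r, <- exp_plus. f_equal. ring. Qed.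

Lemma is_derive_shift (f : R -> R) (c x l : R) :
  is_derive f (x + c) l -> is_derive (fun x => f (x + c)) x l.
Proof.
  intros Hf. evar_last.
  - apply (is_derive_comp f (fun x => x + c)); [exact Hf|].
    apply (is_derive_Rplus (fun x => x) (fun _ => c));
      [apply is_derive_id | apply is_derive_const].
  - unfold scal, plus, one, zero; simpl. unfold mult; simpl. ring.
Qed.

Lemma locally_lt_Rbar (x : R) (hi : Rbar) :
  Rbar_lt x hi -> locally x (fun y => Rbar_lt y hi).
Proof.
  intros H. apply (open_Rbar_lt hi). exact H.
Qed.

Section Reduction.

Context (a b lo : R) (hi : Rbar) (u phi : R -> R) (ha : 0 < a).
Context (sol : solves_on a b lo hi u phi).

(** The condition on [u ^ 2 - u0 ^ 2] gives [p q > 0], and [u > 0] gives [p + q = 2 (p + x) > 0];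
    together they make both factors positive. *)
Lemma sol_p_q (s : R) : lo < s -> Rbar_lt s hi ->
  let x := s + shift a b in let p := p_of a b u x in
  0 < p /\ 0 < p + 2 * x /\
  u s = slope a * (p + x) /\ u s ^ 2 - u0 a b s ^ 2 = slope a ^ 2 * (p * (p + 2 * x)).
Proof.
  intros H1 H2 x p. destruct (sol s H1 H2) as (Hu & _ & Huu & _).
  pose proof (slope_pos a ha) as Hk.
  assert (Eu : u s = slope a * (p + x)).
  { unfold p, p_of, x. replace (s + shift a b - shift a b) with s by ring. field. lra. }
  rewrite (u0_shift a b s ha) in Huu. fold x in Huu.
  rewrite (u0_shift a b s ha). fold x.
  assert (Hpq : 0 < slope a ^ 2 * (p * (p + 2 * x))) by (rewrite Eu in Huu; lra).
  assert (Hpq' : 0 < p * (p + 2 * x)).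
  { apply Rmult_lt_reg_l with (slope a ^ 2); [now apply pow_lt|]. lra. }
  assert (Hs : 0 < p + x).
  { apply Rmult_lt_reg_l with (slope a); [exact Hk|]. lra. }
  assert (0 < p).
  { destruct (Rlt_dec 0 p); [easy|]. assert (0 <= - p) by lra.
    assert (p + 2 * x > 0) by lra. nra. }
  repeat split; [easy | nra | exact Eu | rewrite Eu; ring].
Qed.

Lemma sol_speed (s : R) : lo < s -> Rbar_lt s hi ->
  let x := s + shift a b in let p := p_of a b u x in
  Derive u s = 2 * exp (6 * s) * exp (4 * phi s) / (u s ^ 2 - u0 a b s ^ 2) /\
  Derive u s = slope a * (1 + z_of a b u x) /\ 0 < 1 + z_of a b u x /\
  exp (4 * phi s) = slope a ^ 3 * (1 + z_of a b u x) * (p * (p + 2 * x)) / (2 * exp (6 * s)).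
Proof.
  intros H1 H2 x p. destruct (sol_p_q s H1 H2) as (Hp & Hq & Eu & Euu).
  fold x in Hp, Hq, Eu, Euu. fold p in Hp, Hq, Eu, Euu.
  destruct (sol s H1 H2) as (_ & Hd & Huu & Hdu & _).
  pose proof (slope_pos a ha) as Hk.
  apply is_derive_unique in Hdu. rewrite V_sqr in Hdu.
  assert (Ez : Derive u s = slope a * (1 + z_of a b u x)).
  { unfold z_of, x. replace (s + shift a b - shift a b) with s by ring. field. lra. }
  assert (Hz : 0 < 1 + z_of a b u x).
  { apply Rmult_lt_reg_l with (slope a); [exact Hk|]. lra. }
  repeat split; [exact Hdu | exact Ez | exact Hz |].
  rewrite Ez, Euu in Hdu. pose proof (exp_pos (6 * s)).
  replace (slope a ^ 3 * (1 + z_of a b u x) * (p * (p + 2 * x)))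
    with (slope a * (1 + z_of a b u x) * (slope a ^ 2 * (p * (p + 2 * x)))) by ring.
  rewrite Hdu. field. repeat split; lra.
Qed.

Lemma sol_phi (s : R) : lo < s -> Rbar_lt s hi -> phi s = phi_of a b (p_of a b u) (z_of a b u) s.
Proof.
  intros H1 H2. destruct (sol_speed s H1 H2) as (_ & _ & _ & E).
  unfold phi_of. cbv zeta. rewrite <- E, ln_exp. field.
Qed.

Lemma sol_u (s : R) : lo < s -> Rbar_lt s hi -> u s = u_of a b (p_of a b u) s.
Proof. intros H1 H2. now destruct (sol_p_q s H1 H2) as (_ & _ & E & _). Qed.

Lemma sol_phi_derive (s : R) : lo < s -> Rbar_lt s hi ->
  let x := s + shift a b in let p := p_of a b u x in
  is_derive phi s (- (x / (p * (p + 2 * x)))).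
Proof.
  intros H1 H2 x p. destruct (sol_p_q s H1 H2) as (Hp & Hq & Eu & Euu).
  destruct (sol s H1 H2) as (_ & _ & _ & _ & Hd).
  rewrite (is_derive_unique _ _ _ (is_derive_u0 a b s)), Euu, (u0_shift a b s ha) in Hd.
  fold x in Hd, Hp, Hq. fold p in Hd, Hp, Hq.
  pose proof (slope_pos a ha) as Hk.
  replace (- (x / (p * (p + 2 * x)))) with
    (- (slope a * x * slope a / (slope a ^ 2 * (p * (p + 2 * x))))) by (field; lra).
  exact Hd.
Qed.

(** Differentiability of [z] is extracted from the equation itself: near [s] the derivative of [u]
    coincides with [W], an expression in the differentiable functions [u], [phi] and [u0].
    Differentiating [W] gives [zfield]. *)
Lemma sol_reduced (s : R) : lo < s -> Rbar_lt s hi ->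
  reduced_at (p_of a b u) (z_of a b u) (s + shift a b).
Proof.
  intros H1 H2. destruct (sol_p_q s H1 H2) as (Hp & Hq & Eu & Euu).
  destruct (sol_speed s H1 H2) as (Ed & Ez & Hz & Ee).
  pose proof (sol_phi_derive s H1 H2) as Hphi. cbv zeta in *.
  destruct (sol s H1 H2) as (_ & _ & Huu & Hdu & _).
  pose proof (slope_pos a ha) as Hk.
  set (x := s + shift a b) in *. set (p := p_of a b u) in *. set (z := z_of a b u) in *.
  assert (Hxs : x + - shift a b = s) by (unfold x; ring).
  apply is_derive_unique in Hdu as Hdu'.
  refine (conj Hp (conj Hq (conj Hz (conj _ _)))).
  - unfold p, p_of. evar_last.
    + apply is_derive_Rminus; [|apply is_derive_id].
      unfold Rdiv. apply (is_derive_scal_l (K := R_AbsRing) (V := R_NormedModule)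
        (fun x => u (x - shift a b)) x (Derive u s) (/ slope a)).
      apply (is_derive_shift u (- shift a b)). rewrite Hxs, Hdu'. exact Hdu.
    + unfold z, z_of, x. replace (s + shift a b - shift a b) with s by ring.
      unfold minus, plus, opp, scal, one; simpl. unfold mult; simpl. reflexivity.
  - set (W := fun s => 2 * exp (6 * s) * exp (4 * phi s) / (u s ^ 2 - u0 a b s ^ 2)).
    set (dW := W s * (6 + 4 * - (x / (p x * (p x + 2 * x)))
              - (2 * u s * Derive u s - 2 * u0 a b s * slope a) / (u s ^ 2 - u0 a b s ^ 2))).
    assert (HW : is_derive W s dW).
    { unfold dW, W. evar_last.
      - apply (is_derive_div (fun s => 2 * exp (6 * s) * exp (4 * phi s))
                 (fun s => u s ^ 2 - u0 a b s ^ 2)); [| |lra].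
        + apply (Derive.is_derive_mult (fun s => 2 * exp (6 * s)) (fun s => exp (4 * phi s))).
          * instantiate (1 := 2 * (6 * exp (6 * s))). auto_derive; [easy|ring].
          * apply (is_derive_comp exp (fun s => 4 * phi s)).
            -- apply is_derive_Reals, derivable_pt_lim_exp.
            -- apply is_derive_scal, Hphi.
        + apply is_derive_Rminus.
          * apply is_derive_pow. exact Hdu.
          * apply is_derive_pow, is_derive_u0.
      - unfold minus, plus, opp, scal; simpl. unfold mult; simpl. rewrite Hdu'. field.
        repeat split; lra. }
    apply is_derive_ext_loc with (f := fun y => W (y + - shift a b) * / slope a - 1).
    { assert (Hl : locally x (fun y => lo < y + - shift a b /\ Rbar_lt (y + - shift a b) hi)).
      { assert (Hc : continuous (fun y => y + - shift a b) x).
        { apply (continuous_plus (V := R_NormedModule)); [apply continuous_id|apply continuous_const]. }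
        apply filter_and.
        - apply (Hc (fun y => lo < y)). rewrite Hxs. now apply open_gt.
        - apply (Hc (fun y => Rbar_lt y hi)). rewrite Hxs. now apply locally_lt_Rbar. }
      generalize Hl. apply filter_imp. intros y [Y1 Y2].
      destruct (sol_speed _ Y1 Y2) as (E & _). unfold z, z_of, W.
      change (y - shift a b) with (y + - shift a b). rewrite E. reflexivity. }
    evar_last.
    + apply is_derive_Rminus; [|apply is_derive_const].
      apply (is_derive_scal_l (K := R_AbsRing) (V := R_NormedModule)
        (fun y => W (y + - shift a b)) x dW (/ slope a)).
      apply (is_derive_shift W (- shift a b)). rewrite Hxs. exact HW.
    + unfold dW. change (W s) with (2 * exp (6 * s) * exp (4 * phi s) / (u s ^ 2 - u0 a b s ^ 2)).
      rewrite <- Ed, Euu, Ez, Eu, (u0_shift a b s ha). fold x.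
      unfold minus, plus, opp, scal, zero, zfield; simpl. unfold mult; simpl. field.
      repeat split; lra.
Qed.

End Reduction.

(** The equation for [u] holds because [phi_of] is obtained by solving it for [phi]. The equation
    for [phi] follows by logarithmic differentiation: after inserting [zfield], what remains is
    [- 2 / p + 2 / q = - 4 x / (p q)]. *)
Lemma solves_of_reduced (a b lo : R) (hi : Rbar) (p z : R -> R) :
  0 < a ->
  (forall s, lo < s -> Rbar_lt s hi -> reduced_at p z (s + shift a b)) ->
  solves_on a b lo hi (u_of a b p) (phi_of a b p z).
Proof.
  intros Ha Hred s H1 H2. destruct (Hred s H1 H2) as (Hp & Hq & Hz & Dp & Dz).
  pose proof (slope_pos a Ha) as Hk.
  set (x := s + shift a b) in *.
  assert (Du : is_derive (u_of a b p) s (slope a * (1 + z x))).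
  { unfold u_of. apply is_derive_scal. evar_last.
    - apply is_derive_Rplus.
      + apply is_derive_shift, Dp.
      + apply (is_derive_shift (fun x => x)), (is_derive_id (K := R_AbsRing)).
    - unfold plus, one; simpl. ring. }
  assert (Euu : u_of a b p s ^ 2 - u0 a b s ^ 2 = slope a ^ 2 * (p x * (p x + 2 * x))).
  { unfold u_of. rewrite (u0_shift a b s Ha). fold x. ring. }
  assert (Hpq : 0 < p x * (p x + 2 * x)) by (apply Rmult_lt_0_compat; lra).
  assert (Hk2 : 0 < slope a ^ 2) by now apply pow_lt.
  assert (Hk3 : 0 < slope a ^ 3) by now apply pow_lt.
  pose proof (exp_pos (6 * s)) as He.
  assert (HN : 0 < slope a ^ 3 * (1 + z x) * (p x * (p x + 2 * x))).
  { apply Rmult_lt_0_compat; [apply Rmult_lt_0_compat|]; lra. }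
  refine (conj _ (conj _ (conj _ (conj _ _)))).
  - unfold u_of. fold x. apply Rmult_lt_0_compat; lra.
  - rewrite (is_derive_unique _ _ _ Du). apply Rmult_lt_0_compat; lra.
  - rewrite Euu. apply Rmult_lt_0_compat; lra.
  - rewrite Euu, V_sqr. unfold phi_of. cbv zeta. fold x.
    rewrite <- Rmult_assoc, Rinv_r, Rmult_1_l by lra.
    rewrite exp_ln by (apply Rdiv_lt_0_compat; lra).
    replace (_ / _) with (slope a * (1 + z x)); [exact Du|].
    field. repeat split; try lra.
  - rewrite (is_derive_unique _ _ _ (is_derive_u0 a b s)), Euu, (u0_shift a b s Ha). fold x.
    unfold phi_of. cbv zeta.
    assert (DN : is_derive (fun s => slope a ^ 3 * (1 + z (s + shift a b)) *
       (p (s + shift a b) * (p (s + shift a b) + 2 * (s + shift a b))) / (2 * exp (6 * s))) s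
       (slope a ^ 3 * (1 + z x) * (p x * (p x + 2 * x)) / (2 * exp (6 * s)) *
        (zfield (p x) (p x + 2 * x) (z x) / (1 + z x) + z x / p x + (z x + 2) / (p x + 2 * x) - 6))).
    { apply is_derive_shift in Dp, Dz. evar_last.
      - apply (is_derive_div (fun s => slope a ^ 3 * (1 + z (s + shift a b)) *
           (p (s + shift a b) * (p (s + shift a b) + 2 * (s + shift a b))))
           (fun s => 2 * exp (6 * s))); [| |lra].
        + apply (Derive.is_derive_mult (fun s => slope a ^ 3 * (1 + z (s + shift a b)))
            (fun s => p (s + shift a b) * (p (s + shift a b) + 2 * (s + shift a b)))).
          * apply is_derive_scal.
            apply (is_derive_Rplus (fun _ => 1));
              [apply is_derive_const|exact Dz].
          * apply (Derive.is_derive_mult (fun s => p (s + shift a b))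
               (fun s => p (s + shift a b) + 2 * (s + shift a b))); [exact Dp|].
            apply is_derive_Rplus; [exact Dp|].
            apply is_derive_scal.
            apply (is_derive_shift (fun x => x)), (is_derive_id (K := R_AbsRing)).
        + instantiate (1 := 2 * (6 * exp (6 * s))). auto_derive; [easy|ring].
      - fold x. unfold plus, one, zero; simpl. field. repeat split; lra. }
    evar_last.
    + apply is_derive_scal. apply (is_derive_comp ln); [|exact DN].
      apply is_derive_Reals, derivable_pt_lim_ln. fold x. apply Rdiv_lt_0_compat; lra.
    + fold x. unfold scal, zfield; simpl. unfold mult; simpl. field. repeat split; lra.
Qed.

(** * Extension of reduced solutions to the half-line *)

Lemma reduced_at_ext (p z p' z' : R -> R) (x : R) :
  locally x (fun y => p y = p' y /\ z y = z' y) -> reduced_at p z x -> reduced_at p' z' x.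
Proof.
  intros Hl (H1 & H2 & H3 & H4 & H5).
  destruct (locally_singleton _ _ Hl) as [E1 E2].
  unfold reduced_at. rewrite <- E1, <- E2.
  refine (conj H1 (conj H2 (conj H3 (conj _ _)))).
  - apply is_derive_ext_loc with p; [|exact H4]. revert Hl. apply filter_imp. tauto.
  - apply is_derive_ext_loc with z; [|exact H5]. revert Hl. apply filter_imp. tauto.
Qed.

(** At any interior point [t0] the data satisfy [z > 0] and [p >= c / 3 > 1 / 3], so [continuation]
    applies from there, and [uniqueness] identifies the two solutions on their overlap. *)
Lemma reduced_extension (c : R) (X : Rbar) (p z : R -> R) :
  1 < c -> singular_start c p z -> Rbar_lt (- c / 6) X ->
  (forall x, - c / 6 < x -> Rbar_lt x X -> reduced_at p z x) ->
  exists P Z : R -> R, (forall x, - c / 6 < x -> reduced_at P Z x) /\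
    forall x, - c / 6 < x -> Rbar_lt x X -> P x = p x /\ Z x = z x.
Proof.
  intros Hc Hs HX Hred.
  assert (Ht0 : exists t0, - c / 6 < t0 /\ Rbar_lt t0 X).
  { destruct X as [X| |]; simpl in HX |- *.
    - exists ((- c / 6 + X) / 2). split; lra.
    - exists 0. split; [lra|easy].
    - easy. }
  destruct Ht0 as (t0 & Ht0 & Ht0X).
  assert (Hle : forall x y, y <= x -> Rbar_lt x X -> Rbar_lt y X).
  { intros x y Hxy Hx. now apply Rbar_le_lt_trans with x. }
  assert (Hpz : 0 < z t0 /\ c / 3 <= p t0).
  { apply z_positive; try easy. intros y Hy. apply Hred; [lra|]. apply Hle with t0; [lra|easy]. }
  destruct (Hred t0 Ht0 Ht0X) as (Hp0 & Hq0 & _).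
  destruct (continuation t0 (p t0) (z t0)) as (P & Z & EP & EZ & HcP & HcZ & HR); try lra.
  assert (Heq : forall x, t0 <= x -> Rbar_lt x X -> P x = p x /\ Z x = z x).
  { intros x Hx HxX. destruct (uniqueness p z P Z t0 x) as [E1 E2]; try easy.
    - intros y Hy. apply reduced_continuity, Hred; [lra|]. apply Hle with x; [lra|easy].
    - intros y Hy. apply Hred; [lra|]. apply Hle with x; [lra|easy].
    - intros y Hy. apply HR. lra. }
  (* Because of the overlap, the glued functions agree with the old solution on a full neighbourhood
     of [t0], so the equations also hold at the gluing point. *)
  set (Pg := fun x => if Rle_dec x t0 then p x else P x).
  set (Zg := fun x => if Rle_dec x t0 then z x else Z x).
  assert (Hg : forall x, - c / 6 < x -> Rbar_lt x X -> Pg x = p x /\ Zg x = z x).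
  { intros x Hx HxX. unfold Pg, Zg. destruct (Rle_dec x t0); [easy|].
    apply Heq; [lra|easy]. }
  exists Pg, Zg. split; [|exact Hg].
  intros x Hx. destruct (Rle_dec x t0) as [Hxt|Hxt].
  - apply (reduced_at_ext p z).
    + assert (HxX : Rbar_lt x X) by (now apply Hle with t0).
      generalize (filter_and _ _ (open_gt (- c / 6) x Hx) (locally_lt_Rbar x X HxX)).
      apply filter_imp. intros y [Y1 Y2]. destruct (Hg y Y1 Y2). now split.
    + apply Hred; [exact Hx|]. now apply Hle with t0.
  - apply (reduced_at_ext P Z); [|apply HR; lra].
    generalize (open_gt t0 x (Rnot_le_lt _ _ Hxt)). apply filter_imp. intros y Hy.
    unfold Pg, Zg. destruct (Rle_dec y t0); [lra|easy].
Qed.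

(** * Limits at the singular end and extension of squashed solutions *)

Lemma filterlim_Rplus {T : Type} (F : (T -> Prop) -> Prop) {FF : Filter F} (f g : T -> R) (x y : R) :
  filterlim f F (locally x) -> filterlim g F (locally y) ->
  filterlim (fun t => f t + g t) F (locally (x + y)).
Proof.
  intros Hf Hg. refine (filterlim_comp_2 _ _ Rplus Hf Hg _).
  apply (filterlim_plus (K := R_AbsRing) (V := R_NormedModule)).
Qed.

Lemma filterlim_Rmult {T : Type} (F : (T -> Prop) -> Prop) {FF : Filter F} (f g : T -> R) (x y : R) :
  filterlim f F (locally x) -> filterlim g F (locally y) ->
  filterlim (fun t => f t * g t) F (locally (x * y)).
Proof.
  intros Hf Hg. refine (filterlim_comp_2 _ _ Rmult Hf Hg _).
  apply (filterlim_mult (K := R_AbsRing)).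
Qed.

Lemma filterlim_continuity_pt {T : Type} (F : (T -> Prop) -> Prop) {FF : Filter F}
    (f : T -> R) (h : R -> R) (x : R) :
  continuity_pt h x -> filterlim f F (locally x) ->
  filterlim (fun t => h (f t)) F (locally (h x)).
Proof.
  intros Hh Hf. apply (filterlim_comp _ _ _ f h F (locally x)); [exact Hf|].
  now apply continuous_pt.
Qed.

Lemma filterlim_Rdiv {T : Type} (F : (T -> Prop) -> Prop) {FF : Filter F} (f g : T -> R) (x y : R) :
  y <> 0 -> filterlim f F (locally x) -> filterlim g F (locally y) ->
  filterlim (fun t => f t / g t) F (locally (x / y)).
Proof.
  intros Hy Hf Hg. apply filterlim_Rmult; [exact FF | exact Hf|].
  apply (filterlim_continuity_pt F g Rinv); [|exact Hg].
  apply continuity_pt_inv; [apply derivable_continuous_pt, derivable_pt_id | exact Hy].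
Qed.

Lemma at_right_shift (x : R) : filterlim (fun y => y - x) (at_right x) (at_right 0).
Proof.
  intros P [d Hd]. exists d. intros y Hy Hxy. apply Hd; [|lra].
  apply Rabs_lt_between' in Hy. apply Rabs_lt_between'. simpl in *. lra.
Qed.

Lemma u_c_sqr (a b c s : R) : 0 < a ->
  u_c a b c s ^ 2 - u0 a b s ^ 2 = slope a ^ 2 * (c / 3 * (2 * (s - s_sing a b c))).
Proof. intros Ha. unfold u_c, u0, s_sing, slope. field. lra. Qed.

(** With [t] the distance to the singular end, the expansion gives [p = c / 3 + t ^ 2 X / k] and
    [q = t (2 + t X / k)]. In the formula for [1 + z] the factor [t] of [q] cancels against the one
    in [exp (4 phi_c)], which leaves expressions with limits as [t] tends to 0. *)
Lemma squashed_singular_start (a b c : R) (hi : Rbar) (u phi : R -> R) :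
  0 < a -> 0 < c -> Rbar_lt (s_sing a b c) hi ->
  squashed_solution_pos a b c hi u phi ->
  singular_start c (p_of a b u) (z_of a b u).
Proof.
  intros Ha Hc Hhi [Hsol (eps & X & Y & Heps & HX & HY & HXY)].
  pose proof (slope_pos a Ha) as Hk.
  destruct (HX 0%nat) as [_ [lX LX]]. destruct (HY 0%nat) as [_ [lY LY]].
  change (Derive_n X 0) with X in LX. change (Derive_n Y 0) with Y in LY.
  set (sc := s_sing a b c) in *.
  assert (Hxc : sc + shift a b = - c / 6) by now apply s_sing_shift.
  assert (Hid : filterlim (fun t : R => t) (at_right 0) (locally 0))
    by (apply filter_le_within).
  assert (Hnear : exists e, 0 < e <= eps /\ forall t, 0 < t < e -> Rbar_lt (sc + t) hi).
  { destruct hi as [h| |]; simpl in Hhi |- *.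
    - exists (Rmin eps (h - sc)). repeat split; [apply Rmin_glb_lt; lra|apply Rmin_l|].
      intros t Ht. pose proof (Rmin_r eps (h - sc)). lra.
    - exists eps. repeat split; lra.
    - easy. }
  destruct Hnear as (e & He & Hehi).
  set (P := fun t => c / 3 + t ^ 2 * X t / slope a).
  assert (HP : filterlim P (at_right 0) (locally (c / 3))).
  { replace (c / 3) with (c / 3 + 0 ^ 2 * lX / slope a) by (field; lra).
    apply filterlim_Rplus; [typeclasses eauto | apply filterlim_const|].
    apply filterlim_Rdiv; [typeclasses eauto | lra | | apply filterlim_const].
    apply filterlim_Rmult; [typeclasses eauto | | exact LX].
    apply (filterlim_continuity_pt (at_right 0) (fun t => t) (fun v => v ^ 2)); [|exact Hid].
    apply derivable_continuous_pt, derivable_pt_pow. }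
  set (Z := fun t => exp (4 * (t * Y t)) * (2 * c / 3) / (P t * (2 + t * X t / slope a)) - 1).
  assert (HZ : filterlim Z (at_right 0) (locally 0)).
  { replace 0 with (exp (4 * (0 * lY)) * (2 * c / 3) / (c / 3 * (2 + 0 * lX / slope a)) + - (1)) at 2.
    2: { replace (4 * (0 * lY)) with 0 by ring. rewrite exp_0. field. lra. }
    apply filterlim_Rplus; [typeclasses eauto | | apply filterlim_const].
    apply filterlim_Rdiv; [typeclasses eauto | | |].
    - apply Rgt_not_eq. unfold Rdiv. rewrite Rmult_0_l, Rmult_0_l. lra.
    - apply filterlim_Rmult; [typeclasses eauto | | apply filterlim_const].
      apply (filterlim_continuity_pt (at_right 0) (fun t => 4 * (t * Y t)) exp).
      + apply derivable_continuous_pt, derivable_pt_exp.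
      + apply filterlim_Rmult; [typeclasses eauto | apply filterlim_const|].
        apply filterlim_Rmult; [typeclasses eauto | exact Hid | exact LY].
    - apply filterlim_Rmult; [typeclasses eauto | exact HP|].
      apply filterlim_Rplus; [typeclasses eauto | apply filterlim_const|].
      apply filterlim_Rdiv; [typeclasses eauto | lra | | apply filterlim_const].
      apply filterlim_Rmult; [typeclasses eauto | exact Hid | exact LX]. }
  assert (Hval : forall t, 0 < t < e ->
     p_of a b u (t - c / 6) = P t /\ z_of a b u (t - c / 6) = Z t).
  { intros t Ht. destruct (HXY t ltac:(lra)) as [Eu Ephi]. fold sc in Eu, Ephi.
    assert (Hs1 : sc < sc + t) by lra. pose proof (Hehi t Ht) as Hs2.
    assert (Hx : sc + t + shift a b = t - c / 6) by lra.
    destruct (sol_p_q a b sc hi u phi Ha Hsol (sc + t) Hs1 Hs2) as (Hp & Hq & Eu' & _).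
    destruct (sol_speed a b sc hi u phi Ha Hsol (sc + t) Hs1 Hs2) as (_ & _ & Hz & Ee).
    rewrite Hx in *. cbv zeta in *.
    assert (EP : p_of a b u (t - c / 6) = P t).
    { apply Rmult_eq_reg_l with (slope a); [|lra].
      apply Rplus_eq_reg_r with (slope a * (t - c / 6)).
      rewrite <- Rmult_plus_distr_l, <- Eu', Eu. unfold u_c.
      rewrite (u0_shift a b _ Ha), Hx. unfold P, slope. field. lra. }
    split; [exact EP|].
    rewrite Ephi in Ee. unfold phi_c in Ee. rewrite (u_c_sqr a b c _ Ha) in Ee. fold sc in Ee.
    replace (sc + t - sc) with t in Ee by ring.
    rewrite Rmult_plus_distr_l, <- Rmult_assoc, Rinv_r, Rmult_1_l, exp_plus in Ee by lra.
    assert (H2 : 0 < slope a ^ 2) by now apply pow_lt.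
    pose proof (exp_pos (6 * (sc + t))) as Hexp.
    assert (Hct : 0 < slope a ^ 2 * (c / 3 * (2 * t))).
    { apply Rmult_lt_0_compat; [lra|]. apply Rmult_lt_0_compat; lra. }
    rewrite exp_ln in Ee.
    2: { apply Rdiv_lt_0_compat; [|lra]. fold (slope a). now apply Rmult_lt_0_compat. }
    fold (slope a) in Ee.
    assert (Hqt : p_of a b u (t - c / 6) + 2 * (t - c / 6) = t * (2 + t * X t / slope a)).
    { rewrite EP. unfold P. field. lra. }
    rewrite Hqt, EP in *.
    assert (H2X : 0 < 2 + t * X t / slope a).
    { apply Rmult_lt_reg_l with t; [lra|]. lra. }
    unfold Z. set (q2 := 2 + t * X t / slope a) in *.
    (* Two expressions for [exp (4 phi)], from the expansion and from the reduced variables, are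
       equated and freed of their common positive factor, which contains [t]. *)
    assert (E1 : exp (4 * (t * Y t)) * (2 * c / 3) = (1 + z_of a b u (t - c / 6)) * (P t * q2)).
    { apply Rmult_eq_reg_l with (slope a ^ 3 * t / (2 * exp (6 * (sc + t)))).
      - transitivity (slope a * (slope a ^ 2 * (c / 3 * (2 * t))) / (2 * exp (6 * (sc + t)))
                      * exp (4 * (t * Y t))); [field; lra|].
        rewrite Ee. field. lra.
      - apply Rgt_not_eq. apply Rdiv_lt_0_compat; [|lra].
        apply Rmult_lt_0_compat; [now apply pow_lt|lra]. }
    rewrite E1. field. split; lra. }
  assert (Hev : at_right (- c / 6) (fun x =>
     P (x - - c / 6) = p_of a b u x /\ Z (x - - c / 6) = z_of a b u x)).
  { assert (Hr : forall y : R, y - - c / 6 - c / 6 = y) by (intros; field).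
    assert (He0 : 0 < e) by lra. exists (mkposreal e He0). intros x Hx Hxc'.
    apply Rabs_lt_between' in Hx. simpl in Hx.
    destruct (Hval (x - - c / 6) ltac:(lra)) as [E1 E2].
    rewrite (Hr x) in E1, E2. now split. }
  split.
  - apply (filterlim_ext_loc (fun x => P (x - - c / 6))).
    + revert Hev. apply filter_imp. tauto.
    + apply (filterlim_comp _ _ _ (fun x => x - - c / 6) P _ (at_right 0)); [apply at_right_shift|exact HP].
  - apply (filterlim_ext_loc (fun x => Z (x - - c / 6))).
    + revert Hev. apply filter_imp. tauto.
    + apply (filterlim_comp _ _ _ (fun x => x - - c / 6) Z _ (at_right 0)); [apply at_right_shift|exact HZ].
Qed.

Lemma squashed_reduced (a b c : R) (hi : Rbar) (u phi : R -> R) (x : R) :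
  0 < a -> squashed_solution_pos a b c hi u phi ->
  - c / 6 < x -> Rbar_lt (x - shift a b) hi ->
  reduced_at (p_of a b u) (z_of a b u) x.
Proof.
  intros Ha [Hsol _] Hx Hhi. pose proof (s_sing_shift a b c Ha) as Hs.
  replace x with (x - shift a b + shift a b) by ring.
  apply (sol_reduced a b (s_sing a b c) hi u phi Ha Hsol); [lra | exact Hhi].
Qed.

(** The expansion at the singular end concerns only a right neighbourhood of it, where the extension
    agrees with the given solution; [eps] is shrunk to stay below [hi]. *)
Lemma squashed_ext (a b c : R) (hi : Rbar) (u phi U Phi : R -> R) :
  Rbar_lt (s_sing a b c) hi ->
  squashed_solution_pos a b c hi u phi ->
  solves_on a b (s_sing a b c) p_infty U Phi ->
  (forall s, s_sing a b c < s -> Rbar_lt s hi -> U s = u s /\ Phi s = phi s) ->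
  squashed_solution_pos a b c p_infty U Phi.
Proof.
  intros Hhi [_ (eps & X & Y & Heps & HX & HY & HXY)] Hsol Heq.
  split; [exact Hsol|].
  assert (Hnear : exists e, 0 < e <= eps /\ forall t, 0 < t < e -> Rbar_lt (s_sing a b c + t) hi).
  { destruct hi as [h| |]; simpl in Hhi |- *.
    - exists (Rmin eps (h - s_sing a b c)).
      repeat split; [apply Rmin_glb_lt; lra|apply Rmin_l|].
      intros t Ht. pose proof (Rmin_r eps (h - s_sing a b c)). lra.
    - exists eps. repeat split; lra.
    - easy. }
  destruct Hnear as (e & He & Hehi).
  assert (Hsm : forall f, smooth_up_to_0 eps f -> smooth_up_to_0 e f).
  { intros f Hf n. destruct (Hf n) as [H1 H2]. split; [|exact H2].
    intros t Ht. apply H1. lra. }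
  exists e, X, Y. split; [lra|]. split; [now apply Hsm|]. split; [now apply Hsm|].
  intros t Ht. cbv zeta. destruct (Heq (s_sing a b c + t)) as [-> ->]; [lra | now apply Hehi|].
  apply HXY. lra.
Qed.

Lemma squashed_extension (a b c : R) (hi : Rbar) (u phi : R -> R) :
  0 < a -> 1 < c -> Rbar_lt (s_sing a b c) hi ->
  squashed_solution_pos a b c hi u phi ->
  exists U Phi, squashed_solution_pos a b c p_infty U Phi /\
    forall s, s_sing a b c < s -> Rbar_lt s hi -> U s = u s /\ Phi s = phi s.
Proof.
  intros Ha Hc Hhi Hsq. pose proof (s_sing_shift a b c Ha) as Hs.
  set (X := Rbar_plus hi (shift a b)).
  assert (HX : forall s : R, Rbar_lt s hi <-> Rbar_lt (s + shift a b) X).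
  { intros s. unfold X. destruct hi as [h| |]; simpl; try tauto. split; intros; lra. }
  destruct (reduced_extension c X (p_of a b u) (z_of a b u) Hc) as (P & Z & HR & HE).
  - apply (squashed_singular_start a b c hi u phi); try easy. lra.
  - rewrite <- Hs. now apply HX.
  - intros x Hx1 Hx2. apply (squashed_reduced a b c hi u phi); try easy.
    apply HX. now replace (x - shift a b + shift a b) with x by ring.
  - assert (Hsol : solves_on a b (s_sing a b c) p_infty (u_of a b P) (phi_of a b P Z)).
    { apply solves_of_reduced; [exact Ha|]. intros s Hs1 _. apply HR. lra. }
    assert (Heq : forall s, s_sing a b c < s -> Rbar_lt s hi ->
              u_of a b P s = u s /\ phi_of a b P Z s = phi s).
    { intros s Hs1 Hs2. destruct (HE (s + shift a b)) as [E1 E2]; [lra | now apply HX|].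
      destruct Hsq as [Hsol' _].
      rewrite (sol_u a b _ hi u phi Ha Hsol' s Hs1 Hs2) at 1.
      rewrite (sol_phi a b _ hi u phi Ha Hsol' s Hs1 Hs2).
      unfold u_of, phi_of. cbv zeta. now rewrite E1, E2. }
    exists (u_of a b P), (phi_of a b P Z). split; [|exact Heq].
    now apply (squashed_ext a b c hi u phi).
Qed.

(** * Asymptotics of the global solutions *)

Notation at_infinity := (Rbar_locally' p_infty).

Lemma filterlim_shift_infinity (c : R) : filterlim (fun s => s + c) at_infinity at_infinity.
Proof. intros P [M HM]. exists (M - c). intros s Hs. apply HM. lra. Qed.

Lemma squeeze_zero (f g : R -> R) (S0 : R) :
  (forall s, S0 < s -> 0 <= f s <= g s) ->
  filterlim g at_infinity (locally 0) -> is_lim f p_infty 0.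
Proof.
  intros H Hg. apply is_lim_spec. intros eps.
  assert (Hg' : is_lim g p_infty 0) by exact Hg.
  apply is_lim_spec in Hg'. destruct (Hg' eps) as [M HM].
  exists (Rmax S0 M). intros s Hs.
  pose proof (Rmax_l S0 M). pose proof (Rmax_r S0 M).
  specialize (H s ltac:(lra)). specialize (HM s ltac:(lra)). apply Rabs_def2 in HM.
  apply Rabs_def1; lra.
Qed.

(** The quotient is [u0 / u]. Half of the exponential growth of [p] absorbs the factor [x], through
    [x <= (2 / f) exp (f x / 2)], and the other half gives the decay. *)
Lemma ratio_vanishes (p z : R -> R) (x1 : R) :
  0 < x1 -> 1 / 3 < p x1 ->
  (forall x, x1 <= x -> reduced_at p z x) -> (forall x, x1 <= x -> 0 < z x) ->
  filterlim (fun x => x / (p x + x)) at_infinity (locally 0).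
Proof.
  intros Hx1 Hp1 Hred Hz.
  destruct (exponential_growth p z x1 Hx1 Hp1 Hred Hz) as [f [Hf Hg]].
  set (C := 2 / f * exp (f * x1) / p x1).
  apply (squeeze_zero _ (fun x => C * exp (- (f / 2 * x))) x1).
  - intros x Hx. specialize (Hg x ltac:(lra)).
    destruct (Hred x ltac:(lra)) as (Hp & _).
    split; [apply Rle_mult_inv_pos; lra|].
    apply Rle_trans with (x / p x).
    { apply Rmult_le_compat_l; [lra|]. apply Rinv_le_contravar; lra. }
    pose proof (exp_pos (f / 2 * x)) as He. pose proof (exp_pos (f * x1)).
    assert (Hxe : x <= 2 / f * exp (f / 2 * x)).
    { pose proof (exp_ineq1_le (f / 2 * x)).
      apply Rmult_le_reg_l with (f / 2); [lra|].
      replace (f / 2 * (2 / f * exp (f / 2 * x))) with (exp (f / 2 * x)) by (field; lra). lra. }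
    assert (Hinv : / p x <= / p x1 * exp (f * x1) * (exp (- (f / 2 * x)) * exp (- (f / 2 * x)))).
    { rewrite <- exp_plus.
      replace (- (f / 2 * x) + - (f / 2 * x)) with (- (f * x)) by field.
      rewrite Rmult_assoc, <- exp_plus.
      replace (f * x1 + - (f * x)) with (- (f * (x - x1))) by ring.
      rewrite exp_Ropp, <- Rinv_mult. apply Rinv_le_contravar; [|exact Hg].
      apply Rmult_lt_0_compat; [lra|apply exp_pos]. }
    unfold Rdiv at 1.
    apply Rle_trans with (2 / f * exp (f / 2 * x) *
      (/ p x1 * exp (f * x1) * (exp (- (f / 2 * x)) * exp (- (f / 2 * x))))).
    + apply Rmult_le_compat; [lra | apply Rlt_le, Rinv_0_lt_compat; lra | exact Hxe | exact Hinv].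
    + right. unfold C. rewrite exp_Ropp. field. repeat split; lra.
  - apply (is_lim_spec _ p_infty 0). intros eps.
    destruct (exp_decay (f / 2) C eps ltac:(lra) (cond_pos eps)) as [X HX].
    exists X. intros x Hx. rewrite Rminus_0_r. now apply HX.
Qed.

Lemma ex_derive_n_exp_shift (c s : R) (n : nat) : ex_derive_n (fun s => exp (s + c)) n s.
Proof.
  assert (HD : forall n s, Derive_n (fun s => exp (s + c)) n s = exp (s + c)).
  { clear. induction n as [|n IH]; intros s; [reflexivity|].
    simpl. rewrite (Derive_ext _ _ _ IH). apply is_derive_unique. auto_derive; [easy|ring]. }
  destruct n as [|n]; [exact I|]. simpl.
  apply ex_derive_ext with (fun s => exp (s + c)); [intros; now rewrite HD|].
  auto_derive. easy.
Qed.

Lemma exp_INR_mult (n : nat) (x : R) : exp (INR n * x) = exp x ^ n.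
Proof.
  induction n as [|n IH]; [rewrite Rmult_0_l; apply exp_0|].
  rewrite S_INR, Rmult_plus_distr_r, Rmult_1_l, exp_plus, IH. simpl. ring.
Qed.

(** For positive [w] the cofactor [w ^ 2 + w + 1] exceeds 1, so [|w - 1| <= |w ^ 3 - 1|]. *)
Lemma cube_root_limit (w : R -> R) :
  (exists S0, forall s, S0 < s -> 0 < w s) ->
  filterlim (fun s => w s ^ 3) at_infinity (locally 1) ->
  filterlim w at_infinity (locally 1).
Proof.
  intros [S0 Hpos] H.
  apply (is_lim_spec w p_infty 1). intros eps.
  destruct (proj2 (is_lim_spec (fun s => w s ^ 3) p_infty 1) H eps) as [M HM].
  exists (Rmax S0 M). intros s Hs.
  pose proof (Rmax_l S0 M). pose proof (Rmax_r S0 M).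
  specialize (Hpos s ltac:(lra)). specialize (HM s ltac:(lra)).
  eapply Rle_lt_trans; [|exact HM].
  replace (w s ^ 3 - 1) with ((w s - 1) * (w s ^ 2 + w s + 1)) by ring.
  rewrite Rabs_mult, (Rabs_right (w s ^ 2 + w s + 1)) by nra.
  pose proof (Rabs_pos (w s - 1)). nra.
Qed.

Section Global.

Context (a b c : R) (U Phi : R -> R) (ha : 0 < a) (hc : 1 < c).
Context (sq : squashed_solution_pos a b c p_infty U Phi).

Let sc := s_sing a b c.
Let p := p_of a b U.
Let z := z_of a b U.

Lemma global_reduced (x : R) : - c / 6 < x -> reduced_at p z x.
Proof. intros Hx. now apply (squashed_reduced a b c p_infty U Phi). Qed.

Lemma global_positive (x : R) : - c / 6 < x -> 0 < z x /\ c / 3 <= p x.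
Proof.
  intros Hx. apply (z_positive c); try easy.
  - apply (squashed_singular_start a b c p_infty U Phi); try easy. lra.
  - intros y Hy. apply global_reduced. lra.
Qed.

Lemma global_shift (s : R) : sc < s -> - c / 6 < s + shift a b.
Proof. intros Hs. pose proof (s_sing_shift a b c ha). fold sc in H. lra. Qed.

Lemma global_phi_limit : exists l : R, filterlim Phi at_infinity (locally l).
Proof.
  destruct sq as [Hsol _].
  assert (Hred : forall x, 1 <= x -> reduced_at p z x) by (intros; apply global_reduced; lra).
  assert (Hz : forall x, 1 <= x -> 0 < z x) by (intros; apply global_positive; lra).
  destruct (dilaton_limit p z (fun x => Phi (x + - shift a b)) 1) as [l Hl]; try easy; try lra.
  - destruct (global_positive 1); lra.
  - intros x Hx. apply is_derive_shift.
    pose proof (s_sing_shift a b c ha) as Hs. fold sc in Hs.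
    pose proof (sol_phi_derive a b sc p_infty U Phi ha Hsol (x + - shift a b) ltac:(lra) I) as Hd.
    cbv zeta in Hd. now replace (x + - shift a b + shift a b) with x in Hd by ring.
  - exists l.
    apply (filterlim_ext (fun s => Phi (s + shift a b + - shift a b))).
    { intros s. f_equal. ring. }
    apply (filterlim_comp _ _ _ (fun s => s + shift a b) (fun x => Phi (x + - shift a b))
             _ at_infinity); [apply filterlim_shift_infinity | exact Hl].
Qed.

Lemma global_ratio : filterlim (fun s => u0 a b s / U s) at_infinity (locally 0).
Proof.
  destruct sq as [Hsol _].
  assert (Hr : filterlim (fun x => x / (p x + x)) at_infinity (locally 0)).
  { apply (ratio_vanishes p z 1); try lra.
    - destruct (global_positive 1); lra.
    - intros; apply global_reduced; lra.
    - intros; apply global_positive; lra. }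
  apply (filterlim_ext_loc (fun s => (s + shift a b) / (p (s + shift a b) + (s + shift a b)))).
  - exists sc. intros s Hs.
    destruct (sol_p_q a b sc p_infty U Phi ha Hsol s Hs I) as (H1 & H2 & -> & _).
    rewrite (u0_shift a b s ha). fold p in H1, H2 |- *. pose proof (slope_pos a ha).
    field. split; lra.
  - apply (filterlim_comp _ _ _ (fun s => s + shift a b) (fun x => x / (p x + x)) _ at_infinity);
      [apply filterlim_shift_infinity | exact Hr].
Qed.

Lemma global_u_positive (s : R) : sc < s -> 0 < U s /\ - U s < u0 a b s < U s.
Proof.
  intros Hs. destruct sq as [Hsol _].
  destruct (Hsol s Hs I) as (Hu & _ & Huu & _).
  split; [exact Hu|]. split; nra.
Qed.

(** With [r = exp (s + 2 l / 3)] one has [r ^ 6 = exp (6 s + 4 l)], so the first limit follows from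
    that of [U ^ 3 exp (- 6 s)]. The second is then read off from the equation for [U'], using
    [u0 / U -> 0] again. *)
Lemma global_cone_factor (l : R) :
  filterlim Phi at_infinity (locally l) ->
  filterlim (fun s => U s / exp (s + 2 * l / 3) ^ 2) at_infinity (locally 1) /\
  filterlim (fun s => Derive U s / 2 / exp (s + 2 * l / 3) ^ 2) at_infinity (locally 1).
Proof.
  intros Hl. destruct sq as [Hsol _].
  set (rho := fun s => u0 a b s / U s).
  pose proof global_ratio as Hrho. fold rho in Hrho.
  assert (Hk : forall v : R, filterlim (fun _ : R => v) at_infinity (locally v))
    by (intros; apply filterlim_const).
  assert (H1 : filterlim (fun s => 1 - rho s * rho s) at_infinity (locally 1)).
  { replace 1 with (1 + - (0 * 0)) at 1 by ring.
    apply filterlim_Rplus; [typeclasses eauto | apply Hk|].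
    apply (filterlim_continuity_pt at_infinity (fun s => rho s * rho s) Ropp).
    - apply continuity_pt_opp, derivable_continuous_pt, derivable_pt_id.
    - apply filterlim_Rmult; [typeclasses eauto | exact Hrho | exact Hrho]. }
  assert (Hexp : forall k, filterlim (fun s => exp (4 * Phi s + k)) at_infinity
                             (locally (exp (4 * l + k)))).
  { intros k. apply (filterlim_continuity_pt at_infinity (fun s => 4 * Phi s + k) exp).
    - apply derivable_continuous_pt, derivable_pt_exp.
    - apply filterlim_Rplus; [typeclasses eauto | | apply Hk].
      apply filterlim_Rmult; [typeclasses eauto | apply Hk | exact Hl]. }
  assert (Hr6 : forall s, exp (s + 2 * l / 3) ^ 6 = exp (6 * s) * exp (4 * l)).
  { intros s. rewrite <- exp_plus. replace (6 * s + 4 * l) with (INR 6 * (s + 2 * l / 3)).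
    - rewrite exp_INR_mult. reflexivity.
    - simpl. field. }
  set (w := fun s => U s / exp (s + 2 * l / 3) ^ 2).
  assert (Hw3 : filterlim (fun s => w s ^ 3) at_infinity (locally 1)).
  (* The equation gives [(U ^ 3)' = 3 U ^ 2 U' = 6 exp (6 s) exp (4 Phi) / (1 - rho ^ 2)], which is
     the form required by [lhopital_exp] with [k = 6]. *)
  { assert (Hlh : is_lim (fun s => U s ^ 3 * exp (- (6 * s))) p_infty (exp (4 * l + 0) / 1)).
    { apply (lhopital_exp (fun s => U s ^ 3) (fun s => exp (4 * Phi s + 0) / (1 - rho s * rho s))
               6 (sc + 1)); [lra| |].
      - intros s Hs. assert (Hs' : sc < s) by lra.
        destruct (Hsol s Hs' I) as (Hu & _ & Huu & Hd & _).
        evar_last; [apply is_derive_pow, Hd|].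
        rewrite V_sqr, Rplus_0_r. unfold rho. simpl INR. simpl Init.Nat.pred.
        field. repeat split; lra.
      - apply filterlim_Rdiv; [typeclasses eauto | lra | apply Hexp | exact H1]. }
    apply (filterlim_ext (fun s => U s ^ 3 * exp (- (6 * s)) * exp (- (4 * l)))).
    { intros s. unfold w.
      replace ((U s / exp (s + 2 * l / 3) ^ 2) ^ 3) with (U s ^ 3 / exp (s + 2 * l / 3) ^ 6).
      - rewrite Hr6, !exp_Ropp. pose proof (exp_pos (6 * s)). pose proof (exp_pos (4 * l)).
        field. lra.
      - pose proof (exp_pos (s + 2 * l / 3)). field. lra. }
    replace 1 with (exp (4 * l + 0) / 1 * exp (- (4 * l))).
    - apply filterlim_Rmult; [typeclasses eauto | exact Hlh | apply Hk].
    - rewrite Rplus_0_r, exp_Ropp. pose proof (exp_pos (4 * l)). field. lra. }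
  assert (Hw : filterlim w at_infinity (locally 1)).
  { apply cube_root_limit; [|exact Hw3]. exists sc. intros s Hs.
    destruct (global_u_positive s Hs) as [Hu _].
    apply Rdiv_lt_0_compat; [exact Hu|]. apply pow_lt, exp_pos. }
  split; [exact Hw|].
  apply (filterlim_ext_loc (fun s => exp (4 * Phi s + - (4 * l)) / (w s * w s * (1 - rho s * rho s)))).
  - exists sc. intros s Hs.
    destruct (sol_speed a b sc p_infty U Phi ha Hsol s Hs I) as (-> & _).
    destruct (Hsol s Hs I) as (Hu & _ & Huu & _).
    rewrite exp_plus, exp_Ropp. unfold w, rho.
    pose proof (exp_pos (4 * l)). pose proof (exp_pos (s + 2 * l / 3)).
    assert (E6 : exp (6 * s) = exp (s + 2 * l / 3) ^ 6 / exp (4 * l)).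
    { rewrite Hr6. field. lra. }
    rewrite E6. field. repeat split; lra.
  - replace 1 with (exp (4 * l + - (4 * l)) / (1 * 1 * 1)) at 1.
    + apply filterlim_Rdiv; [typeclasses eauto | lra | apply Hexp |].
      apply filterlim_Rmult; [typeclasses eauto | | exact H1].
      apply filterlim_Rmult; [typeclasses eauto | exact Hw | exact Hw].
    + replace (4 * l + - (4 * l)) with 0 by ring. rewrite exp_0. field.
Qed.

(** The differential equations are solved with positive [a], whereas [omega] contains [u0] for the
    original parameters; the two differ by the sign [sg]. A change of sign swaps the two sphere
    coefficients of the metric. *)
Context (alpha b0 sg : R) (hsg : sg = 1 \/ sg = -1).
Context (hu0 : forall s, u0 alpha b0 s = sg * u0 a b s).

(** Since [z > 0], the coefficient [U' / 2 = slope a (1 + z) / 2] of [ds ^ 2] is at least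
    [slope a / 2], so [s] is controlled by length. *)
Lemma global_complete (s1 : R) : sc < s1 -> complete_end (metric_sol alpha b0 U Phi) s1.
Proof.
  intros Hs1. destruct sq as [Hsol _]. pose proof (slope_pos a ha) as Hk.
  apply diagonal_complete_end with (k1 := fun s => Derive U s / 2)
    (k2 := fun s => 2 / 3 * (U s + u0 alpha b0 s)) (k3 := fun s => 2 / 3 * (U s - u0 alpha b0 s))
    (kappa := sqrt (slope a / 2)).
  - intros s x y. apply metric_sol_diagonal.
  - intros s Hs. assert (Hs' : sc < s) by lra. destruct (global_u_positive s Hs') as [Hu Hu0].
    destruct (Hsol s Hs' I) as (_ & Hd & _).
    rewrite hu0. destruct hsg as [-> | ->]; repeat split; lra.
  - intros s Hs. assert (Hs' : sc < s) by lra. destruct (Hsol s Hs' I) as (_ & _ & _ & Hd & _).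
    apply is_derive_continuity_pt in Hd.
    assert (Hcu : continuity_pt (u0 alpha b0) s).
    { eapply is_derive_continuity_pt, is_derive_u0. }
    assert (Hconst : forall k, continuity_pt (fun _ => k) s)
      by (intros; now apply continuity_pt_const).
    split; [|split].
    + apply continuous_pt.
      apply continuous_ext_loc with (g := fun s => slope a / 2 * (1 + z (s + shift a b))).
      * generalize (open_gt sc s Hs'). apply filter_imp. intros y Hy.
        destruct (sol_speed a b sc p_infty U Phi ha Hsol y Hy I) as (_ & Ez & _).
        assert (E : slope a / 2 * (1 + z (y + shift a b)) = Derive U y / 2)
          by (rewrite Ez; unfold z; field).
        exact E.
      * apply continuous_pt. apply continuity_pt_mult; [apply Hconst|].
        apply continuity_pt_plus; [apply Hconst|].
        apply (continuity_pt_comp (fun s => s + shift a b) z).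
        -- apply continuity_pt_plus; [apply derivable_continuous_pt, derivable_pt_id|apply Hconst].
        -- apply (reduced_continuity p), global_reduced; now apply global_shift.
    + apply continuity_pt_mult; [apply Hconst|]. now apply continuity_pt_plus.
    + apply continuity_pt_mult; [apply Hconst|]. now apply continuity_pt_minus.
  - apply sqrt_lt_R0. lra.
  - intros s Hs. assert (Hs' : sc < s) by lra. rewrite pow2_sqrt by lra.
    destruct (sol_speed a b sc p_infty U Phi ha Hsol s Hs' I) as (_ & -> & _).
    destruct (global_positive (s + shift a b)) as [Hz _]; [now apply global_shift|].
    fold z. nra.
Qed.

(** The radius is dictated by [r ^ 3 = exp (3 s + 2 l)], the limiting size of [Omega]. As [r' = r],
    all coefficients of the [omega] difference are compared with [r ^ 2], and the [omega_se0] term,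
    absent on the cone, is [u0 / U] times the bounded [U / r ^ 2]. *)
Lemma global_approaches_cone (l : R) :
  filterlim Phi at_infinity (locally l) -> approaches_cone alpha b0 U Phi l.
Proof.
  intros Hl. destruct (global_cone_factor l Hl) as [Hw Hw'].
  pose proof global_ratio as Hrho.
  assert (Hk : forall v : R, filterlim (fun _ : R => v) at_infinity (locally v))
    by (intros; apply filterlim_const).
  set (r := fun s => exp (s + 2 * l / 3)) in *.
  assert (Hdr : forall s, Derive r s = r s).
  { intros s. apply is_derive_unique. unfold r. auto_derive; [easy|ring]. }
  assert (Hr : forall s, 0 < r s) by (intros; apply exp_pos).
  assert (Habs : forall (f : R -> R) (v : R), filterlim f at_infinity (locally v) ->
    filterlim (fun s => Rabs (f s - v)) at_infinity (locally 0)).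
  { intros f v Hf. rewrite <- Rabs_R0. replace 0 with (v + - v) by ring.
    apply (filterlim_continuity_pt at_infinity (fun s => f s - v) Rabs); [apply Rcontinuity_abs|].
    apply filterlim_Rplus; [typeclasses eauto | exact Hf | apply Hk]. }
  exists r, sc. split; [|split; [|cbv zeta; split; [|split]]].
  - intros s _. rewrite Hdr. split; [apply Hr|]. split; [apply Hr|].
    intros n. apply ex_derive_n_exp_shift.
  - apply (is_lim_comp exp (fun s => s + 2 * l / 3) p_infty p_infty p_infty).
    + apply is_lim_exp_p.
    + apply filterlim_shift_infinity.
    + exists 0. easy.
  - apply (squeeze_zero _ (fun s => 12 * Rabs (Derive U s / 2 / r s ^ 2 - 1) +
       24 * (Rabs (U s / r s ^ 2 - 1) + Rabs (u0 a b s / U s - 0) * (U s / r s ^ 2))) sc).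
    + intros s Hs. split; [apply sqrt_pos|].
      pose proof (Hr s) as Hrs. assert (H2 : 0 < r s ^ 2) by now apply pow_lt.
      destruct (global_u_positive s Hs) as [Hu _].
      eapply Rle_trans.
      { apply (norm2_cone_le (r s) (Derive r s) (/ 2 * Derive U s - r s * Derive r s) (U s - r s ^ 2)
                 (u0 alpha b0 s)); [exact Hrs | rewrite Hdr; exact Hrs |].
        intros x y. unfold omega_sol, omega_cone, wedge. ring. }
      rewrite Hdr. right. f_equal; f_equal.
      * replace (/ 2 * Derive U s - r s * r s) with ((Derive U s / 2 / r s ^ 2 - 1) * r s ^ 2)
          by (field; lra).
        rewrite Rabs_mult, (Rabs_right (r s ^ 2)) by lra. field. lra.
      * replace (Rabs (u0 alpha b0 s)) with (Rabs (u0 a b s)).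
        2: { rewrite hu0. destruct hsg as [-> | ->].
             - now rewrite Rmult_1_l.
             - replace (-1 * u0 a b s) with (- u0 a b s) by ring. now rewrite Rabs_Ropp. }
        replace (U s - r s ^ 2) with ((U s / r s ^ 2 - 1) * r s ^ 2) at 1 by (field; lra).
        replace (Rabs (u0 a b s)) with (Rabs (u0 a b s / U s - 0) * U s).
        2: { rewrite <- (Rabs_right (U s)) at 2 by lra. rewrite <- Rabs_mult. f_equal. field. lra. }
        rewrite (Rabs_mult _ (r s ^ 2)), (Rabs_right (r s ^ 2)) by lra. field. lra.
    + refine (eq_ind (12 * 0 + 24 * (0 + 0 * 1)) (fun v => filterlim _ at_infinity (locally v))
                _ 0 _); [|ring].
      apply filterlim_Rplus; [typeclasses eauto | |].
      * apply filterlim_Rmult; [typeclasses eauto | apply Hk |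
          exact (Habs (fun s => Derive U s / 2 / r s ^ 2) 1 Hw')].
      * apply filterlim_Rmult; [typeclasses eauto | apply Hk |].
        apply filterlim_Rplus; [typeclasses eauto |
          exact (Habs (fun s => U s / r s ^ 2) 1 Hw) |].
        apply filterlim_Rmult; [typeclasses eauto |
          exact (Habs (fun s => u0 a b s / U s) 0 Hrho) | exact Hw].
  - apply (squeeze_zero _ (fun s => 720 * Rabs (exp (2 * Phi s - 2 * l) - 1)) sc).
    + intros s Hs. split; [apply sqrt_pos|].
      pose proof (Hr s) as Hrs. assert (H2 : 0 < r s ^ 2) by now apply pow_lt.
      assert (H3 : 0 < r s ^ 3) by now apply pow_lt.
      set (A := exp (2 * Phi s) * exp (3 * s) - r s ^ 3).
      eapply Rle_trans.
      { apply (norm3_cone_le (r s) (Derive r s) A A); [exact Hrs | rewrite Hdr; exact Hrs |].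
        intros x y w. unfold Omega_sol, Omega_cone, wedge12, theta1, A. rewrite Hdr.
        rewrite !RtoC_mult, !RtoC_minus, !RtoC_mult, !RtoC_pow. simpl. ring. }
      rewrite Hdr. right.
      assert (E : A = (exp (2 * Phi s - 2 * l) - 1) * r s ^ 3).
      { unfold A. assert (E3 : r s ^ 3 = exp (3 * s) * exp (2 * l)).
        { unfold r. rewrite <- exp_plus.
          replace (3 * s + 2 * l) with (INR 3 * (s + 2 * l / 3)) by (simpl; field).
          now rewrite exp_INR_mult. }
        rewrite E3. unfold Rminus. rewrite (exp_plus (2 * Phi s)), exp_Ropp. pose proof (exp_pos (2 * l)).
        field. lra. }
      rewrite E, Rabs_mult, (Rabs_right (r s ^ 3)) by lra. field. lra.
    + replace 0 with (720 * 0) by ring.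
      apply filterlim_Rmult; [typeclasses eauto | apply Hk |].
      apply (Habs (fun s => exp (2 * Phi s - 2 * l)) 1).
      rewrite <- exp_0. replace 0 with (2 * l + - (2 * l)) by ring.
      apply (filterlim_continuity_pt at_infinity (fun s => 2 * Phi s - 2 * l) exp).
      * apply derivable_continuous_pt, derivable_pt_exp.
      * apply filterlim_Rplus; [typeclasses eauto | | apply Hk].
        apply filterlim_Rmult; [typeclasses eauto | apply Hk | exact Hl].
  - exact (Habs Phi l Hl).
Qed.

End Global.

(** * The dilaton at infinity, the CV-MN solution and the theorem *)

Lemma limit_of_cone (alpha b : R) (u phi : R -> R) (l : R) :
  approaches_cone alpha b u phi l -> is_lim (fun s => Rabs (phi s - l)) p_infty 0.
Proof. intros (r & S0 & _ & _ & _ & _ & H). exact H. Qed.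

(** By [comparison], the solution for [c'] has larger [p], [q] and [z], hence a larger dilaton at
    one point. For [x > 0] the rate [- x / (p q)] is less negative for [c'], so the initial gap
    never shrinks and the limits are strictly ordered. *)
Lemma dilaton_increasing (a b c c' : R) (U Phi U' Phi' : R -> R) (l l' : R) :
  0 < a -> 1 < c -> c < c' ->
  squashed_solution_pos a b c p_infty U Phi ->
  squashed_solution_pos a b c' p_infty U' Phi' ->
  is_lim (fun s => Rabs (Phi s - l)) p_infty 0 ->
  is_lim (fun s => Rabs (Phi' s - l')) p_infty 0 ->
  l < l'.
Proof.
  intros Ha Hc Hcc Hsq Hsq' Hl Hl'.
  pose proof (s_sing_shift a b c Ha) as Hs. pose proof (s_sing_shift a b c' Ha) as Hs'.
  assert (Hcmp : forall x, - c / 6 < x ->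
     z_of a b U x < z_of a b U' x /\ p_of a b U x < p_of a b U' x).
  { intros x Hx. apply (comparison c c'); try lra.
    - apply (squashed_singular_start a b c p_infty U Phi); try easy; lra.
    - apply (squashed_singular_start a b c' p_infty U' Phi'); try easy; lra.
    - intros y Hy. apply (squashed_reduced a b c p_infty U Phi); try easy; lra.
    - intros y Hy. apply (squashed_reduced a b c' p_infty U' Phi'); try easy; lra. }
  destruct Hsq as [Hsol _]. destruct Hsq' as [Hsol' _].
  (* The point [x = 1], to the right of both singular ends and of the zero of [u0]. *)
  set (s0 := 1 - shift a b).
  assert (Hgt : forall s, s0 <= s -> s_sing a b c < s /\ s_sing a b c' < s /\ 1 <= s + shift a b)
    by (unfold s0; intros; lra).
  assert (H0 : Phi s0 < Phi' s0).
  { destruct (Hgt s0 (Rle_refl _)) as (G1 & G2 & G3).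
    destruct (sol_p_q a b _ p_infty U Phi Ha Hsol s0 G1 I) as (P1 & P2 & _).
    destruct (sol_speed a b _ p_infty U Phi Ha Hsol s0 G1 I) as (_ & _ & P3 & E).
    destruct (sol_speed a b _ p_infty U' Phi' Ha Hsol' s0 G2 I) as (_ & _ & P3' & E').
    destruct (Hcmp (s0 + shift a b) ltac:(lra)) as [C1 C2]. cbv zeta in *.
    set (x := s0 + shift a b) in *.
    assert (Hlt : exp (4 * Phi s0) < exp (4 * Phi' s0)).
    { rewrite E, E'. pose proof (exp_pos (6 * s0)).
      assert (Hk : 0 < slope a ^ 3) by (apply pow_lt, slope_pos, Ha).
      apply Rmult_lt_compat_r; [apply Rinv_0_lt_compat; lra|].
      apply Rmult_gt_0_lt_compat; nra.
    }
    apply exp_lt_inv in Hlt. lra. }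
  assert (Hinc : forall s, s0 <= s -> Phi' s0 - Phi s0 <= Phi' s - Phi s).
  { intros s Hss.
    set (df := fun s => - ((s + shift a b) / (p_of a b U' (s + shift a b) *
         (p_of a b U' (s + shift a b) + 2 * (s + shift a b)))) -
       - ((s + shift a b) / (p_of a b U (s + shift a b) *
         (p_of a b U (s + shift a b) + 2 * (s + shift a b))))).
    assert (Hd : forall t, s0 <= t -> is_derive (fun s => Phi' s - Phi s) t (df t)).
    { intros t Ht. destruct (Hgt t Ht) as (G1 & G2 & _).
      apply is_derive_Rminus.
      - now apply (sol_phi_derive a b _ p_infty U' Phi' Ha Hsol' t).
      - now apply (sol_phi_derive a b _ p_infty U Phi Ha Hsol t). }
    apply (nondecreasing_on _ df s0 s Hss
        (fun t Ht => is_derive_continuity_pt _ _ _ (Hd t (proj1 Ht)))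
        (fun t Ht => Hd t (Rlt_le _ _ (proj1 Ht)))).
    intros t Ht. destruct (Hgt t ltac:(lra)) as (G1 & G2 & G3).
    destruct (sol_p_q a b _ p_infty U Phi Ha Hsol t G1 I) as (P1 & P2 & _).
    destruct (Hcmp (t + shift a b) ltac:(lra)) as [_ C2]. cbv zeta in *. unfold df.
    set (x := t + shift a b) in *.
    assert (Hq : p_of a b U x * (p_of a b U x + 2 * x) <= p_of a b U' x * (p_of a b U' x + 2 * x)) by nra.
    assert (x / (p_of a b U' x * (p_of a b U' x + 2 * x)) <= x / (p_of a b U x * (p_of a b U x + 2 * x)));
      [|lra].
    apply Rmult_le_compat_l; [lra|]. apply Rinv_le_contravar; [|exact Hq].
    now apply Rmult_lt_0_compat. }
  apply is_lim_spec in Hl, Hl'.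
  assert (He : 0 < (Phi' s0 - Phi s0) / 4) by lra.
  destruct (Hl (mkposreal _ He)) as [M HM]. destruct (Hl' (mkposreal _ He)) as [M' HM'].
  set (s := Rmax s0 (Rmax M M' + 1)).
  assert (Hsb : s0 <= s /\ M < s /\ M' < s).
  { unfold s. pose proof (Rmax_l s0 (Rmax M M' + 1)). pose proof (Rmax_r s0 (Rmax M M' + 1)).
    pose proof (Rmax_l M M'). pose proof (Rmax_r M M'). lra. }
  specialize (HM s ltac:(lra)). specialize (HM' s ltac:(lra)). specialize (Hinc s ltac:(lra)).
  rewrite Rminus_0_r, Rabs_Rabsolu in HM, HM'. simpl in HM, HM'.
  apply Rabs_def2 in HM, HM'. lra.
Qed.

(** * The CV-MN solution *)

Lemma smooth_up_to_0_const (eps k : R) : smooth_up_to_0 eps (fun _ => k).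
Proof.
  intros n. split; [intros; apply ex_derive_n_const|].
  destruct n as [|n]; [exists k; change (filterlim (fun _ : R => k) (at_right 0) (locally k)); apply filterlim_const|].
  exists 0. apply (filterlim_ext (fun _ => 0)); [|apply filterlim_const].
  intros t. now rewrite Derive_n_const.
Qed.

Definition u_CVMN_pos (a b s : R) : R := 9 / 2 * a * s + b + 3 / 2 * a.

Lemma u_of_CVMN (a b s : R) : 0 < a -> u_of a b (fun _ => 1 / 3) s = u_CVMN_pos a b s.
Proof.
  intros Ha. unfold u_of, u_CVMN_pos.
  rewrite Rmult_plus_distr_l, <- (u0_shift a b s Ha). unfold u0, slope. field.
Qed.

Lemma exp_2phi_of_CVMN (a b s : R) : 0 < a -> - (1) / 6 < s + shift a b ->
  phi_of a b (fun _ => 1 / 3) (fun _ => 0) s = / 2 * ln (exp_2phi_CVMN_pos a b s) /\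
  0 < exp_2phi_CVMN_pos a b s.
Proof.
  intros Ha Hs. pose proof (slope_pos a Ha) as Hk.
  assert (E1 : 9 / 2 * a * s + b + 3 / 4 * a = slope a * (s + shift a b + 1 / 6)).
  { rewrite Rmult_plus_distr_l, <- (u0_shift a b s Ha). unfold u0, slope. field. }
  assert (Hpos : 0 < slope a * (s + shift a b + 1 / 6)) by (apply Rmult_lt_0_compat; lra).
  set (A := exp_2phi_CVMN_pos a b s).
  assert (HA : 0 < A).
  { unfold A, exp_2phi_CVMN_pos. rewrite E1.
    repeat apply Rmult_lt_0_compat; try lra; try apply exp_pos.
    - apply Rinv_0_lt_compat, sqrt_lt_R0. lra.
    - now apply sqrt_lt_R0. }
  split; [|exact HA].
  (* [phi_of] is a quarter of the logarithm of [exp (4 phi)], hence the comparison with the square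
     of [exp (2 phi)]. *)
  assert (E2 : slope a ^ 3 * (1 + 0) * (1 / 3 * (1 / 3 + 2 * (s + shift a b))) / (2 * exp (6 * s))
               = A * A).
  { assert (E6 : exp (- (3 * s)) * exp (- (3 * s)) = / exp (6 * s)).
    { rewrite <- exp_plus, <- exp_Ropp. f_equal. ring. }
    unfold A, exp_2phi_CVMN_pos. rewrite E1.
    set (y := slope a * (s + shift a b + 1 / 6)) in *.
    replace (/ sqrt 3 * (9 / 2 * a) * exp (- (3 * s)) * sqrt y *
      (/ sqrt 3 * (9 / 2 * a) * exp (- (3 * s)) * sqrt y)) with
      (/ (sqrt 3 * sqrt 3) * slope a ^ 2 * (exp (- (3 * s)) * exp (- (3 * s))) * (sqrt y * sqrt y))
      by (unfold slope; field; apply Rgt_not_eq, sqrt_lt_R0; lra).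
    rewrite !sqrt_sqrt, E6 by lra. unfold y. pose proof (exp_pos (6 * s)). field. lra. }
  unfold phi_of. cbv zeta. rewrite E2, ln_mult by exact HA. field.
Qed.

(** The constants [p = 1 / 3] and [z = 0] solve the reduced system because [6 - 2 / p = 0]. For them
    the leading terms [u_c] and [phi_c] are already exact, so both remainders [X] and [Y] vanish. *)
Lemma CVMN_squashed (a b : R) (u phi : R -> R) :
  0 < a -> (forall s, u s = u_CVMN_pos a b s) ->
  (forall s, phi s = / 2 * ln (exp_2phi_CVMN_pos a b s)) ->
  squashed_solution_pos a b 1 p_infty u phi.
Proof.
  intros Ha Hu Hphi. pose proof (s_sing_shift a b 1 Ha) as Hs. pose proof (slope_pos a Ha) as Hk.
  assert (Hsol : solves_on a b (s_sing a b 1) p_infty (u_of a b (fun _ => 1 / 3))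
                   (phi_of a b (fun _ => 1 / 3) (fun _ => 0))).
  { apply solves_of_reduced; [exact Ha|]. intros s H1 _.
    refine (conj _ (conj _ (conj _ (conj _ _)))); try lra.
    - apply is_derive_Rconst.
    - replace (zfield _ _ _) with 0.
      + apply is_derive_Rconst.
      + rewrite zfield_at_0. field. }
  assert (Hphi' : forall s, s_sing a b 1 < s ->
            phi s = phi_of a b (fun _ => 1 / 3) (fun _ => 0) s).
  { intros s H1. rewrite Hphi. symmetry. apply exp_2phi_of_CVMN; [exact Ha|lra]. }
  assert (Hu' : forall s, u s = u_of a b (fun _ => 1 / 3) s).
  { intros s. now rewrite Hu, u_of_CVMN. }
  split.
  - intros s H1 H2. destruct (Hsol s H1 H2) as (S1 & S2 & S3 & S4 & S5).
    rewrite (Derive_ext _ _ s Hu'), Hu', (Hphi' s H1).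
    refine (conj S1 (conj S2 (conj S3 (conj _ _)))).
    + apply is_derive_ext with (u_of a b (fun _ => 1 / 3)); [intros; now rewrite Hu'|exact S4].
    + apply is_derive_ext_loc with (phi_of a b (fun _ => 1 / 3) (fun _ => 0)); [|exact S5].
      generalize (open_gt (s_sing a b 1) s H1). apply filter_imp. intros y Hy. now rewrite Hphi'.
  - exists 1, (fun _ => 0), (fun _ => 0). split; [lra|].
    split; [apply smooth_up_to_0_const|]. split; [apply smooth_up_to_0_const|].
    intros t Ht. cbv zeta. split.
    + rewrite Hu. unfold u_CVMN_pos, u_c, u0. ring.
    + rewrite (Hphi' (s_sing a b 1 + t)) by lra.
      unfold phi_of, phi_c. cbv zeta. rewrite (u_c_sqr a b 1 _ Ha). fold (slope a).
      replace (s_sing a b 1 + t + shift a b) with (t - 1 / 6) by lra.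
      replace (s_sing a b 1 + t - s_sing a b 1) with t by ring.
      rewrite Rmult_0_r, !Rplus_0_r. match goal with |- ?x * ln ?A = ?x * ln ?B => replace A with B; [reflexivity|] end.
      pose proof (exp_pos (6 * (s_sing a b 1 + t))). field. lra.
Qed.

Lemma CVMN_unique (a b : R) (hi : Rbar) (u phi : R -> R) (s : R) :
  0 < a -> Rbar_lt (s_sing a b 1) hi -> squashed_solution_pos a b 1 hi u phi ->
  s_sing a b 1 < s -> Rbar_lt s hi ->
  u s = u_CVMN_pos a b s /\ exp (2 * phi s) = exp_2phi_CVMN_pos a b s.
Proof.
  intros Ha Hhi Hsq H1 H2. pose proof (s_sing_shift a b 1 Ha) as Hs.
  destruct (solution_c1 (p_of a b u) (z_of a b u) (s + shift a b)) as [Ez Ep].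
  - apply (squashed_singular_start a b 1 hi u phi); try easy. lra.
  - lra.
  - intros y Hy. apply (squashed_reduced a b 1 hi u phi); try easy.
    apply Rbar_le_lt_trans with s; [simpl; lra|exact H2].
  - destruct Hsq as [Hsol _].
    rewrite (sol_u a b _ hi u phi Ha Hsol s H1 H2) at 1.
    rewrite (sol_phi a b _ hi u phi Ha Hsol s H1 H2).
    destruct (exp_2phi_of_CVMN a b s Ha ltac:(lra)) as [E HA].
    split.
    + rewrite <- u_of_CVMN by exact Ha. unfold u_of. now rewrite Ep.
    + replace (phi_of a b (p_of a b u) (z_of a b u) s)
        with (phi_of a b (fun _ => 1 / 3) (fun _ => 0) s)
        by (unfold phi_of; cbv zeta; now rewrite Ep, Ez).
      rewrite E, <- Rmult_assoc, Rinv_r, Rmult_1_l by lra. now apply exp_ln.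
Qed.

Lemma squashed_not_global (a b c : R) (U Phi : R -> R) :
  0 < a -> 0 < c < 1 -> ~ squashed_solution_pos a b c p_infty U Phi.
Proof.
  intros Ha Hc Hsq.
  assert (Hs : singular_start c (p_of a b U) (z_of a b U)).
  { apply (squashed_singular_start a b c p_infty U Phi Ha); [lra | exact I | exact Hsq]. }
  apply (no_global_solution c _ _ Hc Hs).
  intros x Hx. now apply (squashed_reduced a b c p_infty U Phi).
Qed.

(* Both signs of [alpha'] reduce to [a = |alpha'|]; the sign only remains in
   the [u0] that enters the metric. *)
Lemma positive_parameters (alpha b : R) (halpha : alpha <> 0) :
  exists a b' sg, 0 < a /\ (sg = 1 \/ sg = -1) /\
    (forall s, u0 alpha b s = sg * u0 a b' s) /\
    (forall c, s_sing alpha b c = s_sing a b' c) /\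
    (forall c hi u phi, squashed_solution alpha b c hi u phi <->
                        squashed_solution_pos a b' c hi u phi) /\
    (forall s, u_CVMN alpha b s = u_CVMN_pos a b' s) /\
    (forall s, exp_2phi_CVMN alpha b s = exp_2phi_CVMN_pos a b' s).
Proof.
  unfold squashed_solution, u_CVMN, exp_2phi_CVMN, u_CVMN_pos, u0, s_sing.
  destruct (Rlt_dec 0 alpha) as [H|H].
  - exists alpha, b, 1. split; [lra|]. split; [now left|]. split; [intros; ring|].
    split; [easy|]. split; [easy|]. now split.
  - exists (- alpha), (- b), (-1). split; [lra|]. split; [now right|]. split; [intros; ring|].
    split; [intros; field; exact halpha|]. split; [easy|]. now split.
Qed.

Theorem theorem5p2 (alpha b : R) (halpha : alpha <> 0) :
  (* (i) *)
  (forall (c : R) (hi : Rbar) (u phi : R -> R),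
     1 < c -> Rbar_lt (s_sing alpha b c) hi ->
     squashed_solution alpha b c hi u phi ->
     exists U Phi : R -> R,
       extends alpha b c hi u phi U Phi /\
       complete_metric alpha b c U Phi /\
       exists phi_inf : R, approaches_cone alpha b U Phi phi_inf) /\
  (* (ii) *)
  (forall c c' phi_inf phi_inf' : R,
     1 < c -> c < c' ->
     asymptotic_dilaton alpha b c phi_inf ->
     asymptotic_dilaton alpha b c' phi_inf' ->
     phi_inf < phi_inf') /\
  (* (iii) *)
  (squashed_solution alpha b 1 p_infty (u_CVMN alpha b) (phi_CVMN alpha b) /\
   forall (hi : Rbar) (u phi : R -> R),
     Rbar_lt (s_sing alpha b 1) hi ->
     squashed_solution alpha b 1 hi u phi ->
     forall s, s_sing alpha b 1 < s -> Rbar_lt s hi ->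
       u s = u_CVMN alpha b s /\ exp (2 * phi s) = exp_2phi_CVMN alpha b s) /\
  (* (iv) *)
  (forall (c : R) (hi : Rbar) (u phi : R -> R),
     0 < c -> c < 1 -> Rbar_lt (s_sing alpha b c) hi ->
     squashed_solution alpha b c hi u phi ->
     ~ forward_complete alpha b c hi u phi).
Proof.
  destruct (positive_parameters alpha b halpha)
    as (a & b' & sg & Ha & Hsg & Hu0 & Hss & Hsq & Hu & He).
  split; [|split; [|split]].
  - intros c hi u phi Hc Hhi Hs. rewrite Hss in Hhi. apply Hsq in Hs.
    destruct (squashed_extension a b' c hi u phi Ha Hc Hhi Hs) as (U & Phi & HU & Heq).
    exists U, Phi. split; [|split].
    + split; [now apply Hsq|]. intros s. rewrite Hss. apply Heq.
    + intros s1 H1. rewrite Hss in H1.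
      now apply (global_complete a b' c U Phi Ha Hc HU alpha b sg Hsg Hu0).
    + destruct (global_phi_limit a b' c U Phi Ha Hc HU) as [l Hl]. exists l.
      now apply (global_approaches_cone a b' c U Phi Ha Hc HU alpha b sg Hsg Hu0).
  - intros c c' l l' Hc Hcc (U & Phi & HU & Hl) (U' & Phi' & HU' & Hl').
    apply Hsq in HU, HU'. apply limit_of_cone in Hl, Hl'.
    exact (dilaton_increasing a b' c c' U Phi U' Phi' l l' Ha Hc Hcc HU HU' Hl Hl').
  - split.
    + apply Hsq, CVMN_squashed; [exact Ha | exact Hu |].
      intros s. unfold phi_CVMN. now rewrite He.
    + intros hi u phi Hhi Hs s H1 H2. rewrite Hss in Hhi, H1. apply Hsq in Hs.
      rewrite Hu, He. now apply (CVMN_unique a b' hi).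
  (* Forward completeness includes an extension to the whole half-line, and this alone is impossible
     for [c < 1]. *)
  - intros c hi u phi Hc0 Hc1 _ _ (U & Phi & [HU _] & _). apply Hsq in HU.
    now apply (squashed_not_global a b' c U Phi Ha (conj Hc0 Hc1)).
Qed.
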